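(* Let $p\in[1,\infty]$. Given a function $f\in W^{k+2,\infty}(D)$, defined on some open bulk region $D\subset\mathbb R^d$, and any vector-valued finite element functions $\phi_h,\psi_h\in S_h(\hat\Gamma_{h,*}^0)^d$ whose ranges are contained in $D$, we have $$\|(1-I_h)(f\circ\phi_h-f\circ\psi_h)\|_{L^p(\hat\Gamma_{h,*}^0)}\le Ch\|\phi_h-\psi_h\|_{L^p(\hat\Gamma_{h,*}^0)},$$ $$\|\nabla_{\hat\Gamma_{h,*}^0}(1-I_h)(f\circ\phi_h-f\circ\psi_h)\|_{L^p(\hat\Gamma_{h,*}^0)}\le Ch\|\phi_h-\psi_h\|_{W^{1,p}(\hat\Gamma_{h,*}^0)}.$$ Consequently, $$\|I_h(f\circ\phi_h-f\circ\psi_h)\|_{L^p(\hat\Gamma_{h,*}^0)}\le C\|\phi_h-\psi_h\|_{L^p(\hat\Gamma_{h,*}^0)},$$ $$\|I_h(f\circ\phi_h-f\circ\psi_h)\|_{W^{1,p}(\hat\Gamma_{h,*}^0)}\le C\|\phi_h-\psi_h\|_{W^{1,p}(\hat\Gamma_{h,*}^0)}.$$ The constants $C$ depend on $\|f\|_{W^{k+2,\infty}(D)}$, $\|\phi_h\|_{W^{1,\infty}(\hat\Gamma_{h,*}^0)}$ and $\|\psi_h\|_{W^{1,\infty}(\hat\Gamma_{h,*}^0)}$.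
   Context: $d\in\{2,3\}$, $k\ge3$ is the finite element degree. $\Gamma^0\subset\mathbb R^d$ is a sufficiently smooth closed hypersurface contained in a bounded domain $\Omega$, with distance projection $a^0$ defined on a neighbourhood of $\Gamma^0$. $\Gamma_{h,\rm f}^0$ is a piecewise flat closed surface with vertices on $\Gamma^0$, a union of $(d-1)$-facets of a shape-regular, quasi-uniform simplicial triangulation of $\Omega$ with mesh size $h$. $\hat\Gamma_{h,*}^0$ is the curved interface of degree $k$ parametrized over $\Gamma_{h,\rm f}^0$ by the degree-$k$ Lagrange interpolant $I_h(a^0|_{\Gamma_{h,\rm f}^0})$; its elements are $K=F_K(\hat K)$ with $F_K$ an $\mathbb R^d$-valued polynomial of degree $\le k$ on the reference simplex $\hat K$ of dimension $d-1$. $S_h(\hat\Gamma_{h,*}^0)=\{g\in H^1(\hat\Gamma_{h,*}^0):g|_K\circ F_K\in\mathbb P^k(\hat K)\ \forall K\}$, and $I_h$ denotes the nodal Lagrange interpolation of degree $k$ onto $S_h(\hat\Gamma_{h,*}^0)$ (defined by pull-back to $\hat K$). The shape-regularity of the initial triangulation is fixed (standing assumption $\|I_h(a^0|_{\Gamma_{h,\rm f}^0})\|_{H_h^k(\Gamma_{h,\rm f}^0)}\le C_0$, $H_h^k$ the elementwise Sobolev space); constants are independent of $h$.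
   Formalization: The mesh size h is assumed sufficiently small (h ≤ h0, depending only on the geometric data), and the open region D is assumed locally quasiconvex (close points are joined in D by paths of comparable length, as in convex or bounded Lipschitz sets); C may depend on D. *)

(* Defs.v *)
From HB Require Import structures.
From mathcomp Require Import all_boot all_order all_algebra.
From mathcomp Require Import all_classical all_reals all_analysis ess_sup_inf.
Set Implicit Arguments. Unset Strict Implicit. Unset Printing Implicit Defensive.
Import Order.TTheory GRing.Theory Num.Theory.
Import numFieldNormedType.Exports.
Local Open Scope classical_set_scope.
Local Open Scope ring_scope.

(* Lebesgue measure on R^n, on the measurable type of n-tuples: R^(n+1) is the
   image of the product R x R^n under cons. *)
Section lebesgue_cons.
Context d (T : measurableType d) (R : realType) (n : nat).
Variable m1 : {sigma_finite_measure set T -> \bar R}.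
Variable mu : {sigma_finite_measure set (n.-tuple T) -> \bar R}.

Definition tcons (p : T * n.-tuple T) : n.+1.-tuple T :=
  [the n.+1.-tuple T of p.1 :: p.2].

Lemma measurable_tcons : measurable_fun [set: (T * n.-tuple T)%type] tcons.
Proof. exact: measurable_cons. Qed.

Definition leb_cons : set (n.+1.-tuple T) -> \bar R :=
  pushforward (m1 \x mu)%E tcons.

Let leb_cons0 : (leb_cons set0 = 0)%E.
Proof. by rewrite /leb_cons /pushforward preimage_set0 measure0. Qed.

Let leb_cons_ge0 A : (0 <= leb_cons A)%E.
Proof. by rewrite /leb_cons /pushforward; apply: measure_ge0. Qed.

Let leb_cons_sigma_additive : semi_sigma_additive leb_cons.
Proof.
move=> F mF tF mUF; rewrite /leb_cons /pushforward preimage_bigcup.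
apply: measure_semi_sigma_additive.
- by move=> i; rewrite -[X in measurable X]setTI; exact: measurable_tcons.
- apply/trivIsetP => /= i j _ _ ij; rewrite -preimage_setI.
  by move/trivIsetP : tF => /(_ _ _ _ _ ij) ->//; rewrite preimage_set0.
- by rewrite -preimage_bigcup -[X in measurable X]setTI; exact: measurable_tcons.
Qed.

HB.instance Definition _ := isMeasure.Build _ _ _
  leb_cons leb_cons0 leb_cons_ge0 leb_cons_sigma_additive.

Let leb_cons_sigma_finite : sigma_finite setT leb_cons.
Proof.
have /sigma_finiteP[F [TF ndF Foo]] := sigma_finiteT m1.
have /sigma_finiteP[G [TG ndG Goo]] := sigma_finiteT mu.
pose u (t : n.+1.-tuple T) : T * n.-tuple T := (thead t, [tuple of behead t]).
have mu_u : measurable_fun setT u.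
  apply: measurable_fun_pair; first exact: measurable_tnth.
  exact: measurable_behead.
have uK : cancel tcons u.
  by case=> x t; rewrite /u theadE; congr pair; apply/val_inj.
exists (fun i => u @^-1` (F i `*` G i)).
  apply/seteqP; split=> // t _.
  have [i _ Fi] : (\bigcup_i F i) (u t).1 by rewrite -TF.
  have [j _ Gj] : (\bigcup_i G i) (u t).2 by rewrite -TG.
  exists (maxn i j) => //; split.
  - by move: Fi; exact/subsetPset/ndF/leq_maxl.
  - by move: Gj; exact/subsetPset/ndG/leq_maxr.
move=> i; have [mFi Fi] := Foo i; have [mGi Gi] := Goo i.
have mFG : measurable (F i `*` G i) by exact: measurableX.
split; first by rewrite -[X in measurable X]setTI; exact: mu_u.
rewrite /leb_cons /pushforward -comp_preimage.
rewrite (_ : u \o tcons = id); last by apply/funext => p /=; rewrite uK.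
by rewrite preimage_id product_measure1E// lte_mul_pinfty// ge0_fin_numE.
Qed.

HB.instance Definition _ := Measure_isSigmaFinite.Build _ _ _
  leb_cons leb_cons_sigma_finite.

End lebesgue_cons.

Fixpoint lebn (R : realType) (n : nat) :
    {sigma_finite_measure set (n.-tuple (measurableTypeR R)) -> \bar R} :=
  match n with
  | 0 => \d_([tuple] : 0.-tuple (measurableTypeR R))
  | n'.+1 => leb_cons (@lebesgue_measure R) (lebn R n')
  end.

Section euclidean.
Variables (R : realType) (n : nat).
Implicit Types (A U D : set 'rV[R]_n).

(* The library norm on row vectors is the sup norm. *)
Definition enorm (x : 'rV[R]_n) : R := Num.sqrt (\sum_i x 0 i ^+ 2).

Definition row_of_tuple (t : n.-tuple (measurableTypeR R)) : 'rV[R]_n :=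
  \row_i tnth t i.

Definition integral_on A (g : 'rV[R]_n -> \bar R) : \bar R :=
  (\int[lebn R n]_(t in row_of_tuple @^-1` A) g (row_of_tuple t))%E.

(* Extension by 0 outside A is harmless: this is only used with g >= 0. *)
Definition ess_sup_on A (g : 'rV[R]_n -> \bar R) : \bar R :=
  ess_sup (lebn R n) ((g \o row_of_tuple) \_ (row_of_tuple @^-1` A)).

Definition basis_vec (i : 'I_n) : 'rV[R]_n := delta_mx 0 i.

(* Iterated classical partial derivative in the directions listed in s. *)
Definition pderiv (s : seq 'I_n) (g : 'rV[R]_n -> R) : 'rV[R]_n -> R :=
  foldr (fun i (v : 'rV[R]_n -> R) => 'D_(basis_vec i) v) g s.

Definition C_class (m : nat) U (g : 'rV[R]_n -> R) : Prop :=
  forall s : seq 'I_n, (size s <= m)%N ->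
    (forall x, U x -> {for x, continuous (pderiv s g)}) /\
    ((size s < m)%N ->
      forall i x, U x -> derivable (pderiv s g) x (basis_vec i)).

Definition test_function D (chi : 'rV[R]_n -> R) : Prop :=
  (forall m, C_class m setT chi) /\
  exists K : set 'rV[R]_n,
    [/\ compact K, K `<=` D & forall x, ~ K x -> chi x = 0].

(* g s is the weak derivative of f in D in the directions listed in s. *)
Definition weak_derivatives (m : nat) D (f : 'rV[R]_n -> R)
    (g : seq 'I_n -> 'rV[R]_n -> R) : Prop :=
  (forall x, D x -> g [::] x = f x) /\
  forall s : seq 'I_n, (size s <= m)%N ->
    [/\ measurable_fun (row_of_tuple @^-1` D) (g s \o row_of_tuple),
        (ess_sup_on D (fun x => `|g s x|%:E) < +oo)%E &
        forall chi, test_function D chi ->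
          integral_on D (fun x => (f x * pderiv s chi x)%:E) =
          ((-1) ^+ size s)%:E * integral_on D (fun x => (g s x * chi x)%:E)]%E.

(* Norm of W^{m,oo}(D): the maximum over all derivatives of order <= m of the
   essential suprema; +oo when f is not in W^{m,oo}(D). *)
Definition sobolev_infty_norm (m : nat) D (f : 'rV[R]_n -> R) : \bar R :=
  ereal_inf
    [set ereal_sup [set ess_sup_on D (fun x => `|g s x|%:E)
                   | s in [set s : seq 'I_n | (size s <= m)%N]]
    | g in weak_derivatives m D f].

(* Regularity of the bulk region that makes W^{1,oo}(D) functions Lipschitz:
   close points are joined inside D by a path of comparable length.  Convex sets
   (any delta, lambda = 1) and bounded Lipschitz open sets satisfy it. *)
Definition locally_quasiconvex D : Prop :=
  exists delta lambda : R, 0 < delta /\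
    forall x y, D x -> D y -> enorm (x - y) < delta ->
      exists gamma : R -> 'rV[R]_n,
        [/\ gamma 0 = x, gamma 1 = y,
            (forall t, 0 <= t <= 1 -> D (gamma t)) &
            forall s t, 0 <= s <= 1 -> 0 <= t <= 1 ->
              enorm (gamma s - gamma t) <= lambda * enorm (x - y) * `|s - t|].

Definition bounded_domain (Omega : set 'rV[R]_n) : Prop :=
  [/\ Omega !=set0, open Omega, connected Omega & bounded_set Omega].

Definition closed_hypersurface (m : nat) (Gamma : set 'rV[R]_n) : Prop :=
  [/\ Gamma !=set0, compact Gamma &
      forall x, Gamma x -> exists (U : set 'rV[R]_n) (g : 'rV[R]_n -> R),
        [/\ open U /\ U x, C_class m U g,
            exists i, 'D_(basis_vec i) g x != 0 &
            forall y, U y -> (Gamma y <-> g y = 0)]].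

(* a is the nearest-point projection onto Gamma, well defined and of class C^m on
   the neighbourhood N of Gamma. *)
Definition distance_projection (m : nat) (Gamma N : set 'rV[R]_n)
    (a : 'rV[R]_n -> 'rV[R]_n) : Prop :=
  [/\ open N, Gamma `<=` N,
      (forall x, N x -> Gamma (a x) /\
        forall y, Gamma y -> y <> a x -> enorm (x - a x) < enorm (x - y)) &
      forall j, C_class m N (fun x => a x 0 j)].

Definition ref_simplex : set 'rV[R]_n :=
  [set xi | (forall i, 0 <= xi 0 i) /\ \sum_i xi 0 i <= 1].

Definition in_Pk (k : nat) (q : 'rV[R]_n -> R) : Prop :=
  exists c : {ffun 'I_n -> 'I_k.+1} -> R, forall xi,
    q xi = \sum_(alpha : {ffun 'I_n -> 'I_k.+1} | (\sum_i alpha i <= k)%N)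
             c alpha * \prod_i xi 0 i ^+ alpha i.

Definition lagrange_nodes (k : nat) : set 'rV[R]_n :=
  [set xi | exists alpha : 'I_n -> nat,
      (\sum_i alpha i <= k)%N /\ xi = \row_i ((alpha i)%:R / k%:R)].

(* The polynomial of degree <= k with the values of g at the nodes (it exists and
   is unique for k >= 1; the 0 is the junk value of xget). *)
Definition lagrange (k : nat) (g : 'rV[R]_n -> R) : 'rV[R]_n -> R :=
  xget 0 [set q | in_Pk k q /\ forall xi, lagrange_nodes k xi -> q xi = g xi].

End euclidean.

(* Differential geometry of a parametrization P : R^m -> R^d; u is the pull-back
   by P of a function on the image of P. *)
Section parametrized.
Variables (R : realType) (m d : nat) (P : 'rV[R]_m -> 'rV[R]_d).

Definition jac (xi : 'rV[R]_m) : 'M[R]_(m, d) :=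
  \matrix_(i, j) 'D_(basis_vec R i) (fun eta => P eta 0 j) xi.

Definition gram (xi : 'rV[R]_m) : 'M[R]_m := jac xi *m (jac xi)^T.

Definition area_element (xi : 'rV[R]_m) : R := Num.sqrt (\det (gram xi)).

Definition tgrad (u : 'rV[R]_m -> R) (xi : 'rV[R]_m) : 'rV[R]_d :=
  (\row_i 'D_(basis_vec R i) u xi) *m invmx (gram xi) *m jac xi.

Definition tgrad_norm (u : 'rV[R]_m -> R) (xi : 'rV[R]_m) : R :=
  enorm (tgrad u xi).

Definition tgrad_norm_vec n (u : 'rV[R]_m -> 'rV[R]_n) (xi : 'rV[R]_m) : R :=
  Num.sqrt (\sum_j tgrad_norm (fun eta => u eta 0 j) xi ^+ 2).

Definition iter_tgrad (s : seq 'I_d) (u : 'rV[R]_m -> R) : 'rV[R]_m -> R :=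
  foldr (fun i v => fun xi => tgrad v xi 0 i) u s.

End parametrized.

(* A finite simplicial mesh of R^d given by its vertices and its d-simplices,
   together with a set of (d-1)-facets forming the discrete interface. *)
Record mesh (R : realType) (d : nat) := Mesh {
  nvert : nat;
  vert : 'I_nvert -> 'rV[R]_d;
  cells : {set {set 'I_nvert}};
  facets : {set {set 'I_nvert}} }.

Section mesh_theory.
Variables (R : realType) (d : nat) (T : mesh R d).
Implicit Types (S : {set 'I_(nvert T)}).

Definition hull S : set 'rV[R]_d :=
  [set x | exists w : 'I_(nvert T) -> R,
      [/\ forall i, 0 <= w i, \sum_(i in S) w i = 1 &
          x = \sum_(i in S) w i *: vert i]].

Definition diam S : R :=
  \big[Num.max/0]_(i in S) \big[Num.max/0]_(j in S) enorm (vert i - vert j).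

Definition mesh_size : R := \big[Num.max/0]_(S in cells T) diam S.

Definition triangulates (Omega : set 'rV[R]_d) : Prop :=
  [/\ forall S, S \in cells T -> #|S| = d.+1,
      closure Omega = \bigcup_(S in [set` cells T]) hull S &
      forall S S', S \in cells T -> S' \in cells T ->
        hull S `&` hull S' `<=` hull (S :&: S')].

Definition shape_regular (sigma : R) : Prop :=
  forall S, S \in cells T -> exists (c : 'rV[R]_d) (rho : R),
    [/\ 0 < rho, forall x, enorm (x - c) <= rho -> hull S x &
        diam S <= sigma * rho].

Definition quasi_uniform (tau : R) : Prop :=
  forall S, S \in cells T -> mesh_size <= tau * diam S.

Definition star_adjacent (i : 'I_(nvert T)) : rel {set 'I_(nvert T)} :=
  fun S S' => [&& S \in facets T, S' \in facets T, i \in S, i \in S' &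
                  #|S :&: S'| == d.-1].

(* The facets form a closed combinatorial (d-1)-manifold, d = 2, 3: each
   (d-2)-face lies in exactly two facets and vertex stars are connected. *)
Definition flat_interface (Gamma : set 'rV[R]_d) : Prop :=
  [/\ facets T != finset.set0,
      forall S, S \in facets T ->
        #|S| = d /\ exists2 S', S' \in cells T & S \subset S',
      forall S i, S \in facets T -> i \in S -> Gamma (vert i),
      forall E S : {set 'I_(nvert T)}, #|E| = d.-1 -> S \in facets T -> E \subset S ->
        #|finset (fun S' => (S' \in facets T) && (E \subset S'))| = 2 &
      forall i S S', S \in facets T -> S' \in facets T -> i \in S -> i \in S' ->
        connect (star_adjacent i) S S'].

Definition vertex_of S (j : nat) : 'rV[R]_d := nth 0 [seq vert i | i <- enum S] j.

Definition flat_map S (xi : 'rV[R]_d.-1) : 'rV[R]_d :=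
  (1 - \sum_i xi 0 i) *: vertex_of S 0
  + \sum_(i < d.-1) xi 0 i *: vertex_of S i.+1.

(* Elementwise description of functions on a parametrized surface: the facet S
   carries the pull-back of the function to the reference simplex. *)
Definition elementwise (V : Type) := {set 'I_(nvert T)} -> 'rV[R]_d.-1 -> V.

(* Integration over the open reference simplex, whose boundary is negligible. *)
Definition ref_open : set 'rV[R]_d.-1 := (@ref_simplex R d.-1)°.

(* Norms with respect to the surface measure, computed in the parametrizations
   P S; on the curved surface P S = F_S, on the flat one P S is affine. *)
Section norms.
Variable P : {set 'I_(nvert T)} -> 'rV[R]_d.-1 -> 'rV[R]_d.

Definition Lp_norm (p : \bar R) (u : elementwise R) : \bar R :=
  match p with
  | r%:E => ((\sum_(S in facets T)
        integral_on ref_open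
          (fun xi => (`|u S xi| `^ r * area_element (P S) xi)%:E)) `^ r^-1)%E
  | +oo%E => \big[maxe/0%E]_(S in facets T)
        ess_sup_on ref_open (fun xi => `|u S xi|%:E)
  | -oo%E => 0%E
  end.

Definition Lp_norm_grad p (u : elementwise R) : \bar R :=
  Lp_norm p (fun S => tgrad_norm (P S) (u S)).

Definition W1p_norm p (u : elementwise R) : \bar R :=
  (Lp_norm p u + Lp_norm_grad p u)%E.

Definition Lp_norm_vec n p (u : elementwise 'rV[R]_n) : \bar R :=
  Lp_norm p (fun S xi => enorm (u S xi)).

Definition W1p_norm_vec n p (u : elementwise 'rV[R]_n) : \bar R :=
  (Lp_norm_vec p u + Lp_norm p (fun S => tgrad_norm_vec (P S) (u S)))%E.

(* Elementwise H^k norm of a vector field: tangential derivative tensors of order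
   up to k, in the components of the ambient space. *)
Definition Hk_norm_vec n (k : nat) (u : elementwise 'rV[R]_n) : \bar R :=
  ((\sum_(S in facets T) \sum_(j < n) \sum_(l < k.+1) \sum_(s : l.-tuple 'I_d)
      integral_on ref_open (fun xi =>
        (iter_tgrad (P S) s (fun eta => u S eta 0 j) xi ^+ 2
         * area_element (P S) xi)%:E)) `^ 2^-1)%E.

End norms.

Section curved.
Variables (k : nat) (a : 'rV[R]_d -> 'rV[R]_d).

(* F_S: degree-k interpolant of the distance projection on the flat facet S. *)
Definition curved_map S (xi : 'rV[R]_d.-1) : 'rV[R]_d :=
  \row_j lagrange k (fun eta => a (flat_map S eta) 0 j) xi.

Definition curved_interface : set 'rV[R]_d :=
  \bigcup_(S in [set` facets T]) (curved_map S @` @ref_simplex R d.-1).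

Definition pull (V : Type) (g : 'rV[R]_d -> V) : elementwise V :=
  fun S xi => g (curved_map S xi).

(* H^1 on the curved interface, as the completion of the continuous, elementwise
   Lipschitz functions. *)
Definition elementwise_lipschitz (u : 'rV[R]_d -> R) : Prop :=
  {within curved_interface, continuous u} /\
  exists L : R, forall S xi eta, S \in facets T ->
    @ref_simplex R d.-1 xi -> @ref_simplex R d.-1 eta ->
    `|pull u S xi - pull u S eta| <= L * enorm (xi - eta).

Definition in_H1 (g : 'rV[R]_d -> R) : Prop :=
  exists u : nat -> 'rV[R]_d -> R,
    [/\ forall n, elementwise_lipschitz (u n),
        forall e : R, 0 < e -> exists N : nat, forall n, (N <= n)%N ->
          (Lp_norm curved_map 2%:E (pull (fun x => (u n x - g x)%R)) <= e%:E)%E &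
        forall e : R, 0 < e -> exists N : nat, forall n n',
          (N <= n)%N -> (N <= n')%N ->
          (Lp_norm_grad curved_map 2%:E (pull (fun x => (u n x - u n' x)%R))
             <= e%:E)%E].

(* Finite element functions are taken as pointwise defined (continuous)
   representatives, so that they can be composed with f. *)
Definition in_Sh (g : 'rV[R]_d -> R) : Prop :=
  in_H1 g /\
  forall S, S \in facets T -> exists2 q, in_Pk k q &
    forall xi, @ref_simplex R d.-1 xi -> pull g S xi = q xi.

Definition in_Sh_vec (g : 'rV[R]_d -> 'rV[R]_d) : Prop :=
  forall j, in_Sh (fun x => g x 0 j).

Definition interp (g : 'rV[R]_d -> R) : elementwise R :=
  fun S => lagrange k (pull g S).

Definition interp_error (g : 'rV[R]_d -> R) : elementwise R :=
  fun S xi => pull g S xi - interp g S xi.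

(* Standing assumptions on the initial mesh.  The last one bounds the elementwise
   H^k norm, over the flat surface, of the interpolated projection. *)
Definition admissible (Gamma Omega N : set 'rV[R]_d) (sigma tau C0 : R) : Prop :=
  [/\ triangulates Omega, shape_regular sigma /\ quasi_uniform tau,
      flat_interface Gamma, forall S, S \in facets T -> hull S `<=` N &
      (Hk_norm_vec flat_map k curved_map <= C0%:E)%E].

End curved.
End mesh_theory.

Arguments Lp_norm {R d} T P p u.
Arguments Lp_norm_grad {R d} T P p u.
Arguments W1p_norm {R d} T P p u.
Arguments Lp_norm_vec {R d} T P {n} p u.
Arguments W1p_norm_vec {R d} T P {n} p u.
Arguments curved_map {R d} T k a S xi.
Arguments curved_interface {R d} T k a.
Arguments pull {R d} T k a {V} g S xi.
Arguments in_Sh_vec {R d} T k a g.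
Arguments interp {R d} T k a g S xi.
Arguments interp_error {R d} T k a g S xi.
Arguments admissible {R d} T k a Gamma Omega N sigma tau C0.

(* Main.v *)
Require Import Defs.
From mathcomp Require Import all_boot all_order perm all_algebra.
From mathcomp Require Import all_classical all_reals all_analysis ess_sup_inf.
From mathcomp Require Import measurable_realfun ring lra.

(** Everything is pulled back to the reference simplex, where [phi] and [psi] become
    polynomials of degree at most [k] whose derivatives are bounded by [H = O(h)].

    Interpolation reproduces polynomials of degree [k].  In [g = f o phi - f o psi] one may
    therefore replace [f], in each of the two terms, by the remainder of its first-order
    Taylor polynomial, at [phi 0] and at [psi 0] respectively, without changing the
    interpolation error.  The gradient of the function [w] so obtained consists of terms
    [(d phi - d psi) (f' (phi) - f' (phi 0))] and
    [d psi (f' (phi) - f' (psi) - f' (phi 0) + f' (psi 0))]; as [f] has two Lipschitz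
    derivatives, both are [O(H (|d e| + H |e|))] with [e = phi - psi].  Lagrange
    interpolation is bounded for the maximum norm, together with its derivatives, so that
    the same bound holds for [w - I w] and its gradient; interpolating [g] and [g - g 0]
    gives the two stability estimates.  This is [reference_estimates].

    Three ingredients turn this into the theorem.

    - Regularity of [f] ([sobolev_C21]): a continuous function with bounded weak derivatives
      up to order 3 has two classical derivatives with uniform local Lipschitz and Taylor
      bounds.  They are the limits of the derivatives of mollifications, whose convergence
      follows from that of the functions by an inequality of Landau type.  Quasiconvexity of
      the domain makes the Lipschitz bounds global ([quasiconvex_lipschitz]).

    - Geometry of the elements ([curved_elements_regular]): a facet belongs to a simplex that
      contains a ball of radius comparable to [h], so that its affine parametrization has a
      differential comparable to [h] from below; interpolating the distance projection, which
      fixes the vertices, perturbs it by [O(h^2)] only.  Tangential gradients are thus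
      comparable to [1/h] times derivatives on the reference simplex, and area elements to
      the power [d - 1] of [h].

    - Passage from pointwise to integral bounds ([Lp_norm_comparison]): all pointwise bounds
      are multiples of sums of nodal values of a component of [e] or of one of its
      derivatives.  Such a polynomial is large, compared with its nodal values, on a box of
      fixed size ([Pk_large_on_box]), which bounds its integrals and essential suprema from
      below, with constants that do not depend on [p].  The same argument deduces [H = O(h)]
      from the bounds on the norms of [phi] and [psi] ([vpartial_le_W1oo]). *)

Set Implicit Arguments. Unset Strict Implicit. Unset Printing Implicit Defensive.
Import Order.TTheory GRing.Theory Num.Theory.
Import numFieldNormedType.Exports.
Local Open Scope classical_set_scope.
Local Open Scope ring_scope.

(** * Calculus on coordinate boxes *)

Section line_calculus.
Variables (R : realType) (V : normedModType R).
Implicit Types (u : V -> R) (x v : V).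

Lemma is_derive_line u x v (t d : R) :
  is_derive (x + t *: v) v u d -> is_derive t 1 (fun s => u (x + s *: v)) d.
Proof.
move=> [ud ed].
have E : (fun h : R => h^-1 *: (((fun s : R => u (x + s *: v)) \o shift t)
           (h *: (1 : R)) - u (x + t *: v))) =
         (fun h : R => h^-1 *: ((u \o shift (x + t *: v)) (h *: v) - u (x + t *: v))).
  apply/funext => h /=; congr (_ *: (u _ - _)).
  by rewrite scaler1 scalerDl addrA addrAC addrC addrA.
by split; [move: ud; rewrite /derivable -E | move: ed; rewrite /derive -E].
Qed.

(** A remainder of second order absorbs the limit in the definition of the directional
    derivative. *)
Lemma is_derive_quad u x v (d C : R) :
  (\forall h \near (0 : R), `|u (h *: v + x) - u x - h * d| <= C * h ^+ 2) ->
  is_derive x v u d.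
Proof.
move=> H.
have L : h^-1 *: ((u \o shift x) (h *: v) - u x) @[h --> (0 : R)^'] --> d.
  apply/cvgrPdist_le => e e0; near=> h.
  have h0 : h != 0 by near: h; exact: nbhs_dnbhs_neq.
  have -> : d - h^-1 *: ((u \o shift x) (h *: v) - u x) =
      - h^-1 * (u (h *: v + x) - u x - h * d).
    by rewrite [_ *: _]mulrC /=; field.
  rewrite normrM normrN normfV ler_pdivrMl ?normr_gt0//.
  have /le_trans -> // : `|u (h *: v + x) - u x - h * d| <= C * h ^+ 2.
    by near: h; exact: nbhs_dnbhs.
  rewrite -(real_normK (num_real h)) expr2 mulrA mulrC.
  rewrite ler_wpM2l//; apply: (@le_trans _ _ ((1 + `|C|) * `|h|)).
    by rewrite ler_wpM2r// ler_wpDl// ler_norm.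
  rewrite -ler_pdivlMl ?ltr_wpDr// mulrC.
  near: h; apply: nbhs_dnbhs; exists (e / (1 + `|C|)) => /=.
    by rewrite divr_gt0// ltr_wpDr.
  by move=> z /=; rewrite sub0r normrN => /ltW.
by split; [apply/cvg_ex; exists d | exact/cvg_lim].
Unshelve. all: by end_near. Qed.

Lemma mvt_bound (g dg : R -> R) (a b C : R) :
  (forall s, Num.min a b <= s <= Num.max a b ->
     is_derive s 1 g (dg s) /\ `|dg s| <= C) ->
  `|g b - g a| <= C * `|b - a|.
Proof.
wlog ab : a b / a <= b => [H hg|].
  have [ab|/ltW ba] := leP a b; first exact: H.
  by rewrite distrC [in leRHS]distrC; apply: H => // s; rewrite minC maxC; exact: hg.
rewrite min_l// max_r// => H.
have [||c cab ->] := @MVT_segment R g dg a b ab.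
- by move=> x; rewrite in_itv/= => /andP[/ltW ax /ltW xb]; apply: (H _ _).1; rewrite ax.
- apply: derivable_within_continuous => x; rewrite in_itv/= => xab.
  by have [[]] := H _ xab.
rewrite normrM ler_wpM2r//; apply: (H _ _).2.
by move: cab; rewrite in_itv.
Qed.

Lemma is_derive_bigsum (I : Type) (s : seq I) (P : pred I) (F : I -> V -> R)
    (dF : I -> R) x v :
  (forall i, P i -> is_derive x v (F i) (dF i)) ->
  is_derive x v (fun z => \sum_(i <- s | P i) F i z) (\sum_(i <- s | P i) dF i).
Proof.
move=> H; elim: s => [|i s IH].
  by under eq_fun do rewrite big_nil; rewrite big_nil; exact: is_derive_cst.
under eq_fun do rewrite big_cons; rewrite big_cons.
by have [Pi|//] := boolP (P i); apply: is_deriveD => //; exact: H.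
Qed.

End line_calculus.

Section boxes.
Variables (R : realType) (n : nat).
Implicit Types (x y z : 'rV[R]_n) (u : 'rV[R]_n -> R) (du : 'I_n -> 'rV[R]_n -> R).

Lemma ler_sum_ord_const (F : 'I_n -> R) (B : R) : (forall i, F i <= B) ->
  \sum_i F i <= n%:R * B.
Proof.
by move=> FB; rewrite mulr_natl -[X in _ *+ X](card_ord n) -sumr_const; apply: ler_sum.
Qed.

Lemma sum_basis_vec i (F : 'I_n -> R) : \sum_j basis_vec R i 0 j * F j = F i.
Proof.
rewrite (bigD1 i)//= big1 => [|j /negbTE ji]; rewrite /basis_vec mxE ?eqxx ?ji.
  by rewrite addr0 mul1r.
by rewrite andbF mul0r.
Qed.

Definition norm1 x : R := \sum_i `|x 0 i|.

(** The coordinate box with opposite corners [x] and [y], written with convex combinations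
    as the coordinates of [x] and [y] come in no particular order. *)
Definition inbox x y z : Prop :=
  forall i, exists2 t : R, 0 <= t <= 1 & z 0 i = x 0 i + t * (y 0 i - x 0 i).

Lemma norm1_ge0 x : 0 <= norm1 x.
Proof. by apply: sumr_ge0. Qed.

Lemma inbox_norm1 x y z : inbox x y z -> norm1 (z - x) <= norm1 (y - x).
Proof.
move=> H; apply: ler_sum => i _; have [t /andP[t0 t1] zi] := H i.
by rewrite !mxE zi addrC addKr normrM (ger0_norm t0) ler_piMl.
Qed.

Lemma is_derive_coord x v (i : 'I_n) :
  is_derive x v (fun z : 'rV[R]_n => z 0 i) (v 0 i).
Proof.
have H : h^-1 *: ((((fun z : 'rV[R]_n => z 0 i) \o shift x) (h *: v)) - x 0 i) @[h --> (0 : R)^']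
    --> v 0 i.
  apply: cvg_near_cst; near=> h.
  have h0 : h != 0 by near: h; exact: nbhs_dnbhs_neq.
  by rewrite /= !mxE addrK [_ *: _]mulrA mulVf// mul1r.
by split; [apply/cvg_ex; exists (v 0 i) | exact/cvg_lim].
Unshelve. all: by end_near. Qed.

Lemma is_derive_linear (b : 'I_n -> R) x v :
  is_derive x v (fun z : 'rV[R]_n => \sum_i z 0 i * b i) (\sum_i v 0 i * b i).
Proof.
apply: is_derive_bigsum => i _; under eq_fun do rewrite mulrC; rewrite mulrC.
by apply: is_deriveZ; exact: is_derive_coord.
Qed.

(** Walking from [x] to [y] along the coordinate axes stays in the box, and each step is
    one-dimensional: its increment is bounded by one partial derivative. *)
Lemma box_mvt u du (C : R) x y :
  (forall z, inbox x y z -> forall i,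
     is_derive z (basis_vec R i) u (du i z) /\ `|du i z| <= C) ->
  `|u y - u x| <= C * norm1 (y - x).
Proof.
move=> H.
pose w (m : nat) : 'rV[R]_n := \row_i (if (i < m)%N then y 0 i else x 0 i).
have -> : u y - u x = \sum_(0 <= m < n) (u (w m.+1) - u (w m)).
  rewrite (telescope_sumr (fun m => u (w m)))//; congr (u _ - u _).
    by apply/rowP => i; rewrite mxE ltn_ord.
  by apply/rowP => i; rewrite mxE.
rewrite big_mkord /norm1 mulr_sumr; apply: (le_trans (ler_norm_sum _ _ _)).
apply: ler_sum => i _.
set c := (y - x) 0 i.
have wi s : w i + s *: basis_vec R i =
    \row_j (if (j < i)%N then y 0 j else x 0 j + s * (j == i)%:R).
  apply/rowP => j; rewrite !mxE /=; case: ltngtP => [ji|ij|/val_inj ->].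
  - have -> : j == i = false by apply/negP => /eqP ji'; rewrite ji' ltnn in ji.
    by rewrite mulr0 addr0.
  - by [].
  - by rewrite eqxx.
have -> : w i = w i + 0 *: basis_vec R i by rewrite scale0r addr0.
have -> : w i.+1 = w i + c *: basis_vec R i.
  rewrite wi; apply/rowP => j; rewrite !mxE ltnS leq_eqVlt.
  case: (ltngtP j i) => [ji|ij|/val_inj ->] /=.
  - by [].
  - rewrite [j == i](_ : _ = false) ?mulr0 ?addr0//.
    by apply/eqP => ji; rewrite ji ltnn in ij.
  - by rewrite eqxx mulr1 /c !mxE; ring.
have -> : `|c| = `|c - 0| by rewrite subr0.
apply: (@mvt_bound _ (fun s => u (w i + s *: basis_vec R i))
    (fun s => du i (w i + s *: basis_vec R i))) => s sc.
have B : inbox x y (w i + s *: basis_vec R i).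
  move=> j; rewrite wi mxE; case: ltnP => ji.
    by exists 1; rewrite ?lexx ?ler01// mul1r addrC subrK.
  have [->|ji'] := eqVneq j i; last by exists 0; rewrite ?lexx ?ler01// mulr0 mul0r.
  have [c0|c0] := eqVneq c 0.
    exists 0; rewrite ?lexx ?ler01//; move: sc; rewrite c0 minxx maxxx => /le_anti <-.
    by rewrite !mul0r.
  exists (s / c); last by rewrite mulr1 (_ : y 0 i - x 0 i = c) ?mulfVK// /c !mxE.
  have [cp|cn] := ltP 0 c.
    by move: sc; rewrite min_l ?max_r ?(ltW cp)// => /andP[s0 s1];
      rewrite divr_ge0 ?(ltW cp)//= ler_pdivrMr// mul1r.
  have {}cn : c < 0 by rewrite lt_neqAle c0.
  move: sc; rewrite min_r ?max_l ?(ltW cn)// => /andP[s0 s1].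
  by rewrite -mulrNN -invrN divr_ge0 ?oppr_ge0 ?(ltW cn)//= ler_pdivrMr ?oppr_gt0// mul1r lerN2.
have [D1 D2] := H _ B i.
by split=> //; exact: is_derive_line.
Qed.

Lemma box_taylor u du (C : R) x y :
  (forall z, inbox x y z -> forall i,
     is_derive z (basis_vec R i) u (du i z) /\ `|du i z - du i x| <= C) ->
  `|u y - u x - \sum_i (y - x) 0 i * du i x| <= C * norm1 (y - x).
Proof.
move=> H.
have -> : u y - u x - \sum_i (y - x) 0 i * du i x =
   (u y - \sum_i y 0 i * du i x) - (u x - \sum_i x 0 i * du i x).
  under eq_bigr do rewrite !mxE mulrBl.
  by rewrite sumrB; ring.
apply: (@box_mvt (fun z => u z - \sum_i z 0 i * du i x)
                 (fun i z => du i z - du i x)) => z zB i.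
have [D1 D2] := H z zB i; split=> //.
apply: is_deriveB => //.
by rewrite -[X in is_derive _ _ _ X](sum_basis_vec i (du^~ x)); exact: is_derive_linear.
Qed.

End boxes.
(** * Polynomials and Lagrange interpolation on the reference simplex *)

Section polynomials.
Variables (R : realType) (n : nat).
Implicit Types (q r : 'rV[R]_n -> R) (xi v : 'rV[R]_n) (k m : nat).

Definition mono (s : seq 'I_n) xi : R := \prod_(i <- s) xi 0 i.

Lemma in_Pk0 k : in_Pk k (fun _ : 'rV[R]_n => 0).
Proof. by exists (fun=> 0) => xi; rewrite big1// => a _; rewrite mul0r. Qed.

Lemma in_PkD k q r : in_Pk k q -> in_Pk k r -> in_Pk k (fun xi => q xi + r xi).
Proof.
move=> [c Hc] [d Hd]; exists (fun a => c a + d a) => xi.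
by rewrite Hc Hd -big_split; apply: eq_bigr => a _; rewrite mulrDl.
Qed.

Lemma in_PkZ k (b : R) q : in_Pk k q -> in_Pk k (fun xi => b * q xi).
Proof.
move=> [c Hc]; exists (fun a => b * c a) => xi.
by rewrite Hc mulr_sumr; apply: eq_bigr => a _; rewrite mulrA.
Qed.

Lemma in_PkB k q r : in_Pk k q -> in_Pk k r -> in_Pk k (fun xi => q xi - r xi).
Proof.
move=> Hq Hr; rewrite (_ : (fun xi => _) = (fun xi => q xi + (-1) * r xi)).
  by apply: in_PkD => //; exact: in_PkZ.
by apply/funext => xi; rewrite mulN1r.
Qed.

Lemma in_Pk_sum k (I : Type) (s : seq I) (P : pred I) (F : I -> 'rV[R]_n -> R) :
  (forall i, P i -> in_Pk k (F i)) -> in_Pk k (fun xi => \sum_(i <- s | P i) F i xi).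
Proof.
move=> H; elim: s => [|i s IH].
  by under [X in in_Pk k X]eq_fun do rewrite big_nil; exact: in_Pk0.
under [X in in_Pk k X]eq_fun do rewrite big_cons.
by have [Pi|//] := boolP (P i); apply: in_PkD => //; exact: H.
Qed.

Lemma mono_count (s : seq 'I_n) xi : mono s xi = \prod_i xi 0 i ^+ count_mem i s.
Proof.
rewrite /mono; elim: s => [|j s IH]; first by rewrite big_nil big1.
rewrite big_cons IH /=; under [RHS]eq_bigr do rewrite exprD.
rewrite big_split/=; congr (_ * _).
by rewrite (bigD1 j)//= eqxx expr1 big1 ?mulr1// => i /negbTE ij; rewrite eq_sym ij.
Qed.

Lemma sum_count (s : seq 'I_n) : (\sum_i count_mem i s = size s)%N.
Proof.
elim: s => [|j s IH]; first by rewrite big1.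
rewrite big_split/= IH (bigD1 j)//= eqxx big1 ?addn0// => i /negbTE ij.
by rewrite eq_sym ij.
Qed.

Lemma in_Pk_mono k (b : R) (s : seq 'I_n) :
  (size s <= k)%N -> in_Pk k (fun xi => b * mono s xi).
Proof.
move=> sk.
pose al : {ffun 'I_n -> 'I_k.+1} := [ffun i => inord (count_mem i s)].
have alE i : al i = count_mem i s :> nat.
  by rewrite ffunE inordK// ltnS (leq_trans (count_size _ _)).
exists (fun a => if a == al then b else 0) => xi.
rewrite (bigD1 al)/=; last by under eq_bigr do rewrite alE; rewrite sum_count.
rewrite eqxx [X in _ + X]big1 ?addr0 => [|a /andP[_ /negbTE ->]]; last by rewrite mul0r.
by rewrite mono_count; under [in RHS]eq_bigr do rewrite alE.
Qed.

(** A coefficient vector is replaced by finitely many steps that add one monomial. *)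
Lemma in_Pk_ind k (P : ('rV[R]_n -> R) -> Prop) :
  P (fun=> 0) -> (forall q r, P q -> P r -> P (fun xi => q xi + r xi)) ->
  (forall b s, (size s <= k)%N -> P (fun xi => b * mono s xi)) ->
  forall q, in_Pk k q -> P q.
Proof.
move=> P0 PD Pm q [c Hc].
have -> : q = fun xi => \sum_(a : {ffun 'I_n -> 'I_k.+1} | (\sum_i a i <= k)%N)
             c a * \prod_i xi 0 i ^+ a i by exact/funext.
elim: (index_enum _) => [|a s IH].
  by under [X in P X]eq_fun do rewrite big_nil.
under [X in P X]eq_fun do rewrite big_cons.
have [ak|//] := boolP (_ <= k)%N; apply: PD => //.
have -> : (fun xi : 'rV[R]_n => c a * \prod_i xi 0 i ^+ a i) =
  fun xi => c a * mono (flatten [seq nseq (a i) i | i <- enum 'I_n]) xi.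
  apply/funext => xi; congr (_ * _); rewrite /mono big_flatten/= big_map big_enum/=.
  by apply: eq_bigr => i _; rewrite big_nseq; elim: (nat_of_ord _) => [|m IHm] /=;
    rewrite ?expr0// exprS IHm.
apply: Pm; rewrite size_flatten /shape -map_comp sumnE big_map big_enum/=.
by under eq_bigr do rewrite size_nseq.
Qed.

Lemma in_Pk_le k m q : (k <= m)%N -> in_Pk k q -> in_Pk m q.
Proof.
move=> km; apply: in_Pk_ind => [|q1 r|b s sk]; [exact: in_Pk0|exact: in_PkD|].
exact/in_Pk_mono/(leq_trans sk).
Qed.

Lemma in_Pk_cst k (b : R) : in_Pk k (fun _ : 'rV[R]_n => b).
Proof.
rewrite (_ : (fun _ => b) = (fun xi => b * mono [::] xi)); first exact: in_Pk_mono.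
by apply/funext => xi; rewrite /mono big_nil mulr1.
Qed.

Lemma in_Pk_coord (i : 'I_n) : in_Pk 1 (fun xi : 'rV[R]_n => xi 0 i).
Proof.
rewrite (_ : (fun _ => _) = (fun xi => 1 * mono [:: i] xi)); first exact: in_Pk_mono.
by apply/funext => xi; rewrite /mono big_seq1 mul1r.
Qed.

Lemma in_PkM k m q r : in_Pk k q -> in_Pk m r -> in_Pk (k + m) (fun xi => q xi * r xi).
Proof.
move=> + Hr; elim/in_Pk_ind => [|q1 q2 H1 H2|b s sk].
- by under [X in in_Pk _ X]eq_fun do rewrite mul0r; exact: in_Pk0.
- by under [X in in_Pk _ X]eq_fun do rewrite mulrDl; exact: in_PkD.
elim/in_Pk_ind: Hr => [|r1 r2 H1 H2|b' s' sk'].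
- by under [X in in_Pk _ X]eq_fun do rewrite mulr0; exact: in_Pk0.
- by under [X in in_Pk _ X]eq_fun do rewrite mulrDr; exact: in_PkD.
rewrite (_ : (fun _ => _) = (fun xi => (b * b') * mono (s ++ s') xi)).
  by apply: in_Pk_mono; rewrite size_cat leq_add.
by apply/funext => xi; rewrite /mono big_cat/=; ring.
Qed.

Lemma in_Pk_prod (I : Type) (s : seq I) (d : I -> nat) (F : I -> 'rV[R]_n -> R) :
  (forall i, in_Pk (d i) (F i)) ->
  in_Pk (\sum_(i <- s) d i) (fun xi => \prod_(i <- s) F i xi).
Proof.
move=> H; elim: s => [|i s IH].
  by under [X in in_Pk _ X]eq_fun do rewrite big_nil; exact: in_Pk_cst.
under [X in in_Pk _ X]eq_fun do rewrite big_cons.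
by rewrite big_cons; apply: in_PkM.
Qed.

(** Stated with an unknown gradient [Q], as the induction over monomials requires; [Q] is
    identified with the partial derivatives afterwards. *)
Lemma in_Pk_diff k q : in_Pk k q -> exists Q : 'I_n -> 'rV[R]_n -> R,
  (forall i, in_Pk k (Q i)) /\
  forall xi v, is_derive xi v q (\sum_i v 0 i * Q i xi).
Proof.
elim/in_Pk_ind => [|q1 q2 [Q1 [H1 D1]] [Q2 [H2 D2]]|b s sk].
- exists (fun _ _ => 0); split=> [i|xi v]; first exact: in_Pk0.
  by rewrite big1 => [|i _]; [exact: is_derive_cst|rewrite mulr0].
- exists (fun i xi => Q1 i xi + Q2 i xi); split=> [i|xi v]; first exact: in_PkD.
  under eq_bigr do rewrite mulrDr.
  by rewrite big_split/=; exact: is_deriveD.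
suff [Q [HQ DQ]] : exists Q : 'I_n -> 'rV[R]_n -> R, (forall i, in_Pk (size s) (Q i)) /\
    forall xi v, is_derive xi v (mono s) (\sum_i v 0 i * Q i xi).
  exists (fun i xi => b * Q i xi); split=> [i|xi v].
    exact/in_PkZ/(in_Pk_le sk).
  under eq_bigr do rewrite mulrCA.
  by rewrite -mulr_sumr; exact: is_deriveZ.
elim: s {sk} => [|j s [Q [HQ DQ]]].
  exists (fun _ _ => 0); split=> [i|xi v]; first exact: in_Pk0.
  rewrite big1 => [|i _]; last by rewrite mulr0.
  rewrite (_ : mono [::] = cst 1); first exact: is_derive_cst.
  by apply/funext => z; rewrite /mono big_nil.
exists (fun i xi => xi 0 j * Q i xi + (i == j)%:R * mono s xi); split=> [i|xi v].
  apply: in_PkD; first exact: (in_PkM (in_Pk_coord j) (HQ i)).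
  by apply: in_Pk_mono => /=.
have -> : mono (j :: s) = (fun z : 'rV[R]_n => z 0 j) * mono s.
  by apply/funext => z; rewrite /mono big_cons.
have := is_deriveM (is_derive_coord xi v j) (DQ xi v).
congr is_derive; under [RHS]eq_bigr do rewrite mulrDr mulrCA.
rewrite big_split/= -mulr_sumr; congr (_ + _).
rewrite (bigD1 j)//= eqxx mul1r big1 => [|i /negbTE ->]; last by rewrite mul0r mulr0.
by rewrite addr0 mulrC.
Qed.

Definition partial (i : 'I_n) q : 'rV[R]_n -> R := fun xi => 'D_(basis_vec R i) q xi.

Lemma in_Pk_partial_subproof k q : in_Pk k q ->
  (forall i, in_Pk k (partial i q)) /\
  forall xi v, is_derive xi v q (\sum_i v 0 i * partial i q xi).
Proof.
move=> /in_Pk_diff[Q [HQ DQ]].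
have E i : partial i q = Q i.
  apply/funext => xi; rewrite /partial; have [_ ->] := DQ xi (basis_vec R i).
  exact: (sum_basis_vec i (Q^~ xi)).
by split=> [i|xi v]; [rewrite E|under eq_bigr do rewrite E].
Qed.

Lemma in_Pk_partial k q i : in_Pk k q -> in_Pk k (partial i q).
Proof. by move=> /in_Pk_partial_subproof[]. Qed.

Lemma is_derive_Pk k q : in_Pk k q ->
  forall xi v, is_derive xi v q (\sum_i v 0 i * partial i q xi).
Proof. by move=> /in_Pk_partial_subproof[]. Qed.

Lemma ref_simplex_coord xi : ref_simplex xi -> forall i, 0 <= xi 0 i <= 1.
Proof.
move=> [x0 x1] i; rewrite x0/=; apply: le_trans x1.
by rewrite (bigD1 i)//= lerDl sumr_ge0.
Qed.

Lemma Pk_bounded k q : in_Pk k q ->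
  exists C : R, forall xi, ref_simplex xi -> `|q xi| <= C.
Proof.
elim/in_Pk_ind => [|q1 q2 [C1 H1] [C2 H2]|b s _].
- by exists 0 => xi _; rewrite normr0.
- exists (C1 + C2) => xi hxi; apply: (le_trans (ler_normD _ _)).
  by apply: lerD; [exact: H1|exact: H2].
- exists `|b| => xi /ref_simplex_coord H; rewrite normrM ler_piMr// /mono.
  elim: s => [|j s IH]; first by rewrite big_nil normr1.
  rewrite big_cons normrM; have /andP[j0 j1] := H j.
  by rewrite mulr_ile1// ger0_norm.
Qed.

End polynomials.
Section lagrange_interpolation.
Variables (R : realType) (n k : nat).
Hypothesis k0 : (0 < k)%N.
Let J := {ffun 'I_n -> 'I_k.+1}.
Implicit Types (q g : 'rV[R]_n -> R) (xi : 'rV[R]_n) (a b : J).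

Definition admissible_index a : bool := (\sum_i a i <= k)%N.

Definition node a : 'rV[R]_n := \row_i ((a i)%:R / k%:R).

(** The one-dimensional building block of the Lagrange basis, for one barycentric
    coordinate [l]: it kills the nodes where [k * l] is one of [0 .. m-1]. *)
Definition ladder (m : nat) (l : R) : R := \prod_(j < m) ((k%:R * l - j%:R) / (m - j)%:R).

(** The classical Lagrange basis: in each of the [n+1] barycentric coordinates, the
    factors kill the nodes whose coordinate is smaller than that of [node a]; as the
    coordinates sum to 1, every node other than [node a] is killed. *)
Definition lagrange_basis a xi : R :=
  (\prod_i ladder (a i) (xi 0 i)) * ladder (k - \sum_i a i) (1 - \sum_i xi 0 i).

Let kR0 : k%:R != 0 :> R. Proof. by rewrite pnatr_eq0 -lt0n. Qed.

Let kK (b : R) : k%:R * (b / k%:R) = b.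
Proof. by rewrite mulrCA divff// mulr1. Qed.

Lemma ladder_same m : ladder m (m%:R / k%:R) = 1.
Proof.
rewrite /ladder big1// => j _; rewrite kK -natrB ?divff// 1?ltnW//.
by rewrite pnatr_eq0 subn_eq0 -ltnNge.
Qed.

Lemma ladder_lt m (b : nat) : (b < m)%N -> ladder m (b%:R / k%:R) = 0.
Proof.
move=> bm; rewrite /ladder (bigD1 (Ordinal bm))//=.
by rewrite kK subrr !mul0r.
Qed.

Lemma node_bary a : admissible_index a ->
  1 - \sum_i node a 0 i = (k - \sum_i a i)%N%:R / k%:R.
Proof.
move=> ak; have -> : \sum_i node a 0 i = (\sum_i a i)%N%:R / k%:R.
  by rewrite natr_sum mulr_suml; apply: eq_bigr => i _; rewrite mxE.
by rewrite natrB// mulrBl divff.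
Qed.

Lemma lagrange_basis_node a b : admissible_index a -> admissible_index b ->
  lagrange_basis a (node b) = (a == b)%:R.
Proof.
move=> ha hb; rewrite /lagrange_basis node_bary//.
have [<-|ab] := eqVneq a b.
  rewrite ladder_same mulr1 big1// => i _; by rewrite mxE ladder_same.
have [i ltba|H] := pickP (fun i => (b i < a i)%N).
  by rewrite (bigD1 i)//= mxE ladder_lt// !mul0r.
rewrite [X in _ * X]ladder_lt ?mulr0//.
have {}H i : (a i <= b i)%N by rewrite leqNgt H.
have lt_ab : (\sum_i a i < \sum_i b i)%N.
  rewrite ltn_neqAle leq_sum// andbT.
  apply/negP => /eqP E; case/eqP: ab; apply/ffunP => i; apply/val_inj/eqP => /=.
  have := leqif_sum (fun i (_ : xpredT i) => leqif_eq (H i)).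
  by move=> [_]; rewrite E eqxx => /esym/forallP/(_ i).
by apply: ltn_sub2l => //; exact: leq_trans lt_ab hb.
Qed.

Lemma in_Pk_ladder m (l : 'rV[R]_n -> R) : in_Pk 1 l -> in_Pk m (fun xi => ladder m (l xi)).
Proof.
move=> Hl; rewrite -[X in in_Pk X _](_ : \sum_(j < m) 1 = m)%N; last first.
  by rewrite sum_nat_const card_ord muln1.
apply: in_Pk_prod => j.
rewrite (_ : (fun _ => _) = (fun xi => (m - j)%:R^-1 * (k%:R * l xi - j%:R))).
  by apply/in_PkZ/in_PkB; [exact: in_PkZ|exact: in_Pk_cst].
by apply/funext => xi; rewrite mulrC.
Qed.

Lemma in_Pk_lagrange_basis a : admissible_index a -> in_Pk k (lagrange_basis a).
Proof.
move=> ak; rewrite -[X in in_Pk X _](subnKC ak); apply: in_PkM.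
  by apply: in_Pk_prod => i; apply: in_Pk_ladder; exact: in_Pk_coord.
apply/in_Pk_ladder/in_PkB; first exact: in_Pk_cst.
by apply: in_Pk_sum => i _; exact: in_Pk_coord.
Qed.

(** As many nodes as monomials: the matrix of the coefficients of the Lagrange basis
    is a left inverse of the square matrix of the values of the monomials at the
    nodes, hence also a right inverse. *)
Lemma Pk_unisolvent q : in_Pk k q ->
  (forall a, admissible_index a -> q (node a) = 0) -> q = fun=> 0.
Proof.
move=> [c Hc] q0.
have /choice[L HL] : forall a, exists l : J -> R, admissible_index a ->
    forall xi, lagrange_basis a xi =
      \sum_(b | admissible_index b) l b * \prod_i xi 0 i ^+ b i.
  move=> a; have [ha|] := boolP (admissible_index a); last by exists (fun=> 0).
  by have [l Hl] := in_Pk_lagrange_basis ha; exists l.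
pose N := #|J|.
pose e (i : 'I_N) : J := enum_val i.
pose mon (b a : J) : R := \prod_i node a 0 i ^+ b i.
pose A : 'M[R]_N := \matrix_(i, j)
  if admissible_index (e i) && admissible_index (e j) then L (e i) (e j) else (i == j)%:R.
pose B : 'M[R]_N := \matrix_(i, j)
  if admissible_index (e i) && admissible_index (e j) then mon (e i) (e j) else (i == j)%:R.
have AB : A *m B = 1%:M.
  apply/matrixP => i j; rewrite !mxE.
  have [hi|hi] := boolP (admissible_index (e i)); last first.
    rewrite (bigD1 i)//= big1 ?addr0; last first.
      by move=> l /negbTE li; rewrite !mxE (negbTE hi)/= eq_sym li mul0r.
    by rewrite !mxE (negbTE hi)/= eqxx mul1r.
  have [hj|hj] := boolP (admissible_index (e j)); last first.
    rewrite (bigD1 j)//= big1 ?addr0; last first.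
      by move=> l /negbTE li; rewrite !mxE (negbTE hj)/= andbF li mulr0.
    by rewrite !mxE (negbTE hj)/= andbF eqxx mulr1.
  have := lagrange_basis_node hi hj; rewrite (HL _ hi).
  rewrite (inj_eq enum_val_inj) => <-.
  rewrite [RHS]big_mkcond/=.
  rewrite [RHS](reindex (@enum_val _ predT))/=; last exact/onW_bij/enum_val_bij.
  apply: eq_bigr => l _; rewrite !mxE hi hj/= andbT.
  have [hl|hl] := boolP (admissible_index (e l)); first by [].
  rewrite [i == l](_ : _ = false) ?mul0r//; apply/negP => /eqP il.
  by move: hl; rewrite -il hi.
have BA := mulmx1C AB.
pose C : 'rV[R]_N := \row_i if admissible_index (e i) then c (e i) else 0.
have CB : C *m B = 0.
  apply/rowP => j; rewrite !mxE.
  have [hj|hj] := boolP (admissible_index (e j)); last first.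
    rewrite big1// => l _; rewrite !mxE (negbTE hj) andbF.
    have [->|] := eqVneq l j; first by rewrite (negbTE hj) mul0r.
    by rewrite mulr0.
  rewrite -[RHS](q0 _ hj) Hc [RHS]big_mkcond/=.
  rewrite [RHS](reindex (@enum_val _ predT))/=; last exact/onW_bij/enum_val_bij.
  apply: eq_bigr => l _; rewrite !mxE hj andbT -/(admissible_index _) -/(e _).
  by case: ifP => // _; rewrite mul0r.
have C0 : C = 0 by rewrite -[C]mulmx1 -BA mulmxA CB mul0mx.
apply/funext => xi; rewrite Hc big1// => a ha.
have /rowP/(_ (enum_rank a)) := C0.
by rewrite !mxE /e enum_rankK /admissible_index ha => ->; rewrite mul0r.
Qed.

Definition interpolant g xi : R := \sum_(a | admissible_index a) g (node a) * lagrange_basis a xi.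

Lemma in_Pk_interpolant g : in_Pk k (interpolant g).
Proof. by apply: in_Pk_sum => a ha; apply/in_PkZ/in_Pk_lagrange_basis. Qed.

Lemma interpolant_node g a : admissible_index a -> interpolant g (node a) = g (node a).
Proof.
move=> ha; rewrite /interpolant (bigD1 a)//= lagrange_basis_node// eqxx mulr1.
rewrite big1 ?addr0// => b /andP[hb /negbTE ba].
by rewrite lagrange_basis_node// ba mulr0.
Qed.

Lemma lagrange_nodes_node a : admissible_index a -> lagrange_nodes k (node a).
Proof. by move=> ha; exists (fun i => a i). Qed.

Lemma lagrange_nodesP xi : lagrange_nodes k xi ->
  exists2 a, admissible_index a & xi = node a.
Proof.
move=> [al [hal ->]].
have H i : (al i < k.+1)%N.
  by rewrite ltnS (leq_trans _ hal)// (bigD1 i)//= leq_addr.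
exists [ffun i => Ordinal (H i)].
  by rewrite /admissible_index; under eq_bigr do rewrite ffunE.
by apply/rowP => i; rewrite !mxE ffunE.
Qed.

Lemma ref_simplex_node a : admissible_index a -> ref_simplex (node a).
Proof.
move=> ha; split=> [i|]; first by rewrite mxE divr_ge0.
by rewrite -subr_ge0 node_bary// divr_ge0.
Qed.

Lemma Pk_eq q r : in_Pk k q -> in_Pk k r ->
  (forall a, admissible_index a -> q (node a) = r (node a)) -> q = r.
Proof.
move=> hq hr qr.
have H : (fun xi => q xi - r xi) = fun=> 0.
  by apply: Pk_unisolvent => [|a ha]; [exact: in_PkB|rewrite qr// subrr].
by apply/funext => xi; apply/subr0_eq; exact: (congr1 (fun f => f xi) H).
Qed.

Lemma lagrangeE g : Defs.lagrange k g = interpolant g.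
Proof.
have H : [set q | in_Pk k q /\ forall xi, lagrange_nodes k xi -> q xi = g xi]
    (interpolant g).
  split; first exact: in_Pk_interpolant.
  by move=> xi /lagrange_nodesP[a ha ->]; exact: interpolant_node.
rewrite /Defs.lagrange; case: xgetP => [q _ [hq qg]|/(_ _ H)//].
apply: Pk_eq => // [|a ha]; first exact: in_Pk_interpolant.
by rewrite interpolant_node// qg//; exact: lagrange_nodes_node.
Qed.

Lemma interpolant_Pk q : in_Pk k q -> interpolant q = q.
Proof.
by move=> hq; apply: Pk_eq => // [|a ha]; [exact: in_Pk_interpolant|exact: interpolant_node].
Qed.

Definition nodal_norm g : R := \sum_(a | admissible_index a) `|g (node a)|.

Lemma nodal_norm_ge0 g : 0 <= nodal_norm g.
Proof. exact: sumr_ge0. Qed.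

(** A polynomial and its partial derivatives are bounded by its nodal values: expand
    it in the Lagrange basis, whose finitely many elements are fixed. *)
Lemma nodal_norm_bound : exists2 C : R, 0 < C & forall g xi, ref_simplex xi ->
  `|interpolant g xi| <= C * nodal_norm g /\
  forall i, `|partial i (interpolant g) xi| <= C * nodal_norm g.
Proof.
have /choice[C HC] : forall a, exists C : R, admissible_index a ->
    forall xi, ref_simplex xi -> `|lagrange_basis a xi| <= C /\
      forall i, `|partial i (lagrange_basis a) xi| <= C.
  move=> a; have [ha|] := boolP (admissible_index a); last by exists 0.
  have [C1 H1] := Pk_bounded (in_Pk_lagrange_basis ha).
  have /choice[C2 H2] := fun i => Pk_bounded (in_Pk_partial i (in_Pk_lagrange_basis ha)).
  exists (`|C1| + \sum_i `|C2 i|) => _ xi hxi; split=> [|i].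
    by rewrite (le_trans (H1 _ hxi))// ler_wpDr ?sumr_ge0// ler_norm.
  rewrite (le_trans (H2 _ _ hxi))// ler_wpDl//.
  by rewrite (bigD1 i)//= ler_wpDr ?sumr_ge0// ler_norm.
exists (1 + \sum_a `|C a|) => [|g xi hxi]; first by rewrite ltr_wpDr ?sumr_ge0.
have CC a : C a <= 1 + \sum_a `|C a|.
  by rewrite ler_wpDl// (bigD1 a)//= ler_wpDr ?sumr_ge0// ler_norm.
split=> [|i].
  apply: (le_trans (ler_norm_sum _ _ _)); rewrite mulr_sumr; apply: ler_sum => a ha.
  by rewrite normrM mulrC ler_wpM2r// (le_trans _ (CC a))//; exact: (HC a ha _ hxi).1.
have -> : partial i (interpolant g) xi =
    \sum_(a | admissible_index a) g (node a) * partial i (lagrange_basis a) xi.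
  apply: derive_val; apply: is_derive_bigsum => a ha; apply: is_deriveZ.
  by apply: derivableP; case: (is_derive_Pk (in_Pk_lagrange_basis ha) xi (basis_vec R i)).
apply: (le_trans (ler_norm_sum _ _ _)); rewrite mulr_sumr; apply: ler_sum => a ha.
by rewrite normrM mulrC ler_wpM2r// (le_trans _ (CC a))//; exact: (HC a ha _ hxi).2.
Qed.

Lemma nodal_norm_max : exists2 C : R, 0 < C & forall g, exists2 a, admissible_index a &
  nodal_norm g <= C * `|g (node a)|.
Proof.
have h0 : admissible_index (finfun (fun=> ord0) : J).
  by rewrite /admissible_index; under eq_bigr do rewrite ffunE; rewrite big1.
exists #|J|%:R => [|g].
  by rewrite ltr0n; apply/card_gt0P; exists (finfun (fun=> ord0) : J).
pose a := [arg max_(b > finfun (fun=> ord0) : J | admissible_index b) `|g (node b)|]%O.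
have [ha H] : admissible_index a /\ forall b, admissible_index b -> `|g (node b)| <= `|g (node a)|.
  by rewrite /a; case: Order.TotalTheory.arg_maxP => // b hb H; split.
exists a => //; apply: (@le_trans _ _ (\sum_(b | admissible_index b) `|g (node a)|)).
  by apply: ler_sum.
rewrite big_mkcond/= mulr_natl -sumr_const; apply: ler_sum => b _.
by case: ifP.
Qed.

End lagrange_interpolation.
(** * Lebesgue measure on tuples *)

Section lebesgue_tuples.
Variable R : realType.
Local Notation leb := (@lebesgue_measure R).

Lemma measurable_tensor n (g : 'I_n -> R -> R) :
  (forall i, measurable_fun [set: R] (g i)) ->
  measurable_fun [set: n.-tuple (measurableTypeR R)] (fun t => \prod_i g i (tnth t i)).
Proof.
move=> mg; apply: measurable_prod => i _.
exact: (measurableT_comp (mg i) (measurable_tnth i)).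
Qed.

(** Tonelli's theorem, by induction on the dimension. *)
Lemma lebn_tensor n (g : 'I_n -> R -> R) :
  (forall i x, 0 <= g i x) -> (forall i, measurable_fun [set: R] (g i)) ->
  (\int[lebn R n]_t (\prod_i g i (tnth t i))%:E
   = \prod_i \int[leb]_x (g i x)%:E)%E.
Proof.
elim: n g => [|n IH] g g0 mg.
  rewrite big_ord0 /= integral_dirac//; last first.
    by apply/measurable_EFinP; exact: (measurable_tensor mg).
  by rewrite big_ord0 diracT mul1e.
have mT := measurable_tensor mg.
transitivity (\int[pushforward (leb \x lebn R n)%E (@tcons _ (measurableTypeR R) n)]_t
   (\prod_i g i (tnth t i))%:E)%E; first by [].
rewrite ge0_integral_pushforward//=; last 3 first.
- exact: measurable_tcons.
- exact/measurable_EFinP.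
- by move=> t _; rewrite lee_fin; apply: prodr_ge0.
rewrite preimage_setT.
rewrite fubini_tonelli1; last 2 first.
- apply/measurable_EFinP.
  exact: (measurableT_comp mT (@measurable_tcons _ (measurableTypeR R) n)).
- by move=> t; rewrite lee_fin; apply: prodr_ge0.
have E x : fubini_F (lebn R n) (fun p : R * n.-tuple R =>
      (\prod_i g i (tnth (tcons p) i))%:E) x =
    ((g ord0 x)%:E * \prod_(i < n) \int[leb]_y (g (lift ord0 i) y)%:E)%E.
  rewrite -(IH (fun i => g (lift ord0 i)))// -ge0_integralZl//; last 3 first.
  - by apply/measurable_EFinP; exact: (measurable_tensor (fun i => mg (lift ord0 i))).
  - by move=> t _; rewrite lee_fin; apply: prodr_ge0.
  - by rewrite lee_fin.
  apply: eq_integral => t _; rewrite -EFinM big_ord_recl; congr (_ * _)%:E.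
  by apply: eq_bigr => i _; rewrite tnthS.
transitivity (\int[leb]_x ((g ord0 x)%:E *
    \prod_(i < n) \int[leb]_y (g (lift ord0 i) y)%:E))%E.
  by apply: eq_integral => x _; exact: E.
rewrite big_ord_recl/= ge0_integralZr//.
- by apply/measurable_EFinP; exact: (mg ord0).
- by move=> x _; rewrite lee_fin.
- by apply: prode_ge0 => i _; apply: integral_ge0 => x _; rewrite lee_fin.
Qed.

Definition tbox n (c : 'rV[R]_n) (r : R) : set (n.-tuple (measurableTypeR R)) :=
  [set t | forall i, c 0 i - r <= tnth t i <= c 0 i + r].

Lemma measurable_tbox n (c : 'rV[R]_n) r : measurable (tbox c r).
Proof.
rewrite (_ : tbox c r = \bigcap_(i in [set: 'I_n])
    ((fun t => tnth t i) @^-1` `[c 0 i - r, c 0 i + r]%classic)).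
  apply: fin_bigcap_measurable => [|i _]; first exact: finite_finset.
  by rewrite -[X in measurable X]setTI; exact: (measurable_tnth i).
apply/seteqP; split => t /= H i.
  by move=> _ /=; rewrite in_itv/=; exact: H.
by have := H i I; rewrite /= in_itv.
Qed.

Lemma tbox_indic n (c : 'rV[R]_n) r t :
  (\1_(tbox c r) t : R) = \prod_i (\1_(`[c 0 i - r, c 0 i + r]%classic) (tnth t i)).
Proof.
rewrite indicE; have [/set_mem H|/negP H] := boolP (t \in tbox c r).
  by rewrite big1// => i _; rewrite indicE mem_set//= in_itv/= H.
have [i Hi] : exists i, ~ (c 0 i - r <= tnth t i <= c 0 i + r).
  by apply/existsNP => H'; apply: H; exact/mem_set.
by rewrite (bigD1 i)//= indicE memNset ?mul0r//= in_itv.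
Qed.

Lemma lebn_tbox n (c : 'rV[R]_n) r : 0 <= r -> lebn R n (tbox c r) = ((2 * r) ^+ n)%:E.
Proof.
move=> r0; rewrite -(setIT (tbox c r)) -integral_indic//; last exact: measurable_tbox.
under eq_integral do rewrite tbox_indic.
rewrite (lebn_tensor (g := fun i x => \1_(`[c 0 i - r, c 0 i + r]%classic) x))//;
  last by move=> i; exact: measurable_indic.
have E (a : R) : (\int[leb]_x (\1_(`[a - r, a + r]%classic) x)%:E = (2 * r)%:E)%E.
  rewrite integral_indic// setIT; etransitivity; first exact: lebesgue_measure_itv.
  rewrite /= lte_fin; case: ltP => [_|H]; first by rewrite -EFinB; congr EFin; ring.
  by congr EFin; lra.
by under eq_bigr do rewrite E; rewrite prodEFin prodr_const card_ord.
Qed.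

Lemma row_of_tupleE n (t : n.-tuple (measurableTypeR R)) i : row_of_tuple t 0 i = tnth t i.
Proof. by rewrite mxE. Qed.

Lemma ball_rowP n (x y : 'rV[R]_n) (r : R) : 0 < r ->
  ball x r y <-> forall i, `|x 0 i - y 0 i| < r.
Proof.
move=> r0; split=> [[_ H] i|H]; first exact: H.
by split=> // i j; rewrite !ord1; exact: H.
Qed.

Lemma notin_tbox n (c : 'rV[R]_n) r t : t \notin tbox c r ->
  exists i, r < `|row_of_tuple t 0 i - c 0 i|.
Proof.
move=> tc; have /existsNP[i Hi] : ~ forall i, c 0 i - r <= tnth t i <= c 0 i + r.
  by move=> H; move/negP: tc; apply; exact/mem_set.
by exists i; rewrite row_of_tupleE ltNge; apply/negP; rewrite ler_distl.
Qed.

Lemma measurable_ball n (x : 'rV[R]_n) (r : R) : 0 < r ->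
  measurable (@row_of_tuple R n @^-1` ball x r).
Proof.
move=> r0.
rewrite (_ : _ @^-1` _ = \bigcap_(i in [set: 'I_n])
    ((fun t : n.-tuple (measurableTypeR R) => tnth t i) @^-1` `]x 0 i - r, x 0 i + r[%classic)).
  apply: fin_bigcap_measurable => [|i _]; first exact: finite_finset.
  by rewrite -[X in measurable X]setTI; exact: (measurable_tnth i).
apply/seteqP; split => t /= H.
  move=> i _ /=; rewrite in_itv/=; have /(ball_rowP _ _ r0)/(_ i) := H.
  by rewrite row_of_tupleE distrC ltr_distl.
apply/(ball_rowP _ _ r0) => i; have := H i I; rewrite /= in_itv/=.
by rewrite row_of_tupleE distrC ltr_distl.
Qed.

(** Open sets are countable unions of balls with rational centres and radii. *)
Lemma measurable_open n (D : set 'rV[R]_n) : open D -> measurable (@row_of_tuple R n @^-1` D).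
Proof.
move=> oD.
pose c (p : {ffun 'I_n -> rat} * nat) : 'rV[R]_n := \row_i ratr (p.1 i).
pose r (p : {ffun 'I_n -> rat} * nat) : R := p.2.+1%:R^-1.
have r0 p : 0 < r p by rewrite invr_gt0.
rewrite (_ : _ @^-1` _ = \bigcup_p [set t | ball (c p) (r p) `<=` D /\
    ball (c p) (r p) (@row_of_tuple R n t)]).
  apply: countable_bigcupT_measurable => [|p]; first exact: countableP.
  have [pD|pD] := pselect (ball (c p) (r p) `<=` D).
    rewrite (_ : mkset _ = @row_of_tuple R n @^-1` ball (c p) (r p)).
      exact: measurable_ball.
    by apply/seteqP; split => t /= => [[]|].
  by rewrite (_ : mkset _ = set0)//; apply/seteqP; split => t // -[].
apply/seteqP; split => t /=; last by move=> [p _ /= [pD]]; exact: pD.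
move=> Dt; have /nbhs_ballP[e /= e0 eD] := oD _ Dt.
have [m me] : exists m : nat, 2 * m.+1%:R^-1 < e.
  have e2 : 0 < e / 2 by rewrite divr_gt0.
  by have [m] := ltr_add_invr e2; exists m; move: p; rewrite add0r ltr_pdivlMr// mulrC.
have /choice[q Hq] : forall i, exists q : rat, `|row_of_tuple t 0 i - ratr q| < m.+1%:R^-1.
  move=> i; have m0 : 0 < m.+1%:R^-1 :> R by rewrite invr_gt0.
  have /rat_in_itvoo[q] : row_of_tuple t 0 i < row_of_tuple t 0 i + m.+1%:R^-1.
    by rewrite ltrDl.
  by rewrite in_itv/= => /andP[q1 q2]; exists q;
    rewrite distrC ltr_distl q2 andbT (lt_trans _ q1)// ltrBlDr ltrDl.
have Hb : ball (c ([ffun i => q i], m)) (r ([ffun i => q i], m)) (row_of_tuple t).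
  by apply/ball_rowP => // i; rewrite mxE ffunE distrC; exact: Hq.
exists ([ffun i => q i], m) => //=; split=> // y Hy; apply: eD.
apply: le_ball (ball_triangle (ball_sym Hb) Hy).
by rewrite -mulr2n -mulr_natl; apply: ltW; exact: me.
Qed.

End lebesgue_tuples.
(** * A smooth mollifier *)

Section bump.
Variable R : realType.
Implicit Types (x y z : R) (p : {poly R}).

(** A power of [z / m] is below the same power of [exp (z / m)]. *)
Lemma poly_expN_bounded p : exists C : R, forall z, 0 <= z -> `|p.[z] * expR (- z)| <= C.
Proof.
have Xm (m : nat) z : 0 <= z -> `|z ^+ m * expR (- z)| <= (m ^ m)%:R.
  move=> z0; rewrite ger0_norm ?mulr_ge0 ?exprn_ge0 ?expR_ge0//.
  case: m => [|m]; first by rewrite expr0 mul1r expR_le1 oppr_le0.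
  have mz : z / m.+1%:R <= expR (z / m.+1%:R).
    by apply: le_trans (expR_ge1Dx _); rewrite lerDr.
  have : (z / m.+1%:R) ^+ m.+1 <= expR z.
    have {2}-> : z = m.+1%:R * (z / m.+1%:R) by rewrite mulrCA divff ?mulr1// pnatr_eq0.
    by rewrite expRM_natl lerXn2r// nnegrE ?expR_ge0// divr_ge0.
  rewrite expr_div_n ler_pdivrMr ?exprn_gt0// natrX expRN.
  by rewrite ler_pdivrMr ?expR_gt0// mulrC.
exists (\sum_(i < size p) `|p`_i| * (i ^ i)%:R) => z z0.
rewrite horner_coef mulr_suml; apply: (le_trans (ler_norm_sum _ _ _)).
apply: ler_sum => i _; rewrite -mulrA normrM ler_wpM2l//; exact: Xm.
Qed.

(** Smooth functions that vanish on the negative half line; the family is closed under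
    differentiation. *)
Definition expV p x : R := if 0 < x then p.[x^-1] * expR (- x^-1) else 0.

Lemma expV_bounded p : exists2 C : R, 0 <= C & forall x, `|expV p x| <= C * (Num.min 1 (x ^+ 2)).
Proof.
have [C1 H1] := poly_expN_bounded p.
have [C2 H2] := poly_expN_bounded ('X^2 * p).
exists (`|C1| + `|C2|) => [|x]; first exact: addr_ge0.
rewrite /expV; case: ifPn => [x0|_]; last first.
  by rewrite normr0 mulr_ge0 ?addr_ge0// le_min ler01 sqr_ge0.
have xV0 : 0 <= x^-1 by rewrite invr_ge0 ltW.
rewrite minEle; case: ifP => _.
  by rewrite mulr1 (le_trans (H1 _ xV0))// ler_wpDr// ler_norm.
have := H2 _ xV0; rewrite hornerM hornerXn -mulrA normrM normrX normfV (gtr0_norm x0).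
rewrite exprVn ler_pdivrMl ?exprn_gt0// mulrC => /le_trans; apply.
by rewrite [leLHS]mulrC ler_wpM2r ?sqr_ge0// ler_wpDl// ler_norm.
Qed.

(** At 0 the derivative vanishes because [expV p] is of second order there. *)
Lemma is_derive_expV p x : is_derive x 1 (expV p) (expV ('X^2 * (p - p^`())) x).
Proof.
have [x0|x0|<-] := ltgtP 0 x; last first.
- have [C C0 HC] := expV_bounded p.
  rewrite {2}/expV ltxx; apply: (@is_derive_quad _ _ _ _ _ _ C); near=> h.
  rewrite mulr0 subr0 {2}/expV ltxx subr0 addr0 [_ *: _]mulr1.
  by apply: le_trans (HC h) _; rewrite ler_wpM2l// ge_min lexx orbT.
- rewrite {2}/expV ltNge (ltW x0)/=.
  have H0 : is_derive x 1 (fun _ : R => 0 : R) 0 by exact: is_derive_cst.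
  apply: near_eq_is_derive H0; near=> y; rewrite /expV ltNge (ltW _)//.
  by near: y; exact: lt_nbhsl.
rewrite {2}/expV x0.
apply: (@near_eq_is_derive _ _ _ (fun y => p.[y^-1] * expR (- y^-1))).
  by near=> y; rewrite /expV ifT//; near: y; exact: lt_nbhsr.
have xn0 : x != 0 by rewrite gt_eqF.
have DV : is_derive x 1 (fun y : R => y^-1) (- x ^- 2).
  by apply: is_derive_eq; [exact: (is_deriveV (f := id))|rewrite [_ *: _]mulr1].
have D1 := is_derive1_comp (is_derive_poly p x^-1) DV.
have D2 := @is_derive1_comp R expR (fun y : R => - y^-1) x _ _ (is_derive_expR _)
  (is_deriveN DV).
have := is_deriveM D1 D2; congr is_derive.
rewrite /= hornerM hornerXn hornerD hornerN /GRing.scale/=.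
by field.
Unshelve. all: by end_near. Qed.

Fixpoint expV_poly (j : nat) : {poly R} :=
  if j is j'.+1 then 'X^2 * (expV_poly j' - (expV_poly j')^`()) else 1.

(** The [m]-th derivative of the product of the [i]-th derivative of [exp(-1/(1+y))]
    and the [j]-th derivative of [exp(-1/t)] at [t = 1 - y]. *)
Fixpoint bump_deriv (m i j : nat) (y : R) : R :=
  if m is m'.+1 then bump_deriv m' i.+1 j y - bump_deriv m' i j.+1 y
  else expV (expV_poly i) (1 + y) * expV (expV_poly j) (1 - y).

Definition bumpf (m : nat) : R -> R := bump_deriv m 0 0.

Arguments bumpf : simpl never.

Lemma is_derive_bump_deriv m i j y :
  is_derive y 1 (bump_deriv m i j) (bump_deriv m.+1 i j y).
Proof.
elim: m i j => [|m IH] i j; last first.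
  by apply: is_deriveB.
have D1 : is_derive y 1 (fun y : R => 1 + y) 1.
  by have := is_deriveD (is_derive_cst (1 : R) y 1) (is_derive_id y 1); rewrite add0r.
have D2 : is_derive y 1 (fun y : R => 1 - y) (-1).
  by have := is_deriveB (is_derive_cst (1 : R) y 1) (is_derive_id y 1); rewrite sub0r.
have E1 := is_derive1_comp (is_derive_expV (expV_poly i) (1 + y)) D1.
have E2 := @is_derive1_comp R (expV (expV_poly j)) (fun y : R => 1 - y) y _ _
  (is_derive_expV _ _) D2.
have := is_deriveM E1 E2; congr is_derive.
by rewrite /= ![_ *: _]mulrC; ring.
Qed.

Lemma is_derive_bump m y : is_derive y 1 (bumpf m) (bumpf m.+1 y).
Proof. exact: is_derive_bump_deriv. Qed.

Lemma bump_deriv_bounded m i j : exists C : R, forall y, `|bump_deriv m i j y| <= C.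
Proof.
elim: m i j => [|m IH] i j.
  have B p : exists C : R, forall y, `|expV p y| <= C.
    have [C C0 HC] := expV_bounded p; exists C => y.
    by rewrite (le_trans (HC y))// ler_piMr// ge_min lexx.
  have [C1 H1] := B (expV_poly i); have [C2 H2] := B (expV_poly j).
  by exists (C1 * C2) => y; rewrite normrM ler_pM.
have [C1 H1] := IH i.+1 j; have [C2 H2] := IH i j.+1.
by exists (C1 + C2) => y; rewrite (le_trans (ler_normB _ _))// lerD.
Qed.

Lemma bump_bounded m : exists2 C : R, 0 < C & forall y, `|bumpf m y| <= C.
Proof.
have [C HC] := bump_deriv_bounded m 0 0; exists (1 + `|C|) => [|y].
  by rewrite ltr_wpDr.
by rewrite (le_trans (HC y))// ler_wpDl// ler_norm.
Qed.

Lemma bump_deriv_out m i j y : 1 <= `|y| -> bump_deriv m i j y = 0.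
Proof.
move=> y1; elim: m i j => [|m IH] i j /=; last by rewrite !IH subrr.
move: y1; rewrite ler_normr => /orP[y1|y1].
  by rewrite [X in _ * X]/expV ltNge subr_le0 y1 mulr0.
by rewrite {1}/expV ltNge -lerBrDl sub0r -lerNr y1 mul0r.
Qed.

Lemma bump_out m y : 1 <= `|y| -> bumpf m y = 0.
Proof. exact: bump_deriv_out. Qed.

Lemma bump_ge0 y : 0 <= bumpf 0 y.
Proof.
by rewrite /bumpf /= /expV; apply: mulr_ge0; case: ifP => // _;
  rewrite hornerE mul1r expR_ge0.
Qed.

Lemma bump_gt0 y : `|y| <= 2^-1 -> expR (- 4) <= bumpf 0 y.
Proof.
have H t : 2^-1 <= t -> expR (- 2) <= expV 1 t.
  move=> t2; have t0 : 0 < t by apply: lt_le_trans t2; rewrite invr_gt0.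
  rewrite /expV t0 hornerE mul1r ler_expR lerN2.
  by rewrite -[leRHS]invrK lef_pV2 ?posrE// invr_gt0.
rewrite ler_norml => /andP[y1 y2]; rewrite /bumpf/=.
have -> : - 4 = - 2 + - 2 :> R by ring.
by rewrite expRD; apply: ler_pM; rewrite ?expR_ge0//; apply: H; lra.
Qed.

Lemma bump_continuous m : continuous (bumpf m).
Proof.
by move=> y; apply: differentiable_continuous; apply/derivable1_diffP;
  have [] := is_derive_bump m y.
Qed.

Lemma measurable_bump m : measurable_fun [set: R] (bumpf m).
Proof. by apply: continuous_measurable_fun; exact: bump_continuous. Qed.

Lemma bump_integral : exists2 c : R, 0 < c &
  (\int[@lebesgue_measure R]_y (bumpf 0 y)%:E = c%:E)%E.
Proof.
pose J := (\int[@lebesgue_measure R]_y (bumpf 0 y)%:E)%E.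
have [C C0 HC] := bump_bounded 0.
have mI (a : R) : (\int[@lebesgue_measure R]_y (\1_(`[- a, a]%classic) y)%:E =
    if (- a < a)%R then (a + a)%:E else 0)%E.
  rewrite integral_indic// setIT; etransitivity; first exact: lebesgue_measure_itv.
  by rewrite /= lte_fin; case: ifP => // _; rewrite -EFinB opprK.
have mInd (a : R) : measurable_fun [set: R] (fun y => (\1_(`[- a, a]%classic) y : R)%:E).
  by apply/measurable_EFinP; exact: measurable_indic.
have mb : measurable_fun [set: R] (fun y => (bumpf 0 y)%:E).
  by apply/measurable_EFinP; exact: measurable_bump.
have Jlt : (J < +oo)%E.
  apply: (@le_lt_trans _ _ (\int[@lebesgue_measure R]_y (C%:E * (\1_(`[- 1, 1]%classic) y)%:E))%E).
    apply: ge0_le_integral => //.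
    - by move=> y _; rewrite lee_fin bump_ge0.
    - by apply: emeasurable_funM => //; exact: mInd.
    move=> y _; rewrite -EFinM lee_fin indicE.
    have [y1|y1] := leP 1 `|y|; first by rewrite bump_out// mulr_ge0// ltW.
    have -> : (y \in `[- 1, 1]%classic) = true.
      by apply/mem_set => /=; rewrite in_itv/= -ler_norml ltW.
    by rewrite mulr1 (le_trans (ler_norm _)).
  rewrite ge0_integralZl//; last 2 first.
  - exact: mInd.
  - by rewrite lee_fin ltW.
  by rewrite mI ifT -?EFinM ?ltry//; lra.
have Jgt : (0 < J)%E.
  apply: (@lt_le_trans _ _ (\int[@lebesgue_measure R]_y
      ((expR (- 4))%:E * (\1_(`[- 2^-1, 2^-1]%classic) y)%:E))%E).
    rewrite ge0_integralZl//; last exact: mInd.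
    rewrite mI ifT; last lra.
    by rewrite -EFinM lte_fin mulr_gt0 ?expR_gt0//; lra.
  apply: ge0_le_integral => //.
  - by apply: emeasurable_funM => //; exact: mInd.
  move=> y _; rewrite -EFinM lee_fin indicE.
  have [/set_mem|_] := boolP (y \in _); last by rewrite mulr0 bump_ge0.
  by rewrite /= in_itv/= -ler_norml mulr1; exact: bump_gt0.
exists (fine J); first by rewrite fine_gt0// Jgt Jlt.
by rewrite fineK// ge0_fin_numE// ltW.
Qed.

Lemma bump_integral_scaled (a e : R) : 0 < e ->
  (\int[@lebesgue_measure R]_y (e^-1 * bumpf 0 ((y - a) / e))%:E =
   \int[@lebesgue_measure R]_y (bumpf 0 y)%:E)%E.
Proof.
move=> e0; pose F (y : R) := (y - a) / e.
have DF y : is_derive y 1 F e^-1.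
  have := is_deriveM (is_deriveB (is_derive_id y 1) (is_derive_cst a y 1))
    (is_derive_cst e^-1 y (1 : R)).
  by congr is_derive; rewrite scaler0 add0r subr0 [_ *: _]mulr1.
have F' : F^`()%classic = cst e^-1.
  by apply/funext => y; rewrite derive1E; exact: derive_val.
rewrite [RHS](increasing_ge0_integration_by_substitutionT (F := F)).
- by apply: eq_integral => y _; rewrite F' mulrC.
- by move=> x y xy; rewrite ltr_pM2r ?invr_gt0// ltrD2r.
- by rewrite F'; exact: cst_continuous.
- by rewrite F'; exact: is_cvg_cst.
- by rewrite F'; exact: is_cvg_cst.
- by move=> y; have [] := DF y.
- apply/cvgrNyPle => A; near=> y; rewrite ler_pdivrMr// lerBlDr.
  by near: y; apply: nbhs_ninfty_le; exact: num_real.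
- apply/cvgryPge => A; near=> y; rewrite ler_pdivlMr// lerBrDr.
  by near: y; apply: nbhs_pinfty_ge; exact: num_real.
- exact: bump_continuous.
- exact: bump_ge0.
Unshelve. all: by end_near. Qed.

End bump.
Section tensor_products.
Variables (R : realType) (n : nat).
Implicit Types (x y : 'rV[R]_n) (c : 'I_n -> nat -> R -> R).

(** [c i j] is the [j]-th derivative of the [i]-th factor; [nu] prescribes how often
    each factor is differentiated. *)
Definition tensor c (nu : 'I_n -> nat) y : R := \prod_i c i (nu i) (y 0 i).

Definition derivative_family c : Prop :=
  forall i j (t : R), is_derive t 1 (c i j) (c i j.+1 t).

Definition bump_index (nu : 'I_n -> nat) (i : 'I_n) : 'I_n -> nat :=
  fun j => (nu j + (j == i))%N.

Lemma is_derive_tensor c nu i y : derivative_family c ->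
  is_derive y (basis_vec R i) (tensor c nu) (tensor c (bump_index nu i) y).
Proof.
move=> dc; pose K := \prod_(j | j != i) c j (nu j) (y 0 j).
have D : is_derive (y 0 i) 1 (K \*: c i (nu i)) (K *: c i (nu i).+1 (y 0 i)).
  by apply: is_deriveZ; exact: dc.
have E h : ((tensor c nu) \o shift y) (h *: basis_vec R i) =
     ((K \*: c i (nu i)) \o shift (y 0 i)) (h *: (1 : R)).
  rewrite /= /tensor (bigD1 i)//= [RHS]mulrC; congr (_ * _).
    by rewrite !mxE !eqxx.
  by apply: eq_bigr => j /negbTE ji; rewrite !mxE ji andbF mulr0 add0r.
have E0 : tensor c nu y = (K \*: c i (nu i)) (y 0 i).
  by have := E 0; rewrite /= !scale0r !add0r.
have EQ : (fun h : R => h^-1 *: (((tensor c nu) \o shift y) (h *: basis_vec R i) -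
      tensor c nu y)) =
    (fun h : R => h^-1 *: (((K \*: c i (nu i)) \o shift (y 0 i)) (h *: (1 : R)) -
      (K \*: c i (nu i)) (y 0 i))).
  by apply/funext => h; rewrite E E0.
have -> : tensor c (bump_index nu i) y = K *: c i (nu i).+1 (y 0 i).
  rewrite /tensor (bigD1 i)//= mulrC /bump_index eqxx addn1; congr (_ * _).
  by apply: eq_bigr => j /negbTE ji; rewrite ji addn0.
case: D => D1 D2; split.
  by rewrite /derivable EQ.
by rewrite /derive EQ.
Qed.

Lemma pderiv_tensor c nu (s : seq 'I_n) : derivative_family c ->
  pderiv s (tensor c nu) = tensor c (foldr (fun i mu => bump_index mu i) nu s).
Proof.
move=> dc; elim: s => // i s IH; rewrite /pderiv/= -/(pderiv s _) IH.
by apply/funext => y; have [_ ->] := is_derive_tensor (foldr (fun i mu => bump_index mu i) nu s) i y dc.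
Qed.

Lemma derivative_family_continuous c i j : derivative_family c -> continuous (c i j).
Proof.
by move=> dc y; apply: differentiable_continuous; apply/derivable1_diffP;
  have [] := dc i j y.
Qed.

Lemma tensor_continuous c nu : derivative_family c -> continuous (tensor c nu).
Proof.
move=> dc; rewrite /tensor; elim: (index_enum _) => [|i s IH].
  by under eq_fun do rewrite big_nil; exact: cst_continuous.
under eq_fun do rewrite big_cons; move=> y; apply: continuousM; last exact: IH.
apply: (@continuous_comp _ _ _ (fun z : 'rV[R]_n => z 0 i) (c i (nu i))).
  exact: coord_continuous.
exact: derivative_family_continuous.
Qed.

Lemma test_function_tensor c nu (x : 'rV[R]_n) (r : R) (D : set 'rV[R]_n) :
  derivative_family c ->
  (forall i j t, r < `|t - x 0 i| -> c i j t = 0) ->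
  (forall y, (forall i, `|y 0 i - x 0 i| <= r) -> D y) ->
  test_function D (tensor c nu).
Proof.
move=> dc cx xD; split.
  move=> m s _; rewrite pderiv_tensor//; split=> [y _|_ i y _].
    exact: tensor_continuous.
  by have [] := is_derive_tensor (foldr (fun i mu => bump_index mu i) nu s) i y dc.
exists [set y | forall i, `|y 0 i - x 0 i| <= r]; split.
- have := @rV_compact R n (fun i => `[x 0 i - r, x 0 i + r]%classic).
  move=> /(_ (fun i => @segment_compact _ _ _)); congr compact.
  apply/seteqP; split=> y /= H i.
    by have := H i; rewrite /= in_itv/= ler_distl.
  by rewrite in_itv/= -ler_distl; exact: H.
- by move=> y /xD.
- move=> y /= H; have [i] : exists i, ~ `|y 0 i - x 0 i| <= r by exact/existsNP.
  by move=> /negP; rewrite -ltNge => hi; rewrite /tensor (bigD1 i)//= cx// mul0r.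
Qed.

Lemma measurable_tensor_row c nu : derivative_family c ->
  measurable_fun [set: n.-tuple (measurableTypeR R)] (tensor c nu \o @row_of_tuple R n).
Proof.
move=> dc; rewrite /comp /tensor.
under eq_fun do under eq_bigr do rewrite row_of_tupleE.
apply: (@measurable_tensor R n (fun i => c i (nu i))) => i.
by apply: continuous_measurable_fun; exact: derivative_family_continuous.
Qed.

Lemma tensor_bound c nu (x : 'rV[R]_n) (r K : R) :
  (forall i t, r < `|t - x 0 i| -> c i (nu i) t = 0) ->
  (forall i t, `|c i (nu i) t| <= K) ->
  forall t, `|tensor c nu (row_of_tuple t)| <= K ^+ n * \1_(tbox x r) t.
Proof.
move=> cx cK t; rewrite indicE; have [tx|/notin_tbox[j Hj]] := boolP (t \in _).
  rewrite mulr1 /tensor normr_prod -[X in _ ^+ X](card_ord n) -prodr_const.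
  by apply: ler_prod => j _; rewrite normr_ge0/= cK.
by rewrite mulr0 /tensor (bigD1 j)//= cx ?mul0r ?normr0.
Qed.

End tensor_products.
(** * From weak derivatives to classical ones *)

Section box_integrals.
Variables (R : realType) (n : nat).
Local Notation mu := (lebn R n).
Local Notation tup := (n.-tuple (measurableTypeR R)).

Lemma box_integrable (h : tup -> R) (K r : R) (c : 'rV[R]_n) :
  measurable_fun [set: tup] h -> 0 <= K -> 0 <= r ->
  {ae mu, forall t, `|h t| <= K * \1_(tbox c r) t} ->
  mu.-integrable [set: tup] (EFin \o h) /\
  `|\int[mu]_t h t| <= K * (2 * r) ^+ n.
Proof.
move=> mh K0 r0 hK.
have mE : measurable_fun [set: tup] (EFin \o h) by exact/measurable_EFinP.
have m1 : measurable_fun [set: tup] (fun t => (\1_(tbox c r) t : R)%:E).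
  by apply/measurable_EFinP; apply: measurable_indic; exact: measurable_tbox.
have B : (\int[mu]_t `|(h t)%:E| <= (K * (2 * r) ^+ n)%:E)%E.
  rewrite EFinM -(lebn_tbox c r0) -(setIT (tbox c r)) -integral_indic//; last exact: measurable_tbox.
  rewrite -ge0_integralZl//.
  apply: ae_ge0_le_integral => //.
  - exact: measurableT_comp.
  - by move=> t _; rewrite mule_ge0// lee_fin.
  - by apply: emeasurable_funM.
  - by apply: filterS hK => t ht _; rewrite -EFinM lee_fin.
have int_h : mu.-integrable [set: tup] (EFin \o h).
  by apply/integrableP; split=> //; apply: le_lt_trans B (ltry _).
split=> //; rewrite -lee_fin EFin_normr_Rintegral//.
by apply: le_trans B; exact: le_abse_integral.
Qed.

Lemma integrableB_EFin (u v : tup -> R) :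
  mu.-integrable [set: tup] (EFin \o u) -> mu.-integrable [set: tup] (EFin \o v) ->
  mu.-integrable [set: tup] (EFin \o (fun t => u t - v t)).
Proof.
by move=> hu hv; have := integrableB measurableT hu hv; congr integrable; apply/funext.
Qed.

Lemma integrableZ_EFin (k : R) (u : tup -> R) :
  mu.-integrable [set: tup] (EFin \o u) ->
  mu.-integrable [set: tup] (EFin \o (fun t => k * u t)).
Proof.
by move=> hu; have := integrableZl measurableT k hu; congr integrable; apply/funext.
Qed.

End box_integrals.

Lemma ler_scale2 (R : realType) (a b x y : R) :
  0 <= a -> 0 <= b -> x <= y -> a * (b * x) <= a * (b * y).
Proof. by move=> a0 b0 xy; do 2 apply: ler_wpM2l => //. Qed.

Section mollifier.
Variables (R : realType) (n : nat).
Implicit Types (x y : 'rV[R]_n) (e : R).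

(** The [j]-th derivative of the [i]-th factor of the mollification kernel of width [e]
    centred at [x]; [c0] stands for the integral of the one-dimensional bump. *)
Definition scaled_bump (c0 : R) x e (i : 'I_n) (j : nat) (t : R) : R :=
  c0^-1 * (e ^- j.+1 * bumpf j ((t - x 0 i) / e)).

Lemma scaled_bump_family c0 x e : derivative_family (scaled_bump c0 x e).
Proof.
move=> i j t.
have D1 : is_derive t 1 (fun t : R => (t - x 0 i) / e) e^-1.
  have := is_deriveM (is_deriveB (is_derive_id t 1) (is_derive_cst (x 0 i) t 1))
    (is_derive_cst e^-1 t (1 : R)).
  by congr is_derive; rewrite scaler0 add0r subr0 [_ *: _]mulr1.
have D2 := @is_derive1_comp R (bumpf j) (fun t : R => (t - x 0 i) / e) t _ _
  (is_derive_bump _ _) D1.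
have := is_deriveZ c0^-1 (is_deriveZ (e ^- j.+1) D2).
congr is_derive; rewrite /scaled_bump /GRing.scale/= -!exprVn [in RHS]exprS; ring.
Qed.

Lemma scaled_bump_out c0 x e i j t : 0 < e -> e <= `|t - x 0 i| ->
  scaled_bump c0 x e i j t = 0.
Proof.
move=> e0 et; rewrite /scaled_bump bump_out ?mulr0//.
by rewrite normrM normfV (gtr0_norm e0) ler_pdivlMr// mul1r.
Qed.

Lemma scaled_bump_ge0 c0 x e i t : 0 < c0 -> 0 < e -> 0 <= scaled_bump c0 x e i 0 t.
Proof.
move=> c00 e0; apply: mulr_ge0; first by rewrite invr_ge0 ltW.
by apply: mulr_ge0; [rewrite invr_ge0 exprn_ge0 ?ltW|exact: bump_ge0].
Qed.

Let normVp (a : R) : 0 < a -> `|a^-1| = a^-1.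
Proof. by move=> a0; rewrite gtr0_norm ?invr_gt0. Qed.

Lemma bump_taylor : exists2 C : R, 0 < C & forall s t,
  `|bumpf 0 (s - t) - bumpf 0 s + t * bumpf 1 s| <= C * t ^+ 2.
Proof.
have [C C0 HC] := bump_bounded R 2; exists C => // s t.
pose g z := bumpf 0 z - z * bumpf 1 s.
have -> : bumpf 0 (s - t) - bumpf 0 s + t * bumpf 1 s = g (s - t) - g s.
  by rewrite /g; ring.
have -> : C * t ^+ 2 = (C * `|t|) * `|s - t - s|.
  by rewrite addrAC subrr sub0r normrN -(real_normK (num_real t)); ring.
apply: (@mvt_bound _ g (fun z => bumpf 1 z - bumpf 1 s)) => z zs; split.
  apply: is_deriveB; first exact: is_derive_bump.
  have := is_deriveM (is_derive_id z 1) (is_derive_cst (bumpf 1 s) z (1 : R)).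
  by congr is_derive; rewrite scaler0 add0r [_ *: _]mulr1.
apply: (@le_trans _ _ (C * `|z - s|)).
  apply: (@mvt_bound _ (bumpf 1) (bumpf 2)) => w _; split; last exact: HC.
  exact: is_derive_bump.
rewrite ler_wpM2l ?(ltW C0)//.
move: zs; have [t0|t0] := leP 0 t.
  rewrite max_l ?min_r; [|lra|lra] => /andP[z1 z2].
  by rewrite (ger0_norm t0) ler_norml; lra.
rewrite max_r ?min_l; [|lra|lra] => /andP[z1 z2].
by rewrite (ltr0_norm t0) ler_norml; lra.
Qed.

Definition kernel c0 x e : 'rV[R]_n -> R := tensor (scaled_bump c0 x e) (fun=> 0%N).

Definition dkernel c0 x e i : 'rV[R]_n -> R :=
  tensor (scaled_bump c0 x e) (bump_index (fun=> 0%N) i).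

Lemma kernel_bound c0 : 0 < c0 -> exists2 C : R, 0 < C & forall x e, 0 < e ->
  forall t, `|kernel c0 x e (row_of_tuple t)| <= (C / e ^+ n) * \1_(tbox x e) t.
Proof.
move=> c00; have [B B0 HB] := bump_bounded R 0.
exists ((c0^-1 * B) ^+ n) => [|x e e0 t]; first by rewrite exprn_gt0// mulr_gt0 ?invr_gt0.
rewrite -expr_div_n; apply: tensor_bound => i s => [/ltW|].
  exact: scaled_bump_out.
rewrite /scaled_bump expr1; move: (bumpf _ _) (HB ((s - x 0 i) / e)) => b bB.
rewrite !normrM !normVp// -mulrA ler_wpM2l ?invr_ge0 ?(ltW c00)//.
by rewrite mulrC ler_wpM2r// invr_ge0 ltW.
Qed.

Lemma kernel_integral c0 x e : 0 < c0 -> 0 < e ->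
  (\int[@lebesgue_measure R]_y (bumpf 0 y)%:E = c0%:E)%E ->
  (\int[lebn R n]_t (kernel c0 x e (row_of_tuple t))%:E = 1)%E.
Proof.
move=> c00 e0 Hc0; rewrite /kernel /tensor.
under eq_integral do under eq_bigr do rewrite row_of_tupleE.
have mb i : measurable_fun [set: R] (scaled_bump c0 x e i 0%N).
  apply: continuous_measurable_fun.
  exact: (derivative_family_continuous (scaled_bump_family c0 x e)).
rewrite (lebn_tensor (g := fun i => scaled_bump c0 x e i 0%N))//; last first.
  by move=> i t; exact: scaled_bump_ge0.
rewrite big1// => i _; rewrite /scaled_bump expr1.
under eq_integral do rewrite EFinM.
rewrite ge0_integralZl//.
- by rewrite bump_integral_scaled// Hc0 -EFinM mulVf// gt_eqF.
- apply/measurable_EFinP; have := mb i; rewrite /scaled_bump expr1 => H.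
  have := @measurable_funM _ _ _ setT (cst c0) _ (measurable_cst _) H.
  apply: eq_measurable_fun => t _ /=.
  by rewrite mulVKf// gt_eqF.
- by move=> t _; rewrite lee_fin mulr_ge0 ?bump_ge0// invr_ge0 ltW.
- by rewrite lee_fin invr_ge0 ltW.
Qed.

(** Moving the centre of the kernel by [h] along an axis: only one factor of the tensor
    product changes, to second order as described by [bump_taylor]. *)
Lemma kernel_taylor c0 e : 0 < c0 -> 0 < e -> exists2 C : R, 0 <= C &
  forall x i h, `|h| <= e -> forall t,
  `|kernel c0 (h *: basis_vec R i + x) e (row_of_tuple t) -
    kernel c0 x e (row_of_tuple t) + h * dkernel c0 x e i (row_of_tuple t)|
  <= (C * h ^+ 2) * \1_(tbox x (2 * e)) t.
Proof.
move=> c00 e0; have [B B0 HB] := bump_bounded R 0.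
have [T T0 HT] := bump_taylor.
pose Ci := c0^-1 * (e^-1 * (T / e ^+ 2)).
pose K := c0^-1 * (e^-1 * B).
have K0 : 0 <= K by rewrite !mulr_ge0 ?invr_ge0// ltW.
have Ci0 : 0 <= Ci by rewrite !mulr_ge0 ?invr_ge0 ?exprn_ge0// ltW.
exists (Ci * (1 + K) ^+ n) => [|x i h he t].
  by rewrite mulr_ge0// exprn_ge0// addr_ge0.
pose y := row_of_tuple t.
pose P := \prod_(j | j != i) scaled_bump c0 x e j 0 (y 0 j).
have E1 : kernel c0 x e y = scaled_bump c0 x e i 0 (y 0 i) * P.
  by rewrite /kernel /tensor (bigD1 i).
have E2 : kernel c0 (h *: basis_vec R i + x) e y =
    c0^-1 * (e^-1 * bumpf 0 ((y 0 i - x 0 i) / e - h / e)) * P.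
  rewrite /kernel /tensor (bigD1 i)//=; congr (_ * _).
    rewrite /scaled_bump expr1 !mxE !eqxx mulr1; congr (_ * (_ * bumpf 0 _)).
    by rewrite opprD addrCA addrC mulrDl mulNr.
  by apply: eq_bigr => j /negbTE ji; rewrite /scaled_bump !mxE ji andbF mulr0 add0r.
have E3 : dkernel c0 x e i y = scaled_bump c0 x e i 1 (y 0 i) * P.
  rewrite /dkernel /tensor (bigD1 i)//= /bump_index eqxx; congr (_ * _).
  by apply: eq_bigr => j /negbTE ->.
rewrite -/y E1 E2 E3.
rewrite (_ : _ - _ + _ = (c0^-1 * (e^-1 * bumpf 0 ((y 0 i - x 0 i) / e - h / e)) -
    scaled_bump c0 x e i 0 (y 0 i) + h * scaled_bump c0 x e i 1 (y 0 i)) * P); last first.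
  move: (scaled_bump _ _ _ _ _ _) (scaled_bump _ _ _ _ _ _) (bumpf _ _) => b1 b2 b3.
  by ring.
have [tx|tx] := boolP (t \in tbox x (2 * e)); last first.
  have [j] := notin_tbox tx; rewrite -/y => Hj.
  rewrite indicE (negbTE tx) mulr0.
  have eHj : e <= `|y 0 j - x 0 j| by lra.
  have [ji|ji] := eqVneq j i; last first.
    rewrite (_ : P = 0) ?mulr0 ?normr0// /P (bigD1 j)//=.
    by rewrite (scaled_bump_out _ _ e0 eHj) mul0r.
  rewrite -ji !(scaled_bump_out _ _ e0 eHj).
  rewrite bump_out ?(mulr0, subr0, addr0, mul0r, normr0)//.
  rewrite -mulrBl normrM normfV (gtr0_norm e0) ler_pdivlMr// mul1r.
  have := ler_normB (y 0 j - x 0 j - h) (- h); rewrite opprK subrK normrN.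
  by lra.
rewrite indicE tx mulr1 normrM.
have HP : `|P| <= (1 + K) ^+ n.
  apply: (@le_trans _ _ (\prod_(j < n | j != i) (1 + K))).
    rewrite /P normr_prod; apply: ler_prod => j _; rewrite normr_ge0/=.
    rewrite /scaled_bump expr1; move: (bumpf _ _) (HB ((y 0 j - x 0 j) / e)) => b bB.
    rewrite !normrM !normVp//.
    apply: (@le_trans _ _ K); last by rewrite lerDr.
    by apply: ler_scale2 => //; rewrite invr_ge0 ltW.
  rewrite prodr_const; apply: ler_weXn2l; first by rewrite lerDl.
  by rewrite -[leqRHS](card_ord n) max_card.
have -> : Ci * (1 + K) ^+ n * h ^+ 2 = (Ci * h ^+ 2) * (1 + K) ^+ n by ring.
apply: ler_pM => //.
set s := (y 0 i - x 0 i) / e.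
have -> : c0^-1 * (e^-1 * bumpf 0 (s - h / e)) - scaled_bump c0 x e i 0 (y 0 i) +
    h * scaled_bump c0 x e i 1 (y 0 i) =
    c0^-1 * (e^-1 * (bumpf 0 (s - h / e) - bumpf 0 s + (h / e) * bumpf 1 s)).
  by rewrite /scaled_bump -/s !expr1 expr2 invfM; ring.
rewrite normrM [X in _ * X]normrM !normVp// /Ci -!mulrA.
apply: ler_scale2; rewrite ?invr_ge0 ?(ltW c00) ?(ltW e0)//.
rewrite [h * (e^-1 * _)]mulrA; apply: le_trans (HT _ _) _.
by rewrite expr_div_n [X in _ <= T * X]mulrC.
Qed.

End mollifier.
Section mollification.
Variables (R : realType) (n m : nat) (D : set 'rV[R]_n) (f : 'rV[R]_n -> R).
Variables (g : seq 'I_n -> 'rV[R]_n -> R) (M : R).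
Local Notation mu := (lebn R n).
Local Notation tup := (n.-tuple (measurableTypeR R)).
Hypothesis oD : open D.
Hypothesis cf : forall x, D x -> {for x, continuous f}.
Hypothesis wg : weak_derivatives m D f g.
Hypothesis M0 : 0 <= M.
Hypothesis gM : forall s, (size s <= m)%N ->
  {ae mu, forall t, D (row_of_tuple t) -> `|g s (row_of_tuple t)| <= M}.
Implicit Types (x y : 'rV[R]_n) (e : R) (s : seq 'I_n) (chi : 'rV[R]_n -> R).

Definition zero_ext s : tup -> R := (g s \o @row_of_tuple R n) \_ (@row_of_tuple R n @^-1` D).

Definition pairing s chi : R := \int[mu]_t (zero_ext s t * chi (row_of_tuple t)).

Lemma measurable_zero_ext s : (size s <= m)%N -> measurable_fun [set: tup] (zero_ext s).
Proof.
move=> sm; have [_ /(_ s sm)[mg _ _]] := wg.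
by apply/(measurable_restrictT _ _).1 => //; exact: measurable_open.
Qed.

Lemma zero_ext_bound s : (size s <= m)%N -> {ae mu, forall t, `|zero_ext s t| <= M}.
Proof.
move=> sm; apply: filterS (gM sm) => t H; rewrite /zero_ext patchE.
case: ifPn => [/set_mem/H//|_].
by rewrite normr0.
Qed.

Lemma pairing_bound s chi x (K r : R) : (size s <= m)%N -> 0 <= K -> 0 <= r ->
  measurable_fun [set: tup] (chi \o @row_of_tuple R n) ->
  (forall t, `|chi (row_of_tuple t)| <= K * \1_(tbox x r) t) ->
  mu.-integrable [set: tup] (EFin \o (fun t => zero_ext s t * chi (row_of_tuple t))) /\
  `|pairing s chi| <= M * K * (2 * r) ^+ n.
Proof.
move=> sm K0 r0 mchi chiK; apply: (@box_integrable _ _ _ _ _ x) => //.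
- by apply: measurable_funM => //; exact: measurable_zero_ext.
- exact: mulr_ge0.
apply: filterS (zero_ext_bound sm) => t Ht.
by rewrite normrM -mulrA; apply: ler_pM.
Qed.

Lemma integral_on_pairing s chi : (size s <= m)%N ->
  mu.-integrable [set: tup] (EFin \o (fun t => zero_ext s t * chi (row_of_tuple t))) ->
  integral_on D (fun x => (g s x * chi x)%:E) = (pairing s chi)%:E.
Proof.
move=> sm hint; rewrite /integral_on integral_mkcond /pairing /Rintegral fineK.
  apply: eq_integral => t _; rewrite /zero_ext !patchE.
  by case: ifP => // _; rewrite mul0r.
exact: integrable_fin_num.
Qed.

(** The definition of weak derivatives, turned into integration by parts for one more
    derivative. *)
Lemma pairing_parts s i (c : 'I_n -> nat -> R -> R) nu x (r : R) (K : R) : (size s < m)%N ->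
  0 <= r -> 0 <= K ->
  derivative_family c -> (forall i j t, r < `|t - x 0 i| -> c i j t = 0) ->
  (forall y, (forall i, `|y 0 i - x 0 i| <= r) -> D y) ->
  (forall i j, (j <= nu i + 1)%N -> forall t, `|c i j t| <= K) ->
  pairing s (tensor c (bump_index nu i)) = - pairing (rcons s i) (tensor c nu).
Proof.
move=> sm r0 K0 dc cx xD cK.
have sm' : (size (rcons s i) <= m)%N by rewrite size_rcons.
have tchi nu' : test_function D (tensor c nu') by apply: (test_function_tensor _ dc cx xD).
have bchi nu' : (forall j, (nu' j <= nu j + 1)%N) ->
    forall t, `|tensor c nu' (row_of_tuple t)| <= K ^+ n * \1_(tbox x r) t.
  by move=> hnu t; apply: tensor_bound => j u; [exact: cx|exact: cK].
have int s' nu' : (size s' <= m)%N -> (forall j, (nu' j <= nu j + 1)%N) ->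
    mu.-integrable [set: tup]
      (EFin \o (fun t => zero_ext s' t * tensor c nu' (row_of_tuple t))).
  move=> hs hnu; apply: (pairing_bound hs (exprn_ge0 n K0) r0 _ (bchi _ hnu)).1.
  exact: measurable_tensor_row.
have hb j : (bump_index nu i j <= nu j + 1)%N.
  by rewrite /bump_index leq_add2l; case: eqP.
have [_ /(_ _ sm')[_ _ /(_ _ (tchi nu))]] := wg.
rewrite integral_on_pairing//; last by apply: int => // j; rewrite leq_addr.
have [_ /(_ _ (ltnW sm))[_ _ /(_ _ (tchi (bump_index nu i)))]] := wg.
rewrite integral_on_pairing//; [|exact: ltnW|by apply: int => //; exact: ltnW].
rewrite -EFinM; have -> : pderiv s (tensor c (bump_index nu i)) = pderiv (rcons s i) (tensor c nu).
  rewrite /pderiv -cats1 foldr_cat/=; congr foldr.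
  by apply/funext => y; have [_ ->] := is_derive_tensor nu i y dc.
move=> ->; rewrite -EFinM size_rcons => -[] /eqP.
by rewrite exprS mulN1r mulNr -mulrN => /eqP/mulfI-> //; rewrite signr_eq0.
Qed.

Variable c0 : R.
Hypothesis c00 : 0 < c0.
Hypothesis Hc0 : (\int[@lebesgue_measure R]_y (bumpf 0 y)%:E = c0%:E)%E.

(** The mollification at scale [e] of the [s]-th weak derivative. *)
Definition moll s e x : R := pairing s (kernel c0 x e).

Definition box_in x e : Prop := forall y, (forall i, `|y 0 i - x 0 i| <= e) -> D y.

Lemma moll_bound (C : R) : 0 < C ->
  (forall x e, 0 < e -> forall t,
    `|kernel c0 x e (row_of_tuple t)| <= (C / e ^+ n) * \1_(tbox x e) t) ->
  forall s e x, (size s <= m)%N -> 0 < e -> `|moll s e x| <= (M + 1) * C * 2 ^+ n.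
Proof.
move=> C0 HC s e x sm e0.
have mk : measurable_fun [set: tup] (kernel c0 x e \o @row_of_tuple R n).
  exact: measurable_tensor_row (scaled_bump_family c0 x e).
have Ce0 : 0 <= C / e ^+ n by rewrite divr_ge0 ?exprn_ge0 ?ltW.
apply: le_trans (pairing_bound sm Ce0 (ltW e0) mk (HC x e e0)).2 _.
have -> : M * (C / e ^+ n) * (2 * e) ^+ n = M * C * 2 ^+ n.
  rewrite exprMn; have : e ^+ n != 0 by rewrite expf_neq0 ?gt_eqF.
  by move: (e ^+ n) (2 ^+ n) => a b a0; field.
rewrite ler_wpM2r ?exprn_ge0// ler_wpM2r ?(ltW C0)//.
by rewrite lerDl.
Qed.

Lemma moll_rcons s i e x : (size s < m)%N -> 0 < e -> box_in x e ->
  moll (rcons s i) e x = - pairing s (dkernel c0 x e i).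
Proof.
move=> sm e0 xD.
have [B0 B00 HB0] := bump_bounded R 0; have [B1 B10 HB1] := bump_bounded R 1.
pose K := c0^-1 * (e^-1 * B0) + c0^-1 * (e ^- 2 * B1).
have K1 : 0 <= c0^-1 * (e^-1 * B0) by rewrite !mulr_ge0 ?invr_ge0// ltW.
have K2 : 0 <= c0^-1 * (e ^- 2 * B1) by rewrite !mulr_ge0 ?invr_ge0 ?exprn_ge0// ltW.
rewrite /dkernel (@pairing_parts s i _ _ x e K) ?opprK//; [exact: ltW|exact: addr_ge0| | |].
- exact: scaled_bump_family.
- by move=> j l t H; rewrite scaled_bump_out// ltW.
have ic0 : `|c0^-1| = c0^-1 by rewrite ger0_norm ?invr_ge0 ?ltW.
have ie : `|e^-1| = e^-1 by rewrite ger0_norm ?invr_ge0 ?ltW.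
move=> j [|[|//]] _ t; rewrite /scaled_bump.
  move: (bumpf _ _) (HB0 ((t - x 0 j) / e)) => b bB.
  apply: (@le_trans _ _ (c0^-1 * (e^-1 * B0))); last by rewrite lerDl.
  by rewrite expr1 !normrM ic0 ie; apply: ler_scale2 => //; rewrite invr_ge0 ltW.
move: (bumpf _ _) (HB1 ((t - x 0 j) / e)) => b bB.
apply: (@le_trans _ _ (c0^-1 * (e ^- 2 * B1))); last by rewrite lerDr.
rewrite !normrM ic0 -exprVn normrX ie.
by apply: ler_scale2 => //; rewrite ?exprn_ge0// invr_ge0 ltW.
Qed.

(** Differentiation under the integral: the kernel is replaced by its first-order expansion
    with respect to the centre, up to a remainder of second order. *)
Lemma is_derive_moll s i e x : (size s < m)%N -> 0 < e -> box_in x e ->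
  is_derive x (basis_vec R i) (moll s e) (moll (rcons s i) e x).
Proof.
move=> sm e0 xD.
have [C C0 HC] := @kernel_taylor R n _ _ c00 e0.
have [C1 C10 HC1] := @kernel_bound R n _ c00.
have sm' := ltnW sm.
have mk z : measurable_fun [set: tup] (kernel c0 z e \o @row_of_tuple R n).
  exact: measurable_tensor_row (scaled_bump_family c0 z e).
have mdk : measurable_fun [set: tup] (dkernel c0 x e i \o @row_of_tuple R n).
  exact: measurable_tensor_row (scaled_bump_family c0 x e).
have intk z := (pairing_bound sm' (divr_ge0 (ltW C10) (exprn_ge0 n (ltW e0)))
  (ltW e0) (mk z) (HC1 z e e0)).1.
have intk' h : `|h| <= e -> mu.-integrable [set: tup] (EFin \o (fun t => zero_ext s t *
    (kernel c0 (h *: basis_vec R i + x) e (row_of_tuple t) -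
     kernel c0 x e (row_of_tuple t) + h * dkernel c0 x e i (row_of_tuple t)))) /\
    `|pairing s (fun y => kernel c0 (h *: basis_vec R i + x) e y - kernel c0 x e y +
        h * dkernel c0 x e i y)| <= M * (C * h ^+ 2) * (2 * (2 * e)) ^+ n.
  move=> he; apply: (pairing_bound sm' _ _ _ (HC x i h he)).
  - by rewrite mulr_ge0// sqr_ge0.
  - by rewrite mulr_ge0// ltW.
  - apply: measurable_funD; last exact: measurable_funM.
    exact: (measurable_funB (mk _) (mk _)).
apply: (@is_derive_quad _ _ _ _ _ _ (M * C * (2 * (2 * e)) ^+ n)); near=> h.
have he : `|h| <= e.
  near: h; exists e => //= z /=; by rewrite sub0r normrN => /ltW.
have [int1 bd1] := intk' h he.
rewrite moll_rcons// mulrN opprK.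
suff -> : moll s e (h *: basis_vec R i + x) - moll s e x + h * pairing s (dkernel c0 x e i) =
    pairing s (fun y => kernel c0 (h *: basis_vec R i + x) e y - kernel c0 x e y +
        h * dkernel c0 x e i y).
  by apply: le_trans bd1 _; rewrite le_eqVlt; apply/orP; left; apply/eqP; ring.
have [h0|h0] := eqVneq h 0.
  rewrite h0 scale0r add0r subrr add0r mul0r /pairing.
  under eq_Rintegral do rewrite subrr mul0r addr0 mulr0.
  by rewrite Rintegral_cst ?mul0r//.
have intd : mu.-integrable [set: tup] (EFin \o (fun t => zero_ext s t * dkernel c0 x e i (row_of_tuple t))).
  have := integrableZl measurableT h^-1 (integrableD measurableT
     (integrableB measurableT int1 (intk (h *: basis_vec R i + x))) (intk x)).
  congr integrable; apply/funext => t /=.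
  rewrite -EFinB -EFinD -EFinM; congr EFin.
  by move: (kernel _ _ _ _) (kernel _ _ _ _) (dkernel _ _ _ _ _) => a b d; field.
rewrite /moll /pairing -RintegralB// -RintegralZl//.
rewrite -RintegralD//.
- by apply: eq_Rintegral => t _; ring.
- exact: integrableB_EFin.
- exact: integrableZ_EFin.
Unshelve. all: by end_near. Qed.

(** The kernel has mass 1, so only the oscillation of [f] near [x] remains. *)
Lemma moll_cvg x : D x -> moll [::] k.+1%:R^-1 x @[k --> \oo] --> f x.
Proof.
move=> Dx; apply/cvgrPdist_le => ep ep0.
have [C C0 HC] := @kernel_bound R n _ c00.
pose d := ep / (C * 2 ^+ n).
have d0 : 0 < d by rewrite divr_gt0// mulr_gt0// exprn_gt0.
have [r r0 Hr] : exists2 r : R, 0 < r & forall y, ball x r y -> D y /\ `|f y - f x| <= d.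
  have /nbhs_ballP[r1 /= r10 H1] := oD Dx.
  have /cvgrPdist_le/(_ _ d0)/nbhs_ballP[r2 /= r20 H2] := cf Dx.
  exists (Num.min r1 r2) => [|y xy]; first by rewrite lt_min r10.
  split; first by apply: H1; apply: le_ball xy; rewrite ge_min lexx.
  by rewrite distrC; apply: H2; apply: le_ball xy; rewrite ge_min lexx orbT.
near=> k.
have e0 : 0 < k.+1%:R^-1 :> R by rewrite invr_gt0.
have er : k.+1%:R^-1 < r by near: k; exact: near_infty_natSinv_lt (PosNum r0).
set e := k.+1%:R^-1 in e0 er *.
have mk : measurable_fun [set: tup] (kernel c0 x e \o @row_of_tuple R n).
  exact: measurable_tensor_row (scaled_bump_family c0 x e).
have Ce0 : 0 <= C / e ^+ n by rewrite divr_ge0 ?exprn_ge0 ?ltW.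
have int1 := (pairing_bound (s := [::]) (leq0n m) Ce0 (ltW e0) mk (HC x e e0)).1.
have [int2 _] : mu.-integrable [set: tup] (EFin \o (kernel c0 x e \o @row_of_tuple R n)) /\
    `|\int[mu]_t (kernel c0 x e (row_of_tuple t))| <= C / e ^+ n * (2 * e) ^+ n.
  apply: (@box_integrable _ _ _ _ _ x) => //; first exact: ltW.
  by apply: nearW; exact: HC.
have I1 : \int[mu]_t (kernel c0 x e (row_of_tuple t)) = 1.
  by rewrite /Rintegral kernel_integral.
have -> : f x - moll [::] e x =
    \int[mu]_t ((f x - zero_ext [::] t) * kernel c0 x e (row_of_tuple t)).
  rewrite -[X in X - _]mulr1 -I1 -RintegralZl// /moll /pairing -RintegralB//.
    by apply: eq_Rintegral => t _; rewrite mulrBl.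
  exact: integrableZ_EFin.
have -> : ep = d * (C / e ^+ n) * (2 * e) ^+ n.
  rewrite exprMn /d; have : e ^+ n != 0 by rewrite expf_neq0 ?gt_eqF.
  have : C != 0 by rewrite gt_eqF.
  have : (2 ^+ n : R) != 0 by rewrite expf_neq0.
  by move: (e ^+ n) (2 ^+ n) => a b ? ? ?; field; apply/and3P.
have mh : measurable_fun [set: tup]
    (fun t => (f x - zero_ext [::] t) * kernel c0 x e (row_of_tuple t)).
  apply: measurable_funM => //; apply: measurable_funB => //.
  exact: measurable_zero_ext.
have dC0 : 0 <= d * (C / e ^+ n) by rewrite mulr_ge0// ltW.
apply: (box_integrable (c := x) mh dC0 (ltW e0) _).2.
apply: nearW => t; rewrite normrM -mulrA.
have [tx|tx] := boolP (t \in tbox x e); last first.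
  suff -> : kernel c0 x e (row_of_tuple t) = 0 by rewrite indicE (negbTE tx) !(mulr0, normr0).
  by have := HC x e e0 t; rewrite indicE (negbTE tx) mulr0 normr_le0 => /eqP.
apply: ler_pM => //; last exact: HC.
have xt : ball x r (row_of_tuple t).
  apply/ball_rowP => // i; rewrite row_of_tupleE distrC; apply: le_lt_trans er.
  by rewrite ler_distl; have /set_mem := tx; exact.
have [Dt ft] := Hr _ xt.
rewrite /zero_ext patchE mem_set// /=; have [-> // _] := wg.
by rewrite distrC.
Unshelve. all: by end_near. Qed.

End mollification.
Section limits.
Variable R : realType.

(** The approximating sequences are Cauchy, up to any prescribed error. *)
Lemma cvg_of_approx (a : nat -> R) :
  (forall e, 0 < e -> exists b : nat -> R, cvg (b k @[k --> \oo]) /\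
     \forall k \near \oo, `|a k - b k| <= e) ->
  cvg (a k @[k --> \oo]).
Proof.
move=> H; apply/cauchy_cvgP/cauchy_exP => e e0.
have e3 : 0 < e / 3 by rewrite divr_gt0.
have [b [cb ab]] := H _ e3.
exists (lim (b k @[k --> \oo])).
suff : \forall k \near \oo, ball (lim (b k @[k --> \oo])) e (a k) by [].
near=> k.
have h1 : `|a k - b k| <= e / 3 by near: k.
have h2 : `|lim (b k @[k --> \oo]) - b k| <= e / 3.
  by near: k; move/cvgrPdist_le: cb; apply.
apply: (@le_lt_trans _ _ (e / 3 + e / 3)); last lra.
have -> : lim (b k @[k --> \oo]) - a k =
    (lim (b k @[k --> \oo]) - b k) - (a k - b k) by ring.
by apply: le_trans (ler_normB _ _) _; exact: lerD.
Unshelve. all: by end_near. Qed.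

Lemma cvg_bigsum (U I : Type) (FU : set_system U) (s : seq I) (F : I -> U -> R) (l : I -> R) :
  Filter FU -> (forall i, F i k @[k --> FU] --> l i) ->
  (\sum_(i <- s) F i k) @[k --> FU] --> \sum_(i <- s) l i.
Proof.
move=> FF H; elim: s => [|i s IH].
  by under eq_fun do rewrite big_nil; rewrite big_nil; exact: cvg_cst.
by under eq_fun do rewrite big_cons; rewrite big_cons; exact: cvgD.
Qed.

Lemma ler_lim_near (a b : nat -> R) (l l' : R) :
  a k @[k --> \oo] --> l -> b k @[k --> \oo] --> l' ->
  (\forall k \near \oo, a k <= b k) -> l <= l'.
Proof.
move=> al bl ab; rewrite -(cvg_lim _ al)// -(cvg_lim _ bl)//.
by apply: ler_lim => //; apply/cvg_ex; [exists l|exists l'].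
Qed.

End limits.

(** Uniform local control of a family of functions indexed by directions of
    differentiation: [G (rcons s i)] is the [i]-th partial derivative of [G s], in the
    strong form of a quadratic Taylor estimate. *)
Definition local_C21 (R : realType) (n : nat) (D : set 'rV[R]_n) (L : R)
    (G : seq 'I_n -> 'rV[R]_n -> R) : Prop :=
  forall s, (size s <= 2)%N ->
    (forall x, D x -> `|G s x| <= L) /\
    forall x, D x -> exists2 r : R, 0 < r & forall y z : 'rV[R]_n,
      (forall i, `|y 0 i - x 0 i| <= r) -> (forall i, `|z 0 i - x 0 i| <= r) ->
      [/\ D y, `|G s y - G s z| <= L * norm1 (y - z) &
       (size s < 2)%N -> `|G s y - G s z - \sum_i (y - z) 0 i * G (rcons s i) z|
         <= L * norm1 (y - z) ^+ 2].

Section classical_derivatives.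
Variables (R : realType) (n m : nat) (D : set 'rV[R]_n) (f : 'rV[R]_n -> R).
Variables (g : seq 'I_n -> 'rV[R]_n -> R) (M : R).
Hypothesis oD : open D.
Hypothesis cf : forall x, D x -> {for x, continuous f}.
Hypothesis wg : weak_derivatives m D f g.
Hypothesis M0 : 0 <= M.
Hypothesis gM : forall s, (size s <= m)%N ->
  {ae lebn R n, forall t, D (row_of_tuple t) -> `|g s (row_of_tuple t)| <= M}.
Variable c0 : R.
Hypothesis c00 : 0 < c0.
Hypothesis Hc0 : (\int[@lebesgue_measure R]_y (bumpf 0 y)%:E = c0%:E)%E.
Implicit Types (x y z w : 'rV[R]_n) (s : seq 'I_n).

Let u (k : nat) s x : R := moll D g c0 s k.+1%:R^-1 x.

Lemma open_box x : D x -> exists2 r : R, 0 < r & box_in D x (2 * r).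
Proof.
move=> /oD/nbhs_ballP[r /= r0 H]; exists (r / 4); first by rewrite divr_gt0.
move=> y Hy; apply: H; apply/ball_rowP => // i; rewrite distrC.
by apply: le_lt_trans (Hy i) _; lra.
Qed.

Let derives x (r : R) k := forall s y i, (size s < m)%N -> (forall j, `|y 0 j - x 0 j| <= r) ->
  is_derive y (basis_vec R i) (u k s) (u k (rcons s i) y).

Lemma near_is_derive_moll x (r : R) : 0 < r -> box_in D x (2 * r) ->
  \forall k \near \oo, derives x r k.
Proof.
move=> r0 xr; near=> k => s y i sm yx.
apply: (is_derive_moll oD wg M0 gM) => //.
move=> z Hz; apply: xr => j.
have kr : k.+1%:R^-1 < r by near: k; exact: near_infty_natSinv_lt (PosNum r0).
have -> : z 0 j - x 0 j = (z 0 j - y 0 j) + (y 0 j - x 0 j) by ring.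
apply: le_trans (ler_normD _ _) _.
have := Hz j; have := yx j; move: kr; move: (k.+1%:R^-1 : R) => a; lra.
Unshelve. all: by end_near. Qed.

Lemma inbox_box x y z w (r : R) : (forall i, `|y 0 i - x 0 i| <= r) ->
  (forall i, `|z 0 i - x 0 i| <= r) -> inbox y z w -> forall i, `|w 0 i - x 0 i| <= r.
Proof.
move=> yx zx H i; have [t /andP[t0 t1] ->] := H i.
have -> : y 0 i + t * (z 0 i - y 0 i) - x 0 i =
  (1 - t) * (y 0 i - x 0 i) + t * (z 0 i - x 0 i) by ring.
apply: le_trans (ler_normD _ _) _; rewrite !normrM (ger0_norm t0) ger0_norm ?subr_ge0//.
apply: (@le_trans _ _ ((1 - t) * r + t * r)); last by rewrite -mulrDl subrK mul1r.
by apply: lerD; apply: ler_wpM2l; rewrite ?subr_ge0.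
Qed.

Variable L : R.
Hypothesis L0 : 0 < L.
Hypothesis uL : forall s e x, (size s <= m)%N -> 0 < e -> `|moll D g c0 s e x| <= L.

Let uLk k s x : (size s <= m)%N -> `|u k s x| <= L.
Proof. by move=> sm; apply: uL => //; rewrite invr_gt0. Qed.

(** Landau's inequality: as second derivatives are bounded, the difference quotients
    with a fixed small step approximate the first derivatives uniformly in [k]; so
    convergence of the functions forces convergence of their derivatives. *)
Lemma moll_is_cvg s x : (size s < m)%N -> D x -> cvg (u k s x @[k --> \oo]).
Proof.
elim/last_ind: s x => [|s i IH] x sm Dx.
  by apply/cvg_ex; exists (f x); exact: (moll_cvg oD cf wg M0 gM).
move: sm; rewrite size_rcons => sm.
have [r r0 xr] := open_box Dx.
apply: cvg_of_approx => e e0.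
(* the error of the difference quotient with step [t] is at most [L * t] *)
pose t := Num.min r (e / L).
have t0 : 0 < t by rewrite lt_min r0 divr_gt0.
pose xt := x + t *: basis_vec R i.
have xt_i j : xt 0 j = x 0 j + t * (j == i)%:R by rewrite !mxE /=.
have hx j : `|x 0 j - x 0 j| <= r by rewrite subrr normr0 ltW.
have hxt j : `|xt 0 j - x 0 j| <= r.
  rewrite xt_i addrC addKr; case: eqP => _; last by rewrite mulr0 normr0 ltW.
  by rewrite mulr1 gtr0_norm// ge_min lexx.
have Dxt : D xt by apply: xr => j; apply: le_trans (hxt j) _; lra.
exists (fun k => (u k s xt - u k s x) / t); split.
  apply: is_cvgM; last exact: is_cvg_cst.
  by apply: is_cvgB; apply: IH => //; exact: ltnW.
near=> k.
have Hk : derives x r k by near: k; exact: near_is_derive_moll.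
have line c : 0 <= c <= t -> forall j, `|(x + c *: basis_vec R i) 0 j - x 0 j| <= r.
  move=> /andP[c0' ct] j; rewrite !mxE /= addrC addKr; case: eqP => _; last by rewrite mulr0 normr0 ltW.
  by rewrite mulr1 ger0_norm// (le_trans ct)// ge_min lexx.
have B : `|u k (rcons s i) x * t - (u k s xt - u k s x)| <= L * t * t.
  pose h c := u k (rcons s i) x * c - u k s (x + c *: basis_vec R i).
  have -> : u k (rcons s i) x * t - (u k s xt - u k s x) = h t - h 0.
    rewrite /h /xt scale0r addr0.
    by move: (u _ _ _) (u _ _ _) (u _ _ _) => A B C; ring.
  have -> : L * t * t = L * t * `|t - 0| by rewrite subr0 gtr0_norm.
  apply: (@mvt_bound _ h (fun c => u k (rcons s i) x - u k (rcons s i) (x + c *: basis_vec R i))).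
  rewrite min_l ?max_r ?(ltW t0)// => c ct; split.
    apply: is_deriveB.
      have := is_deriveZ (u k (rcons s i) x) (is_derive_id c (1 : R)).
      by congr is_derive; rewrite [_ *: _]mulr1.
    by apply: is_derive_line; apply: Hk; [exact: ltnW|exact: line].
  rewrite distrC -{2}[x]addr0 -(scale0r (basis_vec R i)).
  apply: (@le_trans _ _ (L * `|c - 0|)); last first.
    by rewrite subr0 ger0_norm ?ler_wpM2l ?(ltW L0)//; case/andP: ct.
  apply: (@mvt_bound _ (fun c => u k (rcons s i) (x + c *: basis_vec R i))
     (fun c => u k (rcons (rcons s i) i) (x + c *: basis_vec R i))) => d.
  move: ct => /andP[c0' ct]; rewrite min_l ?max_r// => /andP[d0 dc]; split.
    apply: is_derive_line; apply: Hk; first by rewrite size_rcons.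
    by apply: line; rewrite d0 (le_trans dc).
  by apply: uLk; rewrite !size_rcons.
have -> : u k (rcons s i) x - (u k s xt - u k s x) / t =
    (u k (rcons s i) x * t - (u k s xt - u k s x)) / t.
  by move: (u _ _ _) (u _ _ xt) (u _ _ _) => A1 B1 C1; field; rewrite gt_eqF.
rewrite normrM normfV (gtr0_norm t0) ler_pdivrMr//.
apply: le_trans B _; rewrite ler_wpM2r ?(ltW t0)// mulrC -ler_pdivlMr//.
by rewrite ge_min lexx orbT.
Unshelve. all: by end_near. Qed.

Definition classical_deriv s x : R := lim (u k s x @[k --> \oo]).

Lemma classical_deriv_cvg s x : (size s < m)%N -> D x ->
  u k s x @[k --> \oo] --> classical_deriv s x.
Proof. exact: moll_is_cvg. Qed.

Lemma classical_deriv_nil x : D x -> classical_deriv [::] x = f x.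
Proof. by move=> Dx; apply: cvg_lim => //; exact: (moll_cvg oD cf wg M0 gM). Qed.

Lemma cvg_normr (a : nat -> R) (l : R) :
  a k @[k --> \oo] --> l -> `|a k| @[k --> \oo] --> `|l|.
Proof. by move=> al; apply: (cvg_norm al). Qed.

Lemma classical_deriv_local : (3 <= m)%N -> local_C21 D L classical_deriv.
Proof.
move=> m3 s s2.
have sm : (size s < m)%N by exact: leq_trans m3.
split=> [x Dx|x Dx].
  apply: (ler_lim_near (cvg_normr (classical_deriv_cvg sm Dx)) (cvg_cst L)).
  by apply: nearW => k; apply: uLk; exact: ltnW.
have [r r0 xr] := open_box Dx.
have Dr y : (forall i, `|y 0 i - x 0 i| <= r) -> D y.
  by move=> yx; apply: xr => i; apply: le_trans (yx i) _; lra.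
exists r => // y z yx zx; split; first exact: Dr.
  apply: (ler_lim_near (a := fun k => `|u k s y - u k s z|)
      (b := fun=> L * norm1 (y - z)) _ (cvg_cst _)).
    by apply: cvg_normr; apply: cvgB; apply: classical_deriv_cvg => //; exact: Dr.
  near=> k.
  apply: (@box_mvt _ _ _ (fun i => u k (rcons s i))) => w zyw i; split.
    have H : derives x r k by near: k; exact: near_is_derive_moll.
    by apply: H => //; exact: inbox_box zyw.
  by apply: uLk; rewrite size_rcons.
move=> s2'; have sm2 : ((size s).+1 < m)%N by exact: leq_trans m3.
apply: (ler_lim_near (a := fun k => `|u k s y - u k s z -
      \sum_i (y - z) 0 i * u k (rcons s i) z|)
      (b := fun=> L * norm1 (y - z) ^+ 2) _ (cvg_cst _)).
  apply: cvg_normr; apply: cvgB.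
    by apply: cvgB; apply: classical_deriv_cvg => //; exact: Dr.
  apply: cvg_bigsum => i.
  apply: cvgM; first exact: cvg_cst.
  by apply: classical_deriv_cvg; [rewrite size_rcons|exact: Dr].
near=> k.
have H : derives x r k by near: k; exact: near_is_derive_moll.
rewrite expr2 mulrA.
apply: (@box_taylor _ _ _ (fun i => u k (rcons s i))) => w zyw i; split.
  by apply: H => //; exact: inbox_box zyw.
apply: (@le_trans _ _ (L * norm1 (w - z))); last first.
  by rewrite ler_wpM2l ?(ltW L0)//; exact: inbox_norm1.
have wx := inbox_box zx yx zyw.
apply: (@box_mvt _ _ _ (fun j => u k (rcons (rcons s i) j))) => v zwv j; split.
  by apply: H; [rewrite size_rcons|exact: inbox_box zwv].
by apply: uLk; rewrite !size_rcons.
Unshelve. all: by end_near. Qed.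

End classical_derivatives.

(** The derivatives up to order 3 of the mollifications are bounded in terms of the Sobolev
    norm, uniformly in the scale; Lipschitz and Taylor estimates on boxes pass to the limit. *)
Lemma sobolev_C21 (R : realType) (n m : nat) (M : R) : (3 <= m)%N ->
  exists2 L : R, 0 < L & forall (D : set 'rV[R]_n) (f : 'rV[R]_n -> R), open D ->
    (forall x, D x -> {for x, continuous f}) ->
    (sobolev_infty_norm m D f <= M%:E)%E ->
    exists2 G, local_C21 D L G & forall x, D x -> G [::] x = f x.
Proof.
move=> m3; have [c0 c00 Hc0] := bump_integral R.
have [C C0 HC] := @kernel_bound R n _ c00.
pose M' := `|M| + 1.
have M'0 : 0 <= M' by rewrite addr_ge0.
exists ((M' + 1) * C * 2 ^+ n) => [|D f oD cf].
  by rewrite !mulr_gt0 ?exprn_gt0// ltr_wpDl.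
move=> fM; have {fM} : (sobolev_infty_norm m D f < M'%:E)%E.
  by apply: le_lt_trans fM _; rewrite lte_fin /M' (le_lt_trans (ler_norm M))// ltrDl.
move=> /ereal_inf_lt[_ [g wg <-] gM].
have gM' s : (size s <= m)%N ->
    {ae lebn R n, forall t, D (row_of_tuple t) -> `|g s (row_of_tuple t)| <= M'}.
  move=> sm.
  have : (ess_sup_on D (fun x => `|g s x|%:E) < M'%:E)%E.
    by apply: le_lt_trans gM; apply: ereal_sup_ubound; exists s.
  move=> /ereal_inf_lt[r Hr rM']; apply: filterS Hr => t /= + Dt.
  rewrite patchE mem_set//= => H.
  by have := le_lt_trans H rM'; rewrite lte_fin => /ltW.
exists (classical_deriv D g c0).
  apply: (classical_deriv_local oD cf wg M'0 gM' c00 Hc0) => //.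
    by rewrite !mulr_gt0 ?exprn_gt0// ltr_wpDl.
  by move=> s e x; exact: (moll_bound oD wg M'0 gM' C0 HC x).
by move=> x Dx; exact: (classical_deriv_nil oD cf wg M'0 gM' c00 Hc0).
Qed.

(** * Global Lipschitz bounds and the chain rule *)

Section norms_rV.
Variables (R : realType) (n : nat).
Implicit Types x y : 'rV[R]_n.

Lemma enorm_ge0 x : 0 <= enorm x.
Proof. exact: sqrtr_ge0. Qed.

Lemma coord_le_enorm x i : `|x 0 i| <= enorm x.
Proof.
rewrite -sqrtr_sqr ler_wsqrtr// (bigD1 i)//= lerDl.
by apply: sumr_ge0 => j _; exact: sqr_ge0.
Qed.

Lemma enorm_le_norm1 x : enorm x <= norm1 x.
Proof.
rewrite -[leRHS](ger0_norm (norm1_ge0 x)) -sqrtr_sqr ler_wsqrtr// /norm1.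
elim: (index_enum _) => [|i s IH]; first by rewrite !big_nil expr0n.
rewrite !big_cons sqrrD real_normK ?num_real// -addrA lerD2l.
by apply: le_trans IH _; rewrite lerDr mulrn_wge0// mulr_ge0// sumr_ge0.
Qed.

Lemma norm1_le_enorm x : norm1 x <= n%:R * enorm x.
Proof.
by apply: ler_sum_ord_const => i; exact: coord_le_enorm.
Qed.

End norms_rV.

Section quasiconvexity.
Variables (R : realType) (n : nat).

(** The supremum of the parameters up to which the bound holds can be exceeded unless it
    is 1. *)
Lemma unit_interval_lipschitz (u : R -> R) (L : R) : 0 <= L ->
  (forall t, 0 <= t <= 1 -> exists2 r : R, 0 < r & forall s s', 0 <= s <= 1 ->
     0 <= s' <= 1 -> `|s - t| <= r -> `|s' - t| <= r -> `|u s - u s'| <= L * `|s - s'|) ->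
  `|u 1 - u 0| <= L.
Proof.
move=> L0 H; pose A := [set t | 0 <= t <= 1 /\ `|u t - u 0| <= L * t].
have A0 : A 0 by rewrite /A /= lexx ler01 subrr normr0 mulr0.
have A1 : has_sup A.
  by split; [exists 0|exists 1 => t [/andP[]]].
pose T := sup A.
have T0 : 0 <= T by apply: ub_le_sup => //; exact: A1.2.
have T1 : T <= 1 by apply: ge_sup => [|t [/andP[]]]; first by exists 0.
have [r r0 Hr] := H T (introT andP (conj T0 T1)).
have AT : A T.
  have [t At Tt] := sup_adherent r0 A1.
  have tT : t <= T by apply: ub_le_sup => //; exact: A1.2.
  have [t01 ut] := At.
  split; first by rewrite T0.
  have -> : u T - u 0 = (u T - u t) + (u t - u 0) by ring.
  apply: le_trans (ler_normD _ _) _.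
  have := Hr T t; rewrite T0 T1 subrr normr0 => /(_ isT t01 (ltW r0)).
  have e1 : `|T - t| = T - t by rewrite ger0_norm ?subr_ge0.
  rewrite distrC e1 => Htt.
  have : `|u T - u t| <= L * (T - t) by apply: Htt; rewrite -/T in Tt; lra.
  by rewrite mulrBr; lra.
have [T1'|T1'] := ltP T 1; last first.
  have {}T1 : T = 1 by apply/eqP; rewrite eq_le T1 T1'.
  by have [_] := AT; rewrite T1 mulr1.
pose s := Num.min 1 (T + r).
have Ts : T < s by rewrite lt_min T1' ltrDl.
have s1 : s <= 1 by rewrite ge_min lexx.
have sr : s <= T + r by rewrite ge_min lexx orbT.
suff : A s by move=> As; have := ub_le_sup A1.2 As; rewrite -/T leNgt Ts.
have s01 : 0 <= s <= 1 by rewrite s1 (le_trans T0 (ltW Ts)).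
split=> //.
have -> : u s - u 0 = (u s - u T) + (u T - u 0) by ring.
apply: le_trans (ler_normD _ _) _.
have : `|u s - u T| <= L * `|s - T|.
  apply: Hr => //; rewrite ?T0// ?subrr ?normr0 ?(ltW r0)//.
  by rewrite ger0_norm ?subr_ge0 ?(ltW Ts)//; lra.
rewrite ger0_norm ?subr_ge0 ?(ltW Ts)//; have [_] := AT.
by rewrite mulrBr; lra.
Qed.

(** Locally Lipschitz bounds propagate along the paths provided by quasiconvexity;
    for distant points, boundedness suffices. *)
Lemma quasiconvex_lipschitz (D : set 'rV[R]_n) (L : R) : locally_quasiconvex D -> 0 < L ->
  exists2 K : R, 0 < K & forall G, local_C21 D L G -> forall s, (size s <= 2)%N ->
    forall x y, D x -> D y -> `|G s x - G s y| <= K * norm1 (x - y).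
Proof.
move=> [delta [lambda [delta0 Hg]]] L0.
have K1 : 0 <= L * n%:R * `|lambda| by rewrite !mulr_ge0// ltW.
have K2 : 0 < (L + L) / delta by rewrite divr_gt0// addr_gt0.
exists (L * n%:R * `|lambda| + (L + L) / delta) => [|G HG s s2 x y Dx Dy].
  by rewrite ltr_wpDl.
have [HL Hloc] := HG s s2.
have [xy|xy] := ltP (enorm (x - y)) delta; last first.
  apply: le_trans (ler_normB _ _) _; apply: le_trans (lerD (HL _ Dx) (HL _ Dy)) _.
  rewrite mulrDl ler_wpDl ?mulr_ge0 ?norm1_ge0 ?(ltW L0)//.
  rewrite mulrAC ler_pdivlMr// ler_wpM2l//; first by rewrite addr_ge0// ltW.
  exact: le_trans xy (enorm_le_norm1 _).
have [gamma [g0 g1 gD gL]] := Hg _ _ Dx Dy xy.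
rewrite distrC -g0 -g1.
apply: (@le_trans _ _ (L * n%:R * `|lambda| * norm1 (x - y))); last first.
  by rewrite g0 g1 ler_wpM2r ?norm1_ge0// lerDl ltW.
rewrite g0 g1.
have -> : `|G s y - G s x| = `|(G s \o gamma) 1 - (G s \o gamma) 0| by rewrite /= g0 g1.
have C0 : 0 <= `|lambda| * norm1 (x - y) by rewrite mulr_ge0 ?norm1_ge0.
have gL' a b : 0 <= a <= 1 -> 0 <= b <= 1 ->
    enorm (gamma a - gamma b) <= `|lambda| * norm1 (x - y) * `|a - b|.
  move=> ha hb; apply: le_trans (gL _ _ ha hb) _; rewrite ler_wpM2r//.
  apply: (@le_trans _ _ (`|lambda| * enorm (x - y))).
    by rewrite ler_wpM2r ?enorm_ge0 ?ler_norm.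
  by rewrite ler_wpM2l// enorm_le_norm1.
apply: unit_interval_lipschitz => [|t t01].
  by rewrite mulr_ge0 ?norm1_ge0.
have [r r0 Hr] := Hloc _ (gD _ t01).
pose e := r / (`|lambda| * norm1 (x - y) + 1).
have e0 : 0 < e by rewrite divr_gt0// ltr_wpDl.
have near_t a : 0 <= a <= 1 -> `|a - t| <= e -> forall i, `|gamma a 0 i - gamma t 0 i| <= r.
  move=> ha at_ i; have := coord_le_enorm (gamma a - gamma t) i; rewrite !mxE => /le_trans; apply.
  apply: le_trans (gL' _ _ ha t01) _.
  apply: (@le_trans _ _ (`|lambda| * norm1 (x - y) * e)); first exact: ler_wpM2l.
  by rewrite /e mulrCA ler_piMr ?(ltW r0)// ler_pdivrMr ?mul1r ?ltr_wpDl// lerDl.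
exists e => // a b ha hb hat hbt.
have [_ H _] := Hr _ _ (near_t _ ha hat) (near_t _ hb hbt).
apply: le_trans H _; rewrite -!mulrA ler_wpM2l ?(ltW L0)//.
apply: le_trans (norm1_le_enorm _) _; rewrite ler_wpM2l//.
by rewrite mulrA; exact: gL'.
Qed.

End quasiconvexity.

Section chain_rule.
Variables (R : realType) (N d : nat).

(** The chain rule for an outer function that is only known to have a first-order Taylor
    expansion with a quadratic remainder. *)
Lemma is_derive_comp_taylor (phi : 'rV[R]_N -> 'rV[R]_d) (f : 'rV[R]_d -> R)
    (xi v : 'rV[R]_N) (p Gf : 'I_d -> R) (r C : R) :
  (forall j, is_derive xi v (fun eta => phi eta 0 j) (p j)) -> 0 < r ->
  (forall y : 'rV[R]_d, (forall j, `|y 0 j - phi xi 0 j| <= r) ->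
     `|f y - f (phi xi) - \sum_j (y - phi xi) 0 j * Gf j| <= C * norm1 (y - phi xi) ^+ 2) ->
  is_derive xi v (f \o phi) (\sum_j p j * Gf j).
Proof.
move=> dphi r0 Hf.
pose q j (h : R) : R := h^-1 * (phi (h *: v + xi) 0 j - phi xi 0 j).
have qp j : q j h @[h --> (0 : R)^'] --> p j.
  by have [/cvg_ex[l Hl] E] := dphi j; rewrite -E /derive; apply/cvg_ex; exists l.
have h0 : h @[h --> (0 : R)^'] --> (0 : R) by apply: cvg_within.
have hq j : (h * q j h) @[h --> (0 : R)^'] --> (0 : R).
  by rewrite -[X in _ --> X](mul0r (p j)); exact: cvgM.
have S1 : (\sum_j q j h * Gf j) @[h --> (0 : R)^'] --> \sum_j p j * Gf j.
  by apply: cvg_bigsum => j; apply: cvgM => //; exact: cvg_cst.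
have S2 : (\sum_j `|q j h|) @[h --> (0 : R)^'] --> \sum_j `|p j|.
  by apply: cvg_bigsum => j; exact: (cvg_norm (qp j)).
have S3 : (`|C| * (`|h| * (\sum_j `|q j h|) ^+ 2)) @[h --> (0 : R)^'] --> (0 : R).
  rewrite [X in _ --> X](_ : _ = `|C| * (`|0 : R| * (\sum_j `|p j|) ^+ 2)); last first.
    by rewrite normr0 mul0r mulr0.
  apply: cvgM; first exact: cvg_cst.
  apply: cvgM; first exact: (cvg_norm h0).
  by rewrite expr2; under eq_fun do rewrite expr2; exact: cvgM.
have L : h^-1 *: (((f \o phi) \o shift xi) (h *: v) - (f \o phi) xi) @[h --> (0 : R)^']
    --> \sum_j p j * Gf j.
  have -> : \sum_j p j * Gf j = \sum_j p j * Gf j + 0 by rewrite addr0.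
  have -> : (fun h : R => h^-1 *: (((f \o phi) \o shift xi) (h *: v) - (f \o phi) xi)) =
     (fun h => \sum_j q j h * Gf j +
       (h^-1 * (f (phi (h *: v + xi)) - f (phi xi)) - \sum_j q j h * Gf j)).
    by apply/funext => h; rewrite [RHS]addrC subrK.
  apply: cvgD => //; apply/norm_cvg0P.
  apply: (squeeze_cvgr _ (cvg_cst 0) S3); near=> h.
  rewrite normr_ge0/=.
  have hn : h != 0 by near: h; exact: nbhs_dnbhs_neq.
  have E j : phi (h *: v + xi) 0 j - phi xi 0 j = h * q j h.
    by rewrite /q mulrA divff// mul1r.
  have Hr : forall j, `|phi (h *: v + xi) 0 j - phi xi 0 j| <= r.
    move=> j; rewrite E; move: j; near: h; apply: filter_forall => k.
    by move/cvgr0Pnorm_le: (hq k); apply.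
  have -> : h^-1 * (f (phi (h *: v + xi)) - f (phi xi)) - \sum_j q j h * Gf j =
    h^-1 * (f (phi (h *: v + xi)) - f (phi xi) -
      \sum_j (phi (h *: v + xi) - phi xi) 0 j * Gf j).
    rewrite [RHS]mulrBr; congr (_ - _); rewrite mulr_sumr; apply: eq_bigr => j _.
    by rewrite !mxE E mulrA mulrA mulVf// mul1r.
  rewrite normrM normfV ler_pdivrMl ?normr_gt0//.
  apply: le_trans (Hf _ Hr) _.
  have -> : norm1 (phi (h *: v + xi) - phi xi) = `|h| * \sum_j `|q j h|.
    by rewrite /norm1 mulr_sumr; apply: eq_bigr => j _; rewrite !mxE E normrM.
  apply: (@le_trans _ _ (`|C| * (`|h| * \sum_j `|q j h|) ^+ 2)).
    by rewrite ler_wpM2r ?sqr_ge0 ?ler_norm.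
  by rewrite le_eqVlt; apply/orP; left; apply/eqP; ring.
by split; [apply/cvg_ex; exists (\sum_j p j * Gf j)|exact/cvg_lim].
Unshelve. all: by end_near. Qed.

End chain_rule.
(** * The estimates on the reference simplex *)

Section reference_estimates.
Variables (R : realType) (n d k : nat).
Hypothesis k0 : (0 < k)%N.
Implicit Types (xi v : 'rV[R]_n) (u : 'rV[R]_n -> R).

Lemma ref_simplex_segment xi xi0 (t : R) : ref_simplex xi -> ref_simplex xi0 ->
  0 <= t <= 1 -> ref_simplex (xi0 + t *: (xi - xi0)).
Proof.
move=> [x0 x1] [y0 y1] /andP[t0 t1].
have E i : (xi0 + t *: (xi - xi0)) 0 i = (1 - t) * xi0 0 i + t * xi 0 i.
  by rewrite !mxE; ring.
split=> [i|]; first by rewrite E addr_ge0// mulr_ge0// subr_ge0.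
under eq_bigr do rewrite E; rewrite big_split/= -!mulr_sumr.
apply: (@le_trans _ _ ((1 - t) * 1 + t * 1)); last by rewrite !mulr1 subrK.
by apply: lerD; rewrite ler_wpM2l// subr_ge0.
Qed.

Lemma ref_simplex_coordB xi xi0 i : ref_simplex xi -> ref_simplex xi0 ->
  `|(xi - xi0) 0 i| <= 1.
Proof.
move=> /ref_simplex_coord/(_ i)/andP[x0 x1] /ref_simplex_coord/(_ i)/andP[y0 y1].
by rewrite !mxE ler_norml; lra.
Qed.

Lemma ref_simplex_mvt u (du : 'I_n -> 'rV[R]_n -> R) (B : R) : 0 <= B ->
  (forall xi, ref_simplex xi -> forall v, is_derive xi v u (\sum_i v 0 i * du i xi)) ->
  (forall xi, ref_simplex xi -> forall i, `|du i xi| <= B) ->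
  forall xi xi0, ref_simplex xi -> ref_simplex xi0 -> `|u xi - u xi0| <= n%:R * B.
Proof.
move=> B0 hu hB xi xi0 hxi hxi0.
pose h (t : R) := u (xi0 + t *: (xi - xi0)).
have -> : u xi - u xi0 = h 1 - h 0.
  by rewrite /h scale1r scale0r addr0 [xi0 + (_ - _)]addrC subrK.
have -> : n%:R * B = n%:R * B * `|1 - 0 : R| by rewrite subr0 normr1 mulr1.
apply: (@mvt_bound _ h (fun t => \sum_i (xi - xi0) 0 i * du i (xi0 + t *: (xi - xi0)))) => t.
rewrite min_l ?max_r// => t01.
have hz := ref_simplex_segment hxi hxi0 t01.
split; first by apply: is_derive_line; exact: hu.
apply: (le_trans (ler_norm_sum _ _ _)).
apply: ler_sum_ord_const => i.
rewrite normrM -[leRHS]mul1r; apply: ler_pM => //; last exact: hB.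
exact: ref_simplex_coordB.
Qed.

Definition vector_Pk (phi : 'rV[R]_n -> 'rV[R]_d) : Prop :=
  forall j, in_Pk k (fun xi => phi xi 0 j).

Definition vpartial (phi : 'rV[R]_n -> 'rV[R]_d) i j : 'rV[R]_n -> R :=
  partial i (fun xi => phi xi 0 j).

Lemma is_derive_vector_Pk phi xi v j : vector_Pk phi ->
  is_derive xi v (fun eta => phi eta 0 j) (\sum_i v 0 i * vpartial phi i j xi).
Proof. by move=> hphi; exact: is_derive_Pk (hphi j) xi v. Qed.

Lemma ref_simplex_vector_mvt phi (H : R) : 0 <= H -> vector_Pk phi ->
  (forall xi, ref_simplex xi -> forall i j, `|vpartial phi i j xi| <= H) ->
  forall xi xi0, ref_simplex xi -> ref_simplex xi0 ->
    norm1 (phi xi - phi xi0) <= d%:R * (n%:R * H).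
Proof.
move=> H0 hphi hH xi xi0 hxi hxi0.
apply: ler_sum_ord_const => j.
rewrite !mxE.
apply: (ref_simplex_mvt (u := fun eta => phi eta 0 j) (du := fun i => vpartial phi i j)) => //.
  by move=> eta _ v; exact: is_derive_vector_Pk.
by move=> eta heta i; exact: hH.
Qed.

Section composition.
Variables (D : set 'rV[R]_d) (G : seq 'I_d -> 'rV[R]_d -> R) (L KG : R).
Hypothesis HG : local_C21 D L G.
Hypothesis HL : forall s, (size s <= 2)%N -> forall x y, D x -> D y ->
  `|G s x - G s y| <= KG * norm1 (x - y).
Hypothesis L0 : 0 < L.
Hypothesis KG0 : 0 < KG.

Lemma is_derive_comp_vector_Pk phi s xi v : vector_Pk phi -> (size s < 2)%N -> D (phi xi) ->
  is_derive xi v (G s \o phi)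
    (\sum_j (\sum_i v 0 i * vpartial phi i j xi) * G (rcons s j) (phi xi)).
Proof.
move=> hphi s2 Dphi; have [_ /(_ _ Dphi)[r r0 Hr]] := HG (ltnW s2).
apply: (is_derive_comp_taylor (r := r) (C := L)) => // [j|y Hy].
  exact: is_derive_vector_Pk.
have Hx j : `|phi xi 0 j - phi xi 0 j| <= r by rewrite subrr normr0 ltW.
by have [_ _ /(_ s2)] := Hr y (phi xi) Hy Hx.
Qed.

Variables (phi psi : 'rV[R]_n -> 'rV[R]_d) (H E0 E1 : R).
Hypothesis hphi : vector_Pk phi.
Hypothesis hpsi : vector_Pk psi.
Hypothesis H0 : 0 <= H.
Hypothesis E00 : 0 <= E0.
Hypothesis E10 : 0 <= E1.
Hypothesis phiD : forall xi, ref_simplex xi -> D (phi xi).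
Hypothesis psiD : forall xi, ref_simplex xi -> D (psi xi).
Hypothesis phiH : forall xi, ref_simplex xi -> forall i j, `|vpartial phi i j xi| <= H.
Hypothesis psiH : forall xi, ref_simplex xi -> forall i j, `|vpartial psi i j xi| <= H.
Hypothesis eE0 : forall xi, ref_simplex xi -> forall j, `|(phi xi - psi xi) 0 j| <= E0.
Hypothesis eE1 : forall xi, ref_simplex xi -> forall i j,
  `|vpartial phi i j xi - vpartial psi i j xi| <= E1.

Let g s xi : R := G s (phi xi) - G s (psi xi).
Let dg s i xi : R := \sum_j (vpartial phi i j xi * G (rcons s j) (phi xi) -
                            vpartial psi i j xi * G (rcons s j) (psi xi)).

Lemma norm1_difference xi : ref_simplex xi -> norm1 (phi xi - psi xi) <= d%:R * E0.
Proof.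
by move=> hxi; apply: ler_sum_ord_const => j; exact: eE0.
Qed.

Lemma is_derive_difference s xi v : (size s < 2)%N -> ref_simplex xi ->
  is_derive xi v (g s) (\sum_i v 0 i * dg s i xi).
Proof.
move=> s2 hxi.
have := is_deriveB (is_derive_comp_vector_Pk v hphi s2 (phiD hxi))
                   (is_derive_comp_vector_Pk v hpsi s2 (psiD hxi)).
congr is_derive; rewrite -sumrB.
under eq_bigr do rewrite !mulr_suml -sumrB.
rewrite exchange_big/=; apply: eq_bigr => i _; rewrite /dg mulr_sumr.
by apply: eq_bigr => j _; rewrite mulrBr !mulrA.
Qed.

Lemma difference_bound s xi : (size s <= 2)%N -> ref_simplex xi ->
  `|g s xi| <= KG * (d%:R * E0).
Proof.
move=> s2 hxi; apply: le_trans (HL s2 (phiD hxi) (psiD hxi)) _.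
by rewrite ler_wpM2l ?(ltW KG0)//; exact: norm1_difference.
Qed.

Lemma ddifference_bound s i xi : (size s < 2)%N -> ref_simplex xi ->
  `|dg s i xi| <= d%:R * (E1 * L + H * (KG * (d%:R * E0))).
Proof.
move=> s2 hxi; apply: (le_trans (ler_norm_sum _ _ _)).
apply: ler_sum_ord_const => j.
have s2' : (size (rcons s j) <= 2)%N by rewrite size_rcons.
have -> : vpartial phi i j xi * G (rcons s j) (phi xi) -
    vpartial psi i j xi * G (rcons s j) (psi xi) =
  (vpartial phi i j xi - vpartial psi i j xi) * G (rcons s j) (phi xi) +
  vpartial psi i j xi * g (rcons s j) xi by rewrite /g; ring.
apply: (le_trans (ler_normD _ _)); rewrite !normrM; apply: lerD.
  by apply: ler_pM => //; [exact: eE1|have [+ _] := HG s2'; apply; exact: phiD].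
by apply: ler_pM => //; [exact: psiH|exact: difference_bound].
Qed.

Variable xi0 : 'rV[R]_n.
Hypothesis hxi0 : ref_simplex xi0.

(** The first-order Taylor polynomials of [G [::]] at [phi xi0] and [psi xi0], composed
    with [phi] and [psi]: interpolation of degree [k] reproduces this function. *)
Definition taylor_part xi : R := g [::] xi0 + \sum_j ((phi xi - phi xi0) 0 j * G [:: j] (phi xi0) -
                                     (psi xi - psi xi0) 0 j * G [:: j] (psi xi0)).
Definition remainder xi : R := g [::] xi - taylor_part xi.
Definition dremainder i xi : R := \sum_j (vpartial phi i j xi * (G [:: j] (phi xi) - G [:: j] (phi xi0)) -
                          vpartial psi i j xi * (G [:: j] (psi xi) - G [:: j] (psi xi0))).

Lemma in_Pk_taylor_part : in_Pk k taylor_part.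
Proof.
apply: in_PkD; first exact: in_Pk_cst.
apply: in_Pk_sum => j _; apply: in_PkB.
  rewrite (_ : (fun xi => _) = (fun xi => G [:: j] (phi xi0) * (phi xi 0 j - phi xi0 0 j))).
    by apply/in_PkZ/in_PkB; [exact: hphi|exact: in_Pk_cst].
  by apply/funext => xi; rewrite !mxE mulrC.
rewrite (_ : (fun xi => _) = (fun xi => G [:: j] (psi xi0) * (psi xi 0 j - psi xi0 0 j))).
  by apply/in_PkZ/in_PkB; [exact: hpsi|exact: in_Pk_cst].
by apply/funext => xi; rewrite !mxE mulrC.
Qed.

Lemma is_derive_taylor_part xi v : is_derive xi v taylor_part
  (\sum_j ((\sum_i v 0 i * vpartial phi i j xi) * G [:: j] (phi xi0) -
           (\sum_i v 0 i * vpartial psi i j xi) * G [:: j] (psi xi0))).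
Proof.
have D2 : is_derive xi v
   (fun eta => \sum_j ((phi eta - phi xi0) 0 j * G [:: j] (phi xi0) -
                       (psi eta - psi xi0) 0 j * G [:: j] (psi xi0)))
   (\sum_j ((\sum_i v 0 i * vpartial phi i j xi) * G [:: j] (phi xi0) -
            (\sum_i v 0 i * vpartial psi i j xi) * G [:: j] (psi xi0))); last first.
  by have := is_deriveD (is_derive_cst (g [::] xi0) xi v) D2; rewrite add0r.
apply: is_derive_bigsum => j _; apply: is_deriveB.
  have := is_deriveZ (G [:: j] (phi xi0)) (is_deriveB (is_derive_vector_Pk xi v j hphi)
    (is_derive_cst (phi xi0 0 j) xi v)).
  rewrite subr0 [X in is_derive _ _ _ X]mulrC; congr is_derive.
  by apply/funext => eta; rewrite !mxE mulrC.
have := is_deriveZ (G [:: j] (psi xi0)) (is_deriveB (is_derive_vector_Pk xi v j hpsi)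
  (is_derive_cst (psi xi0 0 j) xi v)).
rewrite subr0 [X in is_derive _ _ _ X]mulrC; congr is_derive.
by apply/funext => eta; rewrite !mxE mulrC.
Qed.

Lemma is_derive_remainder xi v : ref_simplex xi ->
  is_derive xi v remainder (\sum_i v 0 i * dremainder i xi).
Proof.
move=> hxi.
have := is_deriveB (is_derive_difference (s := [::]) v isT hxi) (is_derive_taylor_part xi v).
congr is_derive.
under [X in _ - X]eq_bigr do rewrite !mulr_suml -sumrB.
rewrite [X in _ - X]exchange_big/= -sumrB; apply: eq_bigr => i _.
rewrite /dg /dremainder/= !mulr_sumr -sumrB; apply: eq_bigr => j _; ring.
Qed.

(** The second difference of [G [:: j]] over the four points is a difference in [xi] of
    the difference in [phi] and [psi], and is estimated by the mean value theorem. *)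
Lemma four_point j xi : ref_simplex xi -> `|g [:: j] xi - g [:: j] xi0| <=
  n%:R * (d%:R * (E1 * L + H * (KG * (d%:R * E0)))).
Proof.
move=> hxi.
apply: (ref_simplex_mvt (du := dg [:: j])) => //.
- rewrite mulr_ge0// addr_ge0// !mulr_ge0//; exact: ltW.
- by move=> eta heta v; exact: is_derive_difference.
- by move=> eta heta i; exact: ddifference_bound.
Qed.

Definition remainder_const : R :=
  d%:R * (KG * (d%:R * n%:R)) + d%:R * (n%:R * (d%:R * (L + KG * d%:R))).

(** Each term contains a factor [H] and is either linear in the derivative of
    [phi - psi], or quadratic in [H]: this is where the power of [h] is gained. *)
Lemma dremainder_bound i xi : ref_simplex xi ->
  `|dremainder i xi| <= remainder_const * (H * (E1 + H * E0)).
Proof.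
move=> hxi; apply: (le_trans (ler_norm_sum _ _ _)).
have HE : 0 <= H * (E1 + H * E0) by rewrite mulr_ge0// addr_ge0// mulr_ge0.
have -> : remainder_const * (H * (E1 + H * E0)) = \sum_(j < d)
    ((KG * (d%:R * n%:R) + n%:R * (d%:R * (L + KG * d%:R))) * (H * (E1 + H * E0))).
  by rewrite sumr_const card_ord -[RHS]mulr_natl /remainder_const; ring.
apply: ler_sum => j _.
have -> : vpartial phi i j xi * (G [:: j] (phi xi) - G [:: j] (phi xi0)) -
          vpartial psi i j xi * (G [:: j] (psi xi) - G [:: j] (psi xi0)) =
  (vpartial phi i j xi - vpartial psi i j xi) * (G [:: j] (phi xi) - G [:: j] (phi xi0)) +
  vpartial psi i j xi * (g [:: j] xi - g [:: j] xi0) by rewrite /g; ring.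
apply: (le_trans (ler_normD _ _)); rewrite !normrM [leRHS]mulrDl; apply: lerD.
  apply: (@le_trans _ _ (E1 * (KG * (d%:R * (n%:R * H))))).
    apply: ler_pM => //; first exact: eE1.
    apply: le_trans (HL (s := [:: j]) isT (phiD hxi) (phiD hxi0)) _.
    by rewrite ler_wpM2l ?(ltW KG0)//; exact: ref_simplex_vector_mvt.
  have -> : E1 * (KG * (d%:R * (n%:R * H))) = KG * (d%:R * n%:R) * (H * E1) by ring.
  rewrite ler_wpM2l ?mulr_ge0 ?(ltW KG0)// ler_wpM2l// lerDl mulr_ge0//.
apply: (@le_trans _ _ (H * (n%:R * (d%:R * (E1 * L + H * (KG * (d%:R * E0))))))).
  by apply: ler_pM => //; [exact: psiH|exact: four_point].
have -> : H * (n%:R * (d%:R * (E1 * L + H * (KG * (d%:R * E0))))) =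
  n%:R * (d%:R * (H * (L * E1 + KG * d%:R * (H * E0)))) by ring.
have -> : n%:R * (d%:R * (L + KG * d%:R)) * (H * (E1 + H * E0)) =
  n%:R * (d%:R * (H * ((L + KG * d%:R) * (E1 + H * E0)))) by ring.
do 3 (rewrite ler_wpM2l//).
have HE0 : 0 <= H * E0 by rewrite mulr_ge0.
have KGd : 0 <= KG * d%:R by rewrite mulr_ge0// ltW.
rewrite mulrDl !mulrDr; have := mulr_ge0 (ltW L0) HE0; have := mulr_ge0 KGd E10.
move: (L * E1) (L * (H * E0)) (KG * d%:R * E1) (KG * d%:R * (H * E0)) => a b c e; lra.
Qed.

Lemma remainder_bound xi : ref_simplex xi ->
  `|remainder xi| <= n%:R * (remainder_const * (H * (E1 + H * E0))).
Proof.
move=> hxi; have w0 : remainder xi0 = 0.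
  rewrite /remainder /taylor_part big1 ?addr0 ?subrr// => j _.
  by rewrite !mxE !mul0r subrr.
rewrite -[remainder xi]subr0 -w0; apply: (ref_simplex_mvt (du := dremainder)) => //.
- rewrite !mulr_ge0//; last by rewrite addr_ge0// mulr_ge0.
  by rewrite addr_ge0// !mulr_ge0 ?addr_ge0 ?mulr_ge0// ltW.
- by move=> eta heta v; exact: is_derive_remainder.
- by move=> eta heta i; exact: dremainder_bound.
Qed.

End composition.
End reference_estimates.
Section reference_theorem.
Variables (R : realType) (n d k : nat).
Hypothesis k0 : (0 < k)%N.

Lemma nodal_norm_le_sup : exists2 C : R, 0 < C & forall (g : 'rV[R]_n -> R) (B : R),
  (forall xi, ref_simplex xi -> `|g xi| <= B) -> nodal_norm k g <= C * B.
Proof.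
have B0 (g : 'rV[R]_n -> R) (B : R) : (forall xi, ref_simplex xi -> `|g xi| <= B) -> 0 <= B.
  move=> /(_ 0) H; apply: le_trans (normr_ge0 _) (H _).
  by split=> [i|]; [rewrite mxE|rewrite big1// => i _; rewrite mxE].
exists (1 + #|{ffun 'I_n -> 'I_k.+1}|%:R) => [|g B gB]; first by rewrite ltr_wpDr.
apply: (@le_trans _ _ (#|{ffun 'I_n -> 'I_k.+1}|%:R * B)); last first.
  by rewrite ler_wpM2r ?lerDr//; exact: B0 gB.
rewrite mulr_natl -sumr_const /nodal_norm big_mkcond/=; apply: ler_sum => a _.
by case: ifP => [ha|_]; [apply: gB; exact: ref_simplex_node|exact: B0 gB].
Qed.

(** As interpolation reproduces polynomials, the interpolation error of [g] is that of the
    remainder of its Taylor polynomial, which is small.  For the derivatives of the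
    interpolant it suffices to subtract the constant [g 0]. *)
Lemma reference_estimates (L KG : R) : 0 < L -> 0 < KG -> exists2 C : R, 0 < C &
  forall (D : set 'rV[R]_d) (G : seq 'I_d -> 'rV[R]_d -> R)
    (phi psi : 'rV[R]_n -> 'rV[R]_d) (H E0 E1 : R),
  local_C21 D L G ->
  (forall s, (size s <= 2)%N -> forall x y, D x -> D y ->
    `|G s x - G s y| <= KG * norm1 (x - y)) ->
  vector_Pk k phi -> vector_Pk k psi -> 0 <= H -> 0 <= E0 -> 0 <= E1 ->
  (forall xi, ref_simplex xi -> D (phi xi)) ->
  (forall xi, ref_simplex xi -> D (psi xi)) ->
  (forall xi, ref_simplex xi -> forall i j, `|vpartial phi i j xi| <= H) ->
  (forall xi, ref_simplex xi -> forall i j, `|vpartial psi i j xi| <= H) ->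
  (forall xi, ref_simplex xi -> forall j, `|(phi xi - psi xi) 0 j| <= E0) ->
  (forall xi, ref_simplex xi -> forall i j,
    `|vpartial phi i j xi - vpartial psi i j xi| <= E1) ->
  let g := fun xi => G [::] (phi xi) - G [::] (psi xi) in
  forall xi, ref_simplex xi ->
  [/\ `|g xi - interpolant k g xi| <= C * (H * (E1 + H * E0)),
      forall i, `|partial i (fun eta => g eta - interpolant k g eta) xi|
                <= C * (H * (E1 + H * E0)),
      `|interpolant k g xi| <= C * E0 &
      forall i, `|partial i (interpolant k g) xi| <= C * (E1 + H * E0)].
Proof.
move=> L0 KG0.
have [C1 C10 HC1] := @nodal_norm_bound R n k.
have [C2 C20 HC2] := nodal_norm_le_sup.
pose r : R := remainder_const n d L KG.
have r0 : 0 <= r.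
  by rewrite addr_ge0// !mulr_ge0 ?addr_ge0 ?mulr_ge0// ltW.
have nR : 0 <= n%:R :> R by [].
have dR : 0 <= d%:R :> R by [].
pose A1 := r + n%:R * r + C1 * (C2 * (n%:R * r)).
pose A2 := C1 * (C2 * (KG * d%:R)).
pose B1 : R := d%:R * (L + KG * d%:R).
pose A3 := C1 * (C2 * (n%:R * B1)).
have B10 : 0 <= B1 by rewrite mulr_ge0// addr_ge0 ?mulr_ge0// ltW.
have C1' := ltW C10; have C2' := ltW C20.
have nr0 : 0 <= n%:R * r by rewrite mulr_ge0.
have A10 : 0 <= A1 by apply: addr_ge0; [exact: addr_ge0|do 2 apply: mulr_ge0 => //].
have A20 : 0 <= A2 by do 2 apply: mulr_ge0 => //; rewrite mulr_ge0// ltW.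
have A30 : 0 <= A3 by do 2 apply: mulr_ge0 => //; rewrite mulr_ge0.
exists (1 + A1 + A2 + A3) => [|D G phi psi H E0 E1 HG HL hphi hpsi H0 E00 E10 phiD psiD
  phiH psiH eE0 eE1 g xi hxi]; first by rewrite !ltr_wpDr.
have HE : 0 <= H * (E1 + H * E0) by rewrite mulr_ge0// addr_ge0// mulr_ge0.
have HE' : 0 <= E1 + H * E0 by rewrite addr_ge0// mulr_ge0.
set dg := fun i eta => \sum_j (vpartial phi i j eta * G [:: j] (phi eta) -
                            vpartial psi i j eta * G [:: j] (psi eta)).
have Dg eta v : ref_simplex eta -> is_derive eta v g (\sum_i v 0 i * dg i eta).
  by move=> heta; exact: (is_derive_difference HG hphi hpsi phiD psiD (s := [::])).
have dgB i eta : ref_simplex eta -> `|dg i eta| <= B1 * (E1 + H * E0).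
  move=> heta.
  apply: le_trans (ddifference_bound HG HL KG0 phiD psiD psiH eE0 eE1 (s := [::]) i isT heta) _.
  rewrite /B1 -[leRHS]mulrA ler_wpM2l//.
  have -> : H * (KG * (d%:R * E0)) = (KG * d%:R) * (H * E0) by ring.
  have := mulr_ge0 (ltW L0) (mulr_ge0 H0 E00).
  have := mulr_ge0 (mulr_ge0 (ltW KG0) dR) E10.
  rewrite mulrDl !mulrDr [E1 * L]mulrC.
  move: (L * E1) (L * (H * E0)) (KG * d%:R * E1) (KG * d%:R * (H * E0)) => a b c e; lra.
have h00 : ref_simplex (0 : 'rV[R]_n).
  by split=> [i|]; [rewrite mxE|rewrite big1// => i _; rewrite mxE].
pose q := taylor_part G phi psi 0; pose w := remainder G phi psi 0.
pose dw := dremainder G phi psi 0.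
have Pq : in_Pk k q by exact: (in_Pk_taylor_part _ hphi hpsi).
have Dw eta v : ref_simplex eta -> is_derive eta v w (\sum_i v 0 i * dw i eta).
  by move=> heta; exact: (is_derive_remainder HG hphi hpsi phiD psiD).
have dwB i eta : ref_simplex eta -> `|dw i eta| <= r * (H * (E1 + H * E0)).
  by move=> heta; exact: (dremainder_bound HG HL L0 KG0 hphi hpsi H0 E00 E10 phiD psiD phiH psiH eE0 eE1 h00).
have wB eta : ref_simplex eta -> `|w eta| <= n%:R * (r * (H * (E1 + H * E0))).
  by move=> heta; exact: (remainder_bound HG HL L0 KG0 hphi hpsi H0 E00 E10 phiD psiD phiH psiH eE0 eE1 h00).
have Nw := HC2 _ _ wB.
have wE eta : w eta = g eta - q eta by [].
have Iw eta : interpolant k g eta = interpolant k w eta + q eta.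
  rewrite -[q eta](congr1 (fun f => f eta) (interpolant_Pk k0 Pq)) /interpolant -big_split/=.
  by apply: eq_bigr => a _; rewrite -mulrDl wE subrK.
have err eta : g eta - interpolant k g eta = w eta - interpolant k w eta.
  by rewrite Iw wE opprD addrCA addrC.
have T1 : C1 * nodal_norm k w <= C1 * (C2 * (n%:R * r)) * (H * (E1 + H * E0)).
  by rewrite -!mulrA ler_wpM2l ?(ltW C10)//.
have le1 (a b : R) : 0 <= b -> a <= 1 + A1 + A2 + A3 -> a * b <= (1 + A1 + A2 + A3) * b.
  by move=> b0 ab; rewrite ler_wpM2r.
split.
- rewrite err; apply: le_trans (ler_normB _ _) _.
  apply: le_trans (lerD (wB _ hxi) (le_trans (HC1 _ _ hxi).1 T1)) _.
  rewrite mulrA -mulrDl; apply: le1 => //; rewrite /A1.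
  by move: (C1 * (C2 * (n%:R * r))) (n%:R * r) => a b; lra.
- move=> i; have -> : partial i (fun eta => g eta - interpolant k g eta) xi =
    dw i xi - partial i (interpolant k w) xi.
    rewrite (_ : (fun eta => _) = (fun eta => w eta - interpolant k w eta)); last first.
      by apply/funext => eta; exact: err.
    apply: derive_val; apply: is_deriveB; last first.
      by apply: derivableP; have [] := is_derive_Pk (in_Pk_interpolant k w) xi (basis_vec R i).
    have := Dw xi (basis_vec R i) hxi; congr is_derive.
    exact: (sum_basis_vec i (dw^~ xi)).
  apply: le_trans (ler_normB _ _) _.
  apply: le_trans (lerD (dwB i _ hxi) (le_trans ((HC1 w _ hxi).2 i) T1)) _.
  rewrite -mulrDl; apply: le1 => //; rewrite /A1.
  have : 0 <= n%:R * r by rewrite mulr_ge0.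
  by move: (C1 * (C2 * (n%:R * r))) (n%:R * r) => a b; lra.
- have gB eta : ref_simplex eta -> `|g eta| <= KG * (d%:R * E0).
    by move=> heta; exact: (difference_bound HL KG0 phiD psiD eE0 (s := [::])).
  apply: le_trans (HC1 g _ hxi).1 _.
  apply: (@le_trans _ _ (A2 * E0)); last by apply: le1 => //; lra.
  by rewrite /A2 -!mulrA ler_wpM2l ?(ltW C10)//; apply: HC2.
- move=> i; pose g0 eta := g eta - g 0.
  have g0B eta : ref_simplex eta -> `|g0 eta| <= n%:R * (B1 * (E1 + H * E0)).
    move=> heta; apply: (ref_simplex_mvt (du := dg)) => //; first exact: mulr_ge0.
    - by move=> z hz v; exact: Dg.
    - by move=> z hz j; exact: dgB.
  have E : interpolant k g = fun eta => interpolant k g0 eta + g 0.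
    apply/funext => eta.
    have -> : g 0 = interpolant k (fun=> g 0) eta.
      by rewrite (interpolant_Pk k0 (in_Pk_cst n k (g 0))).
    by rewrite /interpolant -big_split/=; apply: eq_bigr => a _; rewrite /g0; ring.
  have -> : partial i (interpolant k g) xi = partial i (interpolant k g0) xi.
    rewrite E; apply: derive_val; rewrite -[X in is_derive _ _ _ X]addr0.
    have D0 : is_derive xi (basis_vec R i) (interpolant k g0) (partial i (interpolant k g0) xi).
      by apply: derivableP; have [] := is_derive_Pk (in_Pk_interpolant k g0) xi (basis_vec R i).
    exact: (is_deriveD D0 (is_derive_cst (g 0) xi (basis_vec R i))).
  apply: le_trans ((HC1 g0 _ hxi).2 i) _.
  apply: (@le_trans _ _ (A3 * (E1 + H * E0))); last by apply: le1 => //; lra.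
  rewrite (_ : A3 * _ = C1 * (C2 * (n%:R * (B1 * (E1 + H * E0))))); last by rewrite /A3 !mulrA.
  by rewrite ler_wpM2l//; apply: HC2.
Qed.

End reference_theorem.
(** * Geometry of the discrete interface *)

Section projection.
Variables (R : realType) (d : nat).

Lemma distance_projection_fixed m (Gamma N : set 'rV[R]_d) a v :
  distance_projection m Gamma N a -> Gamma v -> a v = v.
Proof.
move=> [_ GN H _] Gv; apply/eqP; apply/negPn/negP => /eqP av.
have [_ /(_ _ Gv)] := H _ (GN _ Gv).
move=> /(_ (fun e => av (esym e))); rewrite subrr ltNge.
have -> : enorm (0 : 'rV[R]_d) = 0.
  rewrite /enorm big1 ?sqrtr0// => i _; by rewrite mxE expr0n.
by rewrite enorm_ge0.
Qed.

Definition taylor_at (u : 'rV[R]_d -> R) (M : R) (x : 'rV[R]_d) : Prop :=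
  forall y : 'rV[R]_d, (forall i, `|y 0 i - x 0 i| <= M^-1) ->
    `|u y - u x - \sum_i (y - x) 0 i * pderiv [:: i] u x| <= M * norm1 (y - x) ^+ 2.

Lemma C2_taylor_near (N : set 'rV[R]_d) (u : 'rV[R]_d -> R) m x0 : open N -> (2 <= m)%N ->
  C_class m N u -> N x0 -> \forall x \near x0 & M \near (+oo%R : set_system R),
    taylor_at u M x.
Proof.
move=> oN m2 Cu Nx0.
have [B HB] : exists B : R, \forall z \near x0, forall i l, `|pderiv [:: l; i] u z| <= B.
  pose B0 (p : 'I_d * 'I_d) := `|pderiv [:: p.2; p.1] u x0|.
  exists (1 + \sum_p B0 p).
  suff : \forall z \near x0, forall p : 'I_d * 'I_d,
      `|pderiv [:: p.2; p.1] u z| <= 1 + \sum_p B0 p.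
    by apply: filterS => z Hz i l; exact: (Hz (i, l)).
  apply: (@filter_forall _ ('I_d * 'I_d)%type
    (fun p (z : 'rV[R]_d) => `|pderiv [:: p.2; p.1] u z| <= 1 + \sum_p B0 p) (nbhs x0)) => -[i l].
  have [/(_ _ Nx0) cu _] := Cu [:: l; i] m2.
  have /cvgrPdist_le/(_ _ ltr01) := cu; apply: filterS => z Hz.
  change (`|pderiv [:: l; i] u z| <= 1 + \sum_p B0 p).
  have -> : pderiv [:: l; i] u z = pderiv [:: l; i] u x0 - (pderiv [:: l; i] u x0 - pderiv [:: l; i] u z).
    by rewrite opprB addrC subrK.
  apply: le_trans (ler_normB _ _) _; rewrite addrC; apply: lerD => //.
  rewrite (bigD1 (i, l))//=; apply: ler_wpDr; last exact: lexx.
  by apply: sumr_ge0 => p _; exact: normr_ge0.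
have {HB} : \forall z \near x0, N z /\ forall i l, `|pderiv [:: l; i] u z| <= B.
  by near=> z; split; near: z; [exact: oN|exact: HB].
move=> /nbhs_ballP[r /= r0 Hr].
near=> x M => y yx.
have M1 : 4 / r < M by near: M; apply: nbhs_pinfty_gt; exact: num_real.
have M0 : 0 < M by apply: lt_trans M1; rewrite divr_gt0.
have MB : `|B| <= M by near: M; apply: nbhs_pinfty_ge; exact: num_real.
have Mr : M^-1 < r / 4 by rewrite -[r / 4]invrK ltf_pV2 ?posrE ?invr_gt0 ?divr_gt0// invf_div.
have xx0 : ball x0 (r / 4) x by near: x; apply: nbhsx_ballx; rewrite divr_gt0.
have inB z : inbox x y z -> ball x0 r z.
  move=> Hz; apply/ball_rowP => // i.
  have r4 : 0 < r / 4 by rewrite divr_gt0.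
  have h1 := (ball_rowP _ _ r4).1 xx0 i.
  have [t /andP[t0 t1] zi] := Hz i.
  have -> : x0 0 i - z 0 i = (x0 0 i - x 0 i) - t * (y 0 i - x 0 i) by rewrite zi; ring.
  apply: le_lt_trans (ler_normB _ _) _; rewrite normrM (ger0_norm t0).
  have : t * `|y 0 i - x 0 i| <= M^-1.
    by apply: le_trans (yx i); rewrite ler_piMl.
  by move: Mr h1; move: (M^-1) => a; lra.
rewrite expr2 mulrA.
apply: (@box_taylor _ _ _ (fun i => pderiv [:: i] u)) => z zxy i; split.
  have [Nz _] := Hr _ (inB _ zxy).
  have [_ /(_ (ltnW m2) i z Nz) D] := Cu [::] (leq0n m).
  exact: derivableP.
apply: (@le_trans _ _ (M * norm1 (z - x))); last first.
  by rewrite ler_wpM2l ?(ltW M0)//; exact: inbox_norm1.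
apply: (@box_mvt _ _ _ (fun l => pderiv [:: l; i] u)) => w wxz l.
have [Nw Bw] : N w /\ forall i l, `|pderiv [:: l; i] u w| <= B.
  apply/Hr/inB => j; have [t /andP[t0 t1] ->] := wxz j; have [s /andP[s0 s1] ->] := zxy j.
  exists (t * s); last by ring.
  by rewrite mulr_ge0//= mulr_ile1.
split; last exact: le_trans (Bw i l) (le_trans (ler_norm B) MB).
have [_ /(_ m2 l w Nw) D] := Cu [:: i] (ltnW m2).
exact: derivableP.
Unshelve. all: by end_near. Qed.

(** Compactness makes the local Taylor estimates uniform along the interface. *)
Lemma projection_taylor m (Gamma N : set 'rV[R]_d) a : compact Gamma -> (2 <= m)%N ->
  distance_projection m Gamma N a -> exists2 M : R, 0 < M & forall x, Gamma x ->
    forall y : 'rV[R]_d, (forall i, `|y 0 i - x 0 i| <= M^-1) -> forall j,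
    `|a y 0 j - a x 0 j - \sum_i (y - x) 0 i * pderiv [:: i] (fun z => a z 0 j) x|
    <= M * norm1 (y - x) ^+ 2.
Proof.
move=> cG m2 [oN GN _ Ca].
have /compact_near_coveringP/(_ R (pinfty_nbhs R)
  (fun M x => forall j, taylor_at (fun z => a z 0 j) M x) _)H := cG.
have {}H : \forall M \near (+oo%R : set_system R),
    Gamma `<=` (fun x => forall j, taylor_at (fun z => a z 0 j) M x).
  apply: H => x Gx.
  have K : \forall p \near filter_prod (nbhs x) (+oo%R : set_system R),
      forall j, taylor_at (fun z => a z 0 j) p.2 p.1.
    apply: filter_forall => j.
    exact: (C2_taylor_near oN m2 (Ca j) (GN _ Gx)).
  exact: K.
near (pinfty_nbhs R) => M.
exists M; first by near: M; apply: nbhs_pinfty_gt; exact: num_real.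
move=> x Gx y yx j.
have HM : Gamma `<=` (fun x => forall j, taylor_at (fun z => a z 0 j) M x) by near: M.
exact: HM.
Unshelve. all: by end_near. Qed.

End projection.

Section simplices.
Variables (R : realType) (d : nat) (T : mesh R d).
Implicit Types (S : {set 'I_(nvert T)}) (W : 'I_(nvert T) -> R).

(** Differences of points of the ball span the space and are combinations of the [d] edge
    vectors at a vertex, which are therefore independent. *)
Lemma affine_independence S c (rho : R) : #|S| = d.+1 -> 0 < rho ->
  (forall x, enorm (x - c) <= rho -> hull S x) ->
  forall W, \sum_(i in S) W i = 0 -> \sum_(i in S) W i *: vert i = 0 ->
  forall i, i \in S -> W i = 0.
Proof.
move=> cS rho0 Hc W sW sWv i iS.
pose A := S :\ i.
have cA : #|A| = d by have := cardsD1 i S; rewrite iS cS => -[].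
pose E : 'M[R]_(#|A|, d) := \matrix_(l, j) (vert (enum_val l) - vert i) 0 j.
have sumE U : \sum_(j in S) U j = 0 ->
    \sum_(j in S) U j *: vert j = (\row_l U (enum_val l)) *m E.
  move=> sU; have Ui : U i = - \sum_(j in A) U j.
    by apply/eqP; rewrite -addr_eq0 -(big_setD1 i iS)/= sU.
  rewrite (big_setD1 i iS)/= Ui scaleNr scaler_suml addrC -sumrB.
  apply/rowP => j; rewrite !mxE summxE big_enum_val/=.
  by apply: eq_bigr => l _; rewrite !mxE mulrBr.
have /choice[U HU] : forall j : 'I_d, exists U : 'I_(nvert T) -> R,
    \sum_(i in S) U i = 0 /\ \sum_(i in S) U i *: vert i = (2 * rho) *: delta_mx 0 j.
  move=> j; have e1 : enorm (delta_mx 0 j : 'rV[R]_d) = 1.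
    rewrite /enorm (bigD1 j)//= big1 => [|l /negbTE lj]; rewrite !mxE ?eqxx ?lj.
      by rewrite expr1n addr0 sqrtr1.
    by rewrite andbF expr0n.
  have eZ (b : R) : `|b| <= rho -> enorm (c + b *: delta_mx 0 j - c) <= rho.
    rewrite addrC addKr => hb; rewrite /enorm.
    under eq_bigr do rewrite mxE exprMn.
    rewrite -mulr_sumr sqrtrM ?sqr_ge0// sqrtr_sqr.
    by rewrite -[X in _ * X]/(enorm (delta_mx 0 j)) e1 mulr1.
  have [|w1 [_ s1 v1]] := Hc (c + rho *: delta_mx 0 j).
    by apply: eZ; rewrite gtr0_norm.
  have [|w2 [_ s2 v2]] := Hc (c + (- rho) *: delta_mx 0 j).
    by apply: eZ; rewrite normrN gtr0_norm.
  exists (fun i => w1 i - w2 i); split; first by rewrite sumrB s1 s2 subrr.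
  under eq_bigr do rewrite scalerBl.
  rewrite sumrB -v1 -v2 scaleNr opprD opprK addrACA subrr add0r.
  by rewrite -scalerDl; congr (_ *: _); ring.
pose B : 'M[R]_(d, #|A|) := \matrix_(j, l) U j (enum_val l).
have BE : B *m E = (2 * rho)%:M.
  apply/row_matrixP => j; rewrite row_mul.
  have -> : row j B = \row_l U j (enum_val l) by apply/rowP => l; rewrite !mxE.
  rewrite -sumE; last exact: (HU j).1.
  rewrite (HU j).2; apply/rowP => l; rewrite !mxE eqxx /= [l == j]eq_sym.
  by rewrite mulr_natr.
have rE : row_free E.
  apply/eqP/anti_leq; rewrite rank_leq_row/=; apply: leq_trans (eq_leq cA) _.
  apply: leq_trans (mxrankM_maxr B E); rewrite BE.
  by rewrite mxrank_unit// unitmxE det_scalar unitfE expf_neq0// mulf_neq0// gt_eqF.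
have W0 : \row_l W (enum_val l) = 0 :> 'rV_#|A|.
  by apply/eqP; rewrite -(mulmx_free_eq0 _ rE) -sumE// sWv.
have WA l : l \in A -> W l = 0.
  by move=> lA; have /rowP/(_ (enum_rank_in lA l)) := W0; rewrite !mxE enum_rankK_in.
by move: sW; rewrite (big_setD1 i iS)/= big1 ?addr0.
Qed.

Lemma enormZ (b : R) (x : 'rV[R]_d) : enorm (b *: x) = `|b| * enorm x.
Proof.
rewrite /enorm; under eq_bigr do rewrite mxE exprMn.
by rewrite -mulr_sumr sqrtrM ?sqr_ge0// sqrtr_sqr.
Qed.

Lemma enorm_eq0 (x : 'rV[R]_d) : enorm x = 0 -> x = 0.
Proof.
move=> x0; apply/rowP => i; apply/eqP; rewrite mxE -normr_le0 -x0.
exact: coord_le_enorm.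
Qed.

(** The coefficients of an affine combination of weight zero are its variation of
    barycentric coordinates; across a ball of radius [rho] these vary by at most 1. *)
Lemma barycentric_bound S c (rho : R) : #|S| = d.+1 -> 0 < rho ->
  (forall x, enorm (x - c) <= rho -> hull S x) ->
  forall W, \sum_(i in S) W i = 0 -> forall i, i \in S ->
  rho * `|W i| <= enorm (\sum_(i in S) W i *: vert i).
Proof.
move=> cS rho0 Hc W sW i iS.
set x := \sum_(i in S) _.
have [x0|xn0] := eqVneq (enorm x) 0.
  by rewrite (affine_independence cS rho0 Hc sW (enorm_eq0 x0) iS) normr0 mulr0 enorm_ge0.
have xp : 0 < enorm x by rewrite lt_neqAle eq_sym xn0 enorm_ge0.
pose t := rho / enorm x.
have t0 : 0 < t by rewrite divr_gt0.
have et (b : R) : `|b| = t -> enorm (c + b *: x - c) <= rho.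
  by move=> bt; rewrite addrC addKr enormZ bt /t divfK.
have [|w1 [w10 s1 v1]] := Hc (c + t *: x); first by apply: et; rewrite gtr0_norm.
have [|w2 [w20 s2 v2]] := Hc (c + (- t) *: x); first by apply: et; rewrite normrN gtr0_norm.
have wle1 (w : 'I_(nvert T) -> R) : (forall j, 0 <= w j) -> \sum_(j in S) w j = 1 -> w i <= 1.
  by move=> w0 <-; rewrite (big_setD1 i iS)/= lerDl sumr_ge0.
have U0 : w1 i - w2 i - 2 * t * W i = 0.
  apply: (affine_independence cS rho0 Hc (W := fun i => w1 i - w2 i - 2 * t * W i)) iS.
    by rewrite !sumrB s1 s2 -mulr_sumr sW mulr0 subrr subr0.
  under eq_bigr do rewrite !scalerBl -scalerA.
  rewrite !sumrB -v1 -v2 -scaler_sumr -/x scaleNr opprD opprK addrACA subrr add0r.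
  by rewrite -scalerDl -scalerBl (_ : _ - _ = 0) ?scale0r//; ring.
have : `|2 * t * W i| <= 1.
  have -> : 2 * t * W i = w1 i - w2 i by apply/eqP; rewrite eq_sym -subr_eq0 U0.
  have := wle1 _ w10 s1; have := wle1 _ w20 s2; have := w10 i; have := w20 i.
  by rewrite ler_norml; move: (w1 i) (w2 i) => p q; lra.
rewrite normrM (gtr0_norm (mulr_gt0 _ t0))// /t => H.
have : 2 * (rho * `|W i|) <= enorm x.
  by rewrite -[leRHS]mul1r -ler_pdivrMr// mulrA; apply: le_trans H; rewrite le_eqVlt;
    apply/orP; left; apply/eqP; ring.
by have := normr_ge0 (W i); move/(mulr_ge0 (ltW rho0)); lra.
Qed.

End simplices.
Section facets.
Variables (R : realType) (n : nat) (T : mesh R n.+1).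
Implicit Types (S : {set 'I_(nvert T)}) (xi : 'rV[R]_n).

Definition edge S (l : 'I_n) : 'rV[R]_n.+1 := vertex_of S l.+1 - vertex_of S 0.

Lemma flat_map_coord S xi j : flat_map S xi 0 j =
  vertex_of S 0 0 j + \sum_l xi 0 l * edge S l 0 j.
Proof.
rewrite /flat_map !mxE summxE.
have -> : \sum_(l < n) (xi 0 l *: vertex_of S l.+1) 0 j = \sum_l xi 0 l * vertex_of S l.+1 0 j.
  by apply: eq_bigr => l _; rewrite mxE.
under [in RHS]eq_bigr do rewrite /edge !mxE mulrBr.
by rewrite sumrB -mulr_suml; ring.
Qed.

Lemma vertex_ofP S : #|S| = n.+1 -> exists I : nat -> 'I_(nvert T),
  [/\ forall j, (j < n.+1)%N -> vertex_of S j = vert (I j),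
      forall j, (j < n.+1)%N -> I j \in S &
      forall i j, (i < n.+1)%N -> (j < n.+1)%N -> I i = I j -> i = j].
Proof.
move=> cS; have sS : size (enum S) = n.+1 by rewrite -cardE.
have [i0 _] : exists i0, i0 \in S by apply/card_gt0P; rewrite cS.
exists (fun j => nth i0 (enum S) j); split => [j jn|j jn|i j iN jn /eqP].
- by rewrite /vertex_of (nth_map i0) ?sS.
- by rewrite -mem_enum mem_nth ?sS.
- by rewrite nth_uniq ?enum_uniq ?sS// => /eqP.
Qed.

Lemma facet_edges_bound S S' c (rho : R) (w : 'rV[R]_n) : #|S| = n.+1 -> #|S'| = n.+2 ->
  S \subset S' -> 0 < rho -> (forall x, enorm (x - c) <= rho -> hull S' x) ->
  forall l, rho * `|w 0 l| <= enorm (\sum_l w 0 l *: edge S l).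
Proof.
move=> cS cS' SS' rho0 Hc l.
have [I [vI IS Iinj]] := vertex_ofP cS.
pose W i : R := \sum_l w 0 l * ((i == I l.+1)%:R - (i == I 0)%:R).
have pick j (F : 'I_(nvert T) -> 'rV[R]_n.+1) : (j < n.+1)%N ->
    \sum_(i in S') (i == I j)%:R *: F i = F (I j).
  move=> jn; have IjS' : I j \in S' by move/fintype.subsetP: SS'; apply; exact: IS.
  rewrite (bigD1 _ IjS')/= eqxx scale1r big1 ?addr0// => i /andP[_ /negbTE ->].
  by rewrite scale0r.
have pickR j : (j < n.+1)%N -> \sum_(i in S') (i == I j)%:R = 1 :> R.
  move=> jn; have IjS' : I j \in S' by move/fintype.subsetP: SS'; apply; exact: IS.
  by rewrite (bigD1 _ IjS')/= eqxx big1 ?addr0// => i /andP[_ /negbTE ->].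
have sW : \sum_(i in S') W i = 0.
  rewrite /W exchange_big/= big1// => j _; rewrite -mulr_sumr sumrB.
  by rewrite !pickR// ?ltnS ?ltn_ord// subrr mulr0.
have sWv : \sum_(i in S') W i *: vert i = \sum_l w 0 l *: edge S l.
  under eq_bigr do rewrite /W scaler_suml.
  rewrite exchange_big/=; apply: eq_bigr => j _.
  under eq_bigr do rewrite -scalerA scalerBl.
  rewrite -scaler_sumr sumrB !pick// ?ltnS ?ltn_ord//.
  by rewrite /edge !vI// ltnS.
have IlS' : I l.+1 \in S' by move/fintype.subsetP: SS'; apply; apply: IS; rewrite ltnS.
have := barycentric_bound cS' rho0 Hc sW IlS'.
rewrite sWv; have -> // : W (I l.+1) = w 0 l.
rewrite /W (bigD1 l)//= big1 => [|j jl]; last first.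
  have -> : (I l.+1 == I j.+1) = false.
    apply/negP => /eqP/Iinj; rewrite !ltnS !ltn_ord => /(_ isT isT)[] /val_inj lj.
    by rewrite lj eqxx in jl.
  have -> : (I l.+1 == I 0) = false.
    by apply/negP => /eqP/Iinj; rewrite !ltnS ltn_ord => /(_ isT isT).
  by rewrite subrr mulr0.
have -> : (I l.+1 == I 0) = false.
  by apply/negP => /eqP/Iinj; rewrite !ltnS ltn_ord => /(_ isT isT).
by rewrite eqxx subr0 mulr1 addr0.
Qed.

Lemma diam_ge S i j : i \in S -> j \in S -> enorm (vert i - vert j) <= diam S.
Proof.
move=> iS jS; rewrite /diam.
apply: (le_trans (le_bigmax_cond _ (fun j => enorm (vert i - vert j)) jS)).
by apply: (le_bigmax_cond _ (fun i => \big[Num.max/0]_(j in S) enorm (vert i - vert j)) iS).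
Qed.

Lemma diam_le_mesh_size S : S \in cells T -> diam S <= mesh_size T.
Proof. by move=> ST; apply: (le_bigmax_cond _ (@diam _ _ T) ST). Qed.

Lemma facet_edges_le S S' l : #|S| = n.+1 -> S' \in cells T -> S \subset S' ->
  enorm (edge S l) <= mesh_size T.
Proof.
move=> cS S'T SS'; have [I [vI IS _]] := vertex_ofP cS.
rewrite /edge !vI ?ltnS//; apply: le_trans (diam_le_mesh_size S'T).
by apply: diam_ge; move/fintype.subsetP: SS'; apply; apply: IS; rewrite ltnS.
Qed.

End facets.

Section curved_geometry.
Variables (R : realType) (n k m : nat).
Hypothesis n0 : (0 < n)%N.
Hypothesis k0 : (0 < k)%N.

(** What the estimates need from the mesh: the element maps are polynomials whose
    differential is comparable, from above and from below, to the mesh size. *)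
Definition regular_elements (T : mesh R n.+1)
    (F : {set 'I_(nvert T)} -> 'rV[R]_n -> 'rV[R]_n.+1) (c C : R) : Prop :=
  forall S, S \in facets T -> vector_Pk k (F S) /\ forall xi, ref_simplex xi ->
    (forall l j, `|vpartial (F S) l j xi| <= C * mesh_size T) /\
    forall w : 'rV[R]_n, forall l, c * mesh_size T * `|w 0 l| <= enorm (w *m jac (F S) xi).

(** The interpolated projection differs from the flat facet by the interpolant of
    [a - id], which is of second order in the mesh size: the first-order Taylor polynomial
    of [a] at a vertex is affine and nearly fixes all vertices. *)
Lemma curved_elements_regular (Gamma Omega N : set 'rV[R]_n.+1) a (sigma tau C0 : R) :
  compact Gamma -> (2 <= m)%N -> distance_projection m Gamma N a ->
  exists h0 c C : R, [/\ 0 < h0, 0 < c, 0 < C & forall T : mesh R n.+1,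
    admissible T k a Gamma Omega N sigma tau C0 -> mesh_size T <= h0 ->
    0 < mesh_size T /\ regular_elements (curved_map T k a) c C].
Proof.
move=> cG m2 aG.
have [M M0 HM] := projection_taylor cG m2 aG.
have [C1 C10 HC1] := @nodal_norm_bound R n k.
have [C2 C20 HC2] := @nodal_norm_le_sup R n k k0.
pose b : R := n.+1%:R; have b0 : 0 < b by rewrite ltr0n.
pose Q := C1 * (C2 * (2 * (M * b ^+ 2))).
have Q0 : 0 < Q by rewrite !mulr_gt0// exprn_gt0.
pose s := `|tau| * `|sigma| + 1.
have s0 : 0 < s by rewrite ltr_wpDl// mulr_ge0.
(* the first bound keeps an element within reach of the Taylor estimate, the last one makes the
   perturbation of the differential, of size [Q * h ^+ 2], at most half of the lower bound that
   the inscribed ball provides for the flat facet *)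
pose h0 := Num.min M^-1 (Num.min 1 (2 * s * (b * n%:R * Q + 1))^-1).
have bnQ : 0 <= b * n%:R * Q by rewrite !mulr_ge0// ltW.
have bnQ1 : 0 < 2 * s * (b * n%:R * Q + 1) by rewrite !mulr_gt0// ltr_wpDl.
exists h0, (2 * s * b)^-1, (1 + Q); split.
- by rewrite !lt_min !invr_gt0 M0 ltr01.
- by rewrite invr_gt0 !mulr_gt0.
- by rewrite addr_gt0.
move=> T [[cT _ _] [sT qT] [fT0 fT vG _ _] _ _] hh0.
set h := mesh_size T in hh0 *.
have hM : h <= M^-1 by apply: le_trans hh0 _; rewrite ge_min lexx.
have h1 : h <= 1 by apply: le_trans hh0 _; rewrite !ge_min lexx orbT.
have hs : h <= (2 * s * (b * n%:R * Q + 1))^-1.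
  by apply: le_trans hh0 _; rewrite !ge_min lexx !orbT.
have Hfacet S : S \in facets T -> exists S' c rho, [/\ #|S| = n.+1,
    S' \in cells T, S \subset S', 0 < rho /\ h <= s * rho &
    forall x, enorm (x - c) <= rho -> hull S' x].
  move=> ST; have [cS [S' S'T SS']] := fT _ ST.
  have [c [rho [rho0 Hc dS]]] := sT _ S'T.
  exists S', c, rho; split=> //; split=> //.
  have d0 : 0 <= diam S' by rewrite /diam; apply: bigmax_ge_id.
  apply: le_trans (qT _ S'T) _.
  apply: (@le_trans _ _ (`|tau| * (`|sigma| * rho))).
    apply: (@le_trans _ _ (`|tau| * diam S')); first by rewrite ler_wpM2r// ler_norm.
    by rewrite ler_wpM2l// (le_trans dS)// ler_wpM2r ?ler_norm// ltW.
  by rewrite mulrA ler_wpM2r ?(ltW rho0)// /s lerDl.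
have hpos : 0 < h.
  have /set0Pn[S ST] := fT0.
  have [S' [c [rho [cS S'T SS' [rho0 _] Hc]]]] := Hfacet _ ST.
  pose l : 'I_n := Ordinal n0.
  have := facet_edges_bound (delta_mx 0 l) cS (cT _ S'T) SS' rho0 Hc l.
  rewrite mxE !eqxx normr1 mulr1 (bigD1 l)//= big1 ?addr0; last first.
    by move=> j /negbTE jl; rewrite mxE jl andbF scale0r.
  rewrite mxE !eqxx scale1r => /lt_le_trans -/(_ _ rho0) Hl.
  exact: lt_le_trans Hl (facet_edges_le _ cS S'T SS').
split=> // S ST.
have [S' [c [rho [cS S'T SS' [rho0 hrho] Hc]]]] := Hfacet _ ST.
have [I [vI IS _]] := vertex_ofP cS.
pose v0 := vertex_of S 0.
have Gv j : (j < n.+1)%N -> Gamma (vertex_of S j).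
  by move=> jn; rewrite vI//; apply: vG ST (IS _ jn).
have av j : (j < n.+1)%N -> a (vertex_of S j) = vertex_of S j.
  by move=> jn; apply: (distance_projection_fixed aG); exact: Gv.
have edge_h l j : `|edge S l 0 j| <= h.
  by apply: le_trans (coord_le_enorm _ _) _; exact: facet_edges_le SS'.
pose A := flat_map S.
pose Da j i := pderiv [:: i] (fun z => a z 0 j) v0.
have A_v0 xi : A xi - v0 = \sum_l xi 0 l *: edge S l.
  apply/rowP => j; rewrite mxE [A xi 0 j]flat_map_coord [X in _ + X]mxE addrC addKr summxE.
  by apply: eq_bigr => l _; rewrite [RHS]mxE.
have A_h xi j : ref_simplex xi -> `|(A xi - v0) 0 j| <= h.
  move=> [xi0 xi1]; rewrite A_v0 summxE; apply: le_trans (ler_norm_sum _ _ _) _.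
  apply: (@le_trans _ _ (\sum_l xi 0 l * h)).
    by apply: ler_sum => l _; rewrite mxE normrM (ger0_norm (xi0 l)) ler_wpM2l.
  by rewrite -mulr_suml ler_piMl// ltW.
have tay y j : (forall i, `|(y - v0) 0 i| <= h) ->
    `|a y 0 j - v0 0 j - \sum_i (y - v0) 0 i * Da j i| <= M * b ^+ 2 * h ^+ 2.
  move=> yv; have yv' i : `|y 0 i - v0 0 i| <= M^-1.
    by have := le_trans (yv i) hM; rewrite !mxE.
  have := HM v0 (Gv _ (ltn0Sn n)) y yv' j; rewrite (av 0%N)// -/v0 => /le_trans; apply.
  rewrite -mulrA ler_wpM2l ?(ltW M0)// -exprMn lerXn2r ?nnegrE ?norm1_ge0//.
    by rewrite mulr_ge0 ?ltW.
  by apply: ler_sum_ord_const => i; exact: yv.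
have aA xi : ref_simplex xi -> forall j,
    `|a (A xi) 0 j - A xi 0 j| <= 2 * (M * b ^+ 2) * h ^+ 2.
  move=> hxi j; have [xi0 xi1] := hxi.
  have T1 := tay (A xi) j (fun i => A_h xi i hxi).
  have T2 l : `|edge S l 0 j - \sum_i edge S l 0 i * Da j i| <= M * b ^+ 2 * h ^+ 2.
    have := tay (vertex_of S l.+1) j; rewrite av ?ltnS// => H.
    have := H _; rewrite -/(edge S l) => {}H.
    have -> : edge S l 0 j = vertex_of S l.+1 0 j - v0 0 j by rewrite !mxE.
    by apply: H => i; exact: edge_h.
  have -> : a (A xi) 0 j - A xi 0 j =
     (a (A xi) 0 j - v0 0 j - \sum_i (A xi - v0) 0 i * Da j i) -
     \sum_l xi 0 l * (edge S l 0 j - \sum_i edge S l 0 i * Da j i).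
    have -> : A xi 0 j = v0 0 j + \sum_l xi 0 l * edge S l 0 j by exact: flat_map_coord.
    under [X in _ = _ - X]eq_bigr do rewrite mulrBr.
    rewrite sumrB.
    have -> : \sum_l xi 0 l * (\sum_i edge S l 0 i * Da j i) =
        \sum_i (A xi - v0) 0 i * Da j i.
      under eq_bigr do rewrite mulr_sumr.
      rewrite exchange_big/=; apply: eq_bigr => i _; rewrite A_v0 summxE mulr_suml.
      apply: eq_bigr => l _; rewrite mulrA; congr (_ * _).
      by symmetry; exact: mxE.
    by ring.
  apply: le_trans (ler_normB _ _) _.
  have -> : 2 * (M * b ^+ 2) * h ^+ 2 = M * b ^+ 2 * h ^+ 2 + M * b ^+ 2 * h ^+ 2 by ring.
  apply: lerD => //; apply: le_trans (ler_norm_sum _ _ _) _.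
  apply: (@le_trans _ _ (\sum_l xi 0 l * (M * b ^+ 2 * h ^+ 2))).
    by apply: ler_sum => l _; rewrite normrM (ger0_norm (xi0 l)) ler_wpM2l.
  rewrite -mulr_suml ler_piMl// !mulr_ge0 ?exprn_ge0// ltW//.
pose F := curved_map T k a S.
have PA j : in_Pk 1 (fun xi => A xi 0 j).
  under [X in in_Pk _ X]eq_fun do rewrite [A _ _ _]flat_map_coord.
  apply: in_PkD; first exact: in_Pk_cst.
  apply: in_Pk_sum => l _; under [X in in_Pk _ X]eq_fun do rewrite mulrC.
  by apply/in_PkZ/in_Pk_coord.
have PAk j : in_Pk k (fun xi => A xi 0 j) by exact: in_Pk_le (PA j).
have Fj j : (fun xi => F xi 0 j) = interpolant k (fun eta => a (A eta) 0 j).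
  by apply/funext => xi; rewrite /F /curved_map mxE lagrangeE.
pose D j := interpolant k (fun eta => a (A eta) 0 j - A eta 0 j).
have FD j xi : F xi 0 j = A xi 0 j + D j xi.
  have -> : F xi 0 j = interpolant k (fun eta => a (A eta) 0 j) xi by rewrite -Fj.
  rewrite -[A xi 0 j](congr1 (fun f => f xi) (interpolant_Pk k0 (PAk j))) /D /interpolant.
  by rewrite -big_split/=; apply: eq_bigr => i _; ring.
have PF : vector_Pk k F by move=> j; rewrite Fj; exact: in_Pk_interpolant.
split=> // xi hxi.
have DQ l j : `|partial l (D j) xi| <= Q * h ^+ 2.
  apply: le_trans ((HC1 _ _ hxi).2 l) _.
  rewrite /Q -!mulrA ler_wpM2l ?(ltW C10)// (mulrA 2).
  have := HC2 (fun eta => a (A eta) 0 j - A eta 0 j) (2 * (M * b ^+ 2) * h ^+ 2)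
    (fun z hz => aA z hz j).
  by rewrite -!mulrA.
have dF l j : vpartial F l j xi = edge S l 0 j + partial l (D j) xi.
  rewrite /vpartial (_ : (fun eta => F eta 0 j) = (fun eta => A eta 0 j + D j eta)); last first.
    by apply/funext => eta; exact: FD.
  apply: derive_val; apply: is_deriveD; last first.
    apply: derivableP.
    by have [] := is_derive_Pk (in_Pk_interpolant k (fun eta => a (A eta) 0 j - A eta 0 j)) xi (basis_vec R l).
  rewrite (_ : (fun eta => A eta 0 j) = (fun eta => v0 0 j + \sum_l eta 0 l * edge S l 0 j)); last first.
    by apply/funext => eta; exact: flat_map_coord.
  rewrite -[X in is_derive _ _ _ X]add0r.
  suff D2 : is_derive xi (basis_vec R l) (fun eta : 'rV[R]_n => \sum_l eta 0 l * edge S l 0 j)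
      (edge S l 0 j).
    exact: (is_deriveD (is_derive_cst (v0 0 j) xi (basis_vec R l)) D2).
  rewrite -[X in is_derive _ _ _ X](sum_basis_vec l (fun i => edge S i 0 j)).
  exact: is_derive_linear.
split=> [l j|w l].
  rewrite dF; apply: le_trans (ler_normD _ _) _.
  rewrite -/h mulrDl mul1r; apply: lerD => //; apply: le_trans (DQ l j) _.
  by rewrite ler_wpM2l ?(ltW Q0)// expr2 ler_piMl// ltW.
pose l0 := [arg max_(i > l) `|w 0 i|]%O.
have wl0 i : `|w 0 i| <= `|w 0 l0|.
  by rewrite /l0; case: Order.TotalTheory.arg_maxP => // j _; exact.
have Ew j : (w *m jac F xi) 0 j = (\sum_i w 0 i *: edge S i) 0 j + \sum_i w 0 i * partial i (D j) xi.
  rewrite [LHS]mxE summxE -big_split/=; apply: eq_bigr => i _.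
  rewrite [jac _ _ _ _]mxE -[LHS]/(w 0 i * vpartial F i j xi) dF mulrDr; congr (_ + _).
  by symmetry; exact: mxE.
have lower : rho * `|w 0 l0| <= norm1 (w *m jac F xi) + b * n%:R * Q * h ^+ 2 * `|w 0 l0|.
  apply: le_trans (facet_edges_bound w cS (cT _ S'T) SS' rho0 Hc l0) _.
  apply: le_trans (enorm_le_norm1 _) _.
  have -> : b * n%:R * Q * h ^+ 2 * `|w 0 l0| = \sum_(j < n.+1) \sum_(i < n) `|w 0 l0| * (Q * h ^+ 2).
    have sc (r : R) : \sum_(j < n.+1) \sum_(i < n) r = b * (n%:R * r).
      by rewrite /b !mulr_natl !sumr_const !card_ord.
    by rewrite sc [`|w 0 l0| * _]mulrC !mulrA.
  rewrite /norm1 -big_split/=; apply: ler_sum => j _.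
  have -> : (\sum_i w 0 i *: edge S i) 0 j =
     (w *m jac F xi) 0 j - \sum_i w 0 i * partial i (D j) xi by rewrite Ew addrK.
  apply: le_trans (ler_normB _ _) _; rewrite lerD2l.
  apply: le_trans (ler_norm_sum _ _ _) _; apply: ler_sum => i _.
  by rewrite normrM; apply: ler_pM.
rewrite -/h -/F.
apply: (@le_trans _ _ ((2 * s * b)^-1 * h * `|w 0 l0|)).
  by rewrite ler_wpM2l// mulr_ge0 ?(ltW hpos)// invr_ge0 !mulr_ge0 ?(ltW s0) ?(ltW b0).
have N1 := norm1_le_enorm (w *m jac F xi); rewrite -/b in N1.
have main : h / (2 * s) * `|w 0 l0| <= norm1 (w *m jac F xi).
  have e1 : b * n%:R * Q * h <= (2 * s)^-1.
    apply: (@le_trans _ _ ((b * n%:R * Q + 1) * (2 * s * (b * n%:R * Q + 1))^-1)).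
      by apply: ler_pM => //; rewrite ?(ltW hpos)// lerDl.
    by rewrite invfM mulrCA divff ?mulr1// gt_eqF// ltr_wpDl.
  have e2 : h / s <= rho by rewrite ler_pdivrMr// mulrC.
  have e3 : b * n%:R * Q * h ^+ 2 <= h / (2 * s).
    by rewrite expr2 mulrA mulrC ler_wpM2l// ltW.
  have e4 : h / (2 * s) * `|w 0 l0| + h / (2 * s) * `|w 0 l0| <= rho * `|w 0 l0|.
    rewrite -mulrDl ler_wpM2r//; apply: le_trans e2; rewrite invfM.
    have two (x y : R) : x * y + x * y = 2 * x * y by move=> *; ring.
    by rewrite two !mulrA (mulrAC 2) mulfV// mul1r.
  have e5 : b * n%:R * Q * h ^+ 2 * `|w 0 l0| <= h / (2 * s) * `|w 0 l0| by rewrite ler_wpM2r.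
  move: lower e4 e5; move: (h / (2 * s) * _) (rho * _) (norm1 _) (b * n%:R * Q * _ * _) => p q r t.
  lra.
have -> : (2 * s * b)^-1 * h * `|w 0 l0| = h / (2 * s) * `|w 0 l0| / b.
  rewrite invfM [RHS]mulrAC; congr (_ * _); rewrite [LHS]mulrC -!mulrA; congr (_ * _).
rewrite ler_pdivrMr//; apply: (le_trans main); apply: (le_trans N1).
by rewrite [leLHS]mulrC.
Qed.

End curved_geometry.

(** * Lower bounds for polynomials on the reference simplex *)

Section reference_norms.
Variables (R : realType) (n k : nat).
Hypothesis k0 : (0 < k)%N.
Implicit Types (xi y z : 'rV[R]_n).
Local Notation intK := (@ref_simplex R n)°.

Lemma is_derive_affine (q : 'rV[R]_n -> R) (na x v : 'rV[R]_n) (t d : R) :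
  is_derive (na + t *: (x - na)) (t *: v) q d ->
  is_derive x v (fun z => q (na + t *: (z - na))) d.
Proof.
move=> [qd eq_d].
have E : (fun h : R => h^-1 *: (((fun z => q (na + t *: (z - na))) \o shift x) (h *: v) -
            q (na + t *: (x - na)))) =
         (fun h : R => h^-1 *: ((q \o shift (na + t *: (x - na))) (h *: (t *: v)) -
            q (na + t *: (x - na)))).
  apply/funext => h /=; congr (_ *: (q _ - _)).
  rewrite -addrA scalerDr !scalerA [h * t]mulrC addrCA; congr (_ + _).
split; first by rewrite /derivable E.
by rewrite /derive E.
Qed.

(** A quantitative substitute for the equivalence of norms on polynomials, in a form that
    bounds integrals and essential suprema from below by the size of a box. *)
Definition large_on_box (r C : R) : Prop := forall q : 'rV[R]_n -> R, in_Pk k q ->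
  exists y : 'rV[R]_n, forall z : 'rV[R]_n, (forall i, `|z 0 i - y 0 i| <= r) ->
    intK z /\ nodal_norm k q <= C * `|q z|.

(** Scaling the simplex towards the node where a polynomial is largest, by a factor that
    depends on degree and dimension only, the polynomial varies little; a box of fixed size fits into
    the scaled simplex. *)
Lemma Pk_large_on_box : exists r C : R, [/\ 0 < r, 0 < C & large_on_box r C].
Proof.
have [C1 C10 HC1] := @nodal_norm_bound R n k.
have [C2 C20 HC2] := @nodal_norm_max R n k.
have A0 : 0 <= n%:R * C1 * C2 by rewrite !mulr_ge0// ltW.
(* on the simplex scaled by [t] a polynomial varies by at most half its value at the node *)
pose t := (2 * (n%:R * C1 * C2 + 1))^-1.
have t0 : 0 < t by rewrite invr_gt0 mulr_gt0// ltr_wpDl.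
have t1 : t <= 1.
  by rewrite invf_le1 ?mulr_gt0 ?ltr_wpDl//; lra.
have tA : t * (n%:R * C1 * C2) <= 2^-1.
  rewrite /t; move: A0; move: (n%:R * C1 * C2) => A A0.
  by rewrite ler_pdivrMl ?mulr_gt0 ?ltr_wpDl//; lra.
clearbody t.
(* the box with half side [c / 2] around the point with all coordinates [c] is in the simplex *)
pose c : R := (2 * n.+1%:R)^-1.
have c0 : 0 < c by rewrite invr_gt0 mulr_gt0.
have nc : n%:R * (2 * c) <= 1.
  have -> : 2 * c = n.+1%:R^-1 by rewrite /c invfM mulrA (mulfV (_ : 2 != 0 :> R)) ?mul1r ?gt_eqF.
  by rewrite ler_pdivrMr// mul1r ler_nat.
clearbody c; pose r := t * c / 4.
have r0 : 0 < r by rewrite divr_gt0 ?mulr_gt0.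
exists r, (2 * C2); split=> [//||q Pq]; first by rewrite mulr_gt0.
have [na hna Na] : exists2 na : 'rV[R]_n, ref_simplex na & nodal_norm k q <= C2 * `|q na|.
  have [a aok Na] := HC2 q; exists (node R a) => //; exact: ref_simplex_node.
pose y : 'rV[R]_n := \row_i (na 0 i + t * (c - na 0 i)).
have yE i : y 0 i = na 0 i + t * (c - na 0 i) by rewrite mxE.
clearbody y.
(* points within twice the radius are images of points of the simplex *)
have pre z : (forall i, `|z 0 i - y 0 i| <= 2 * r) ->
    exists2 zeta : 'rV[R]_n, ref_simplex zeta & z = na + t *: (zeta - na).
  move=> Hz; pose zeta : 'rV[R]_n := \row_i (c + t^-1 * (z 0 i - y 0 i)).
  have zE i : zeta 0 i = c + t^-1 * (z 0 i - y 0 i) by rewrite mxE.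
  clearbody zeta.
  exists zeta.
    have zc i : 0 <= zeta 0 i <= 2 * c.
      have : `|t^-1 * (z 0 i - y 0 i)| <= c / 2.
        rewrite normrM gtr0_norm ?invr_gt0// ler_pdivrMl//.
        by apply: le_trans (Hz i) _; rewrite /r; lra.
      by rewrite zE ler_norml; move: (t^-1 * _) => w /andP[w1 w2]; apply/andP; split; lra.
    split=> [i|]; first by have /andP[] := zc i.
    by apply: le_trans nc; apply: ler_sum_ord_const => i; have /andP[] := zc i.
  apply/rowP => i; rewrite !mxE zE yE.
  rewrite mulrDr mulrDr mulrA mulfV ?gt_eqF// mul1r; move: (z 0 i) (na 0 i) => p w; ring.
have two z : (forall i, `|z 0 i - y 0 i| <= r) -> forall i, `|z 0 i - y 0 i| <= 2 * r.
  by move=> Hz i; apply: le_trans (Hz i) _; rewrite ler_peMl// ?(ltW r0)// ler1n.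
have simplex z : (forall i, `|z 0 i - y 0 i| <= 2 * r) -> ref_simplex z.
  move=> /pre[zeta hz ->]; apply: ref_simplex_segment => //.
  by rewrite (ltW t0).
exists y => z Hz; split.
  rewrite /interior/=; apply/nbhs_ballP; exists r => //= w /(ball_rowP _ _ r0) Hw.
  apply: simplex => i.
  have -> : w 0 i - y 0 i = (z 0 i - y 0 i) - (z 0 i - w 0 i) by ring.
  apply: le_trans (ler_normB _ _) _; rewrite (mulr_natl r 2) mulr2n lerD//.
  exact/ltW/Hw.
have [zeta hz zE] := pre z (two z Hz).
have Iq : interpolant k q = q by exact: interpolant_Pk.
have var : `|q z - q na| <= n%:R * (t * (C1 * nodal_norm k q)).
  pose u (x : 'rV[R]_n) := q (na + t *: (x - na)).
  have -> : q na = u na by rewrite /u subrr scaler0 addr0.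
  have -> : q z = u zeta by rewrite /u -zE.
  apply: (@ref_simplex_mvt _ _ u (fun i x => t * partial i q (na + t *: (x - na)))) => //.
  - by rewrite !mulr_ge0 ?nodal_norm_ge0// ltW.
  - move=> x hx v; apply: is_derive_affine.
    have := is_derive_Pk Pq (na + t *: (x - na)) (t *: v); congr is_derive.
    by apply: eq_bigr => i _; rewrite mxE; ring.
  - move=> x hx i; rewrite normrM gtr0_norm// ler_wpM2l ?(ltW t0)//.
    have := (HC1 q (na + t *: (x - na)) _).2 i; rewrite Iq; apply.
    by apply: ref_simplex_segment => //; rewrite (ltW t0).
have half : `|q z - q na| <= 2^-1 * `|q na|.
  apply: (le_trans var).
  apply: (@le_trans _ _ (t * (n%:R * C1 * C2) * `|q na|)); last by rewrite ler_wpM2r.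
  have -> : t * (n%:R * C1 * C2) * `|q na| = n%:R * (t * (C1 * (C2 * `|q na|))) by ring.
  by rewrite !ler_wpM2l// ltW.
apply: (le_trans Na); rewrite [2 * C2]mulrC -mulrA ler_wpM2l ?(ltW C20)//.
have := ler_normB (q z) (q z - q na); rewrite opprB addrC subrK.
by move: half; move: `|q z - _| `|q z| `|q na| => p1 p2 p3; lra.
Qed.
End reference_norms.
Section reference_integrals.
Variables (R : realType) (n : nat).
Implicit Types (f : 'rV[R]_n -> \bar R) (xi y z : 'rV[R]_n) (r m : R).
Local Notation intK := (@ref_simplex R n)°.

(** The integral of an arbitrary nonnegative function is defined as a supremum over the
    simple functions below it. *)
Lemma ge0_le_integral_on f1 f2 (A1 A2 : set 'rV[R]_n) : A1 `<=` A2 ->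
  (forall x, A1 x -> (0 <= f1 x)%E) -> (forall x, A2 x -> (0 <= f2 x)%E) ->
  (forall x, A1 x -> (f1 x <= f2 x)%E) ->
  (integral_on A1 f1 <= integral_on A2 f2)%E.
Proof.
move=> A12 f10 f20 f12; rewrite /integral_on !ge0_integralE => [|t At|t At]; last first.
- exact: f10.
- exact: f20.
apply: ereal_sup_le => _ [h Hh <-]; exists h => //= t.
apply: (le_trans (Hh t)); rewrite !patchE.
case: ifPn => [/[!inE]At|_].
  by rewrite mem_set; [exact: f12|exact: A12].
by case: ifPn => // /[!inE]At; exact: f20.
Qed.

Lemma integral_on_cst (A : set 'rV[R]_n) m : measurable (@row_of_tuple R n @^-1` A) ->
  integral_on A (fun=> m%:E) = (m%:E * lebn R n (@row_of_tuple R n @^-1` A))%E.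
Proof. by move=> mA; exact: integral_cst. Qed.

Lemma measurable_ref_interior : measurable (@row_of_tuple R n @^-1` intK).
Proof. by apply: measurable_open; exact: open_interior. Qed.

Lemma ref_box (y : 'rV[R]_n) r :
  @row_of_tuple R n @^-1` [set z | forall i, `|z 0 i - y 0 i| <= r] = tbox y r.
Proof.
apply/seteqP; split=> t Ht i; have := Ht i;
  by rewrite ler_distl row_of_tupleE.
Qed.

Lemma lebn_ref_interior : (lebn R n (@row_of_tuple R n @^-1` intK) <= 1)%E.
Proof.
apply: (@le_trans _ _ (lebn R n (tbox (const_mx 2^-1) 2^-1))); last first.
  by rewrite lebn_tbox ?invr_ge0// mulfV// expr1n.
apply: le_measure; rewrite ?inE; [exact: measurable_ref_interior|exact: measurable_tbox|].
move=> t /= Ht; rewrite -ref_box => i.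
have /ref_simplex_coord/(_ i) := interior_subset Ht.
by rewrite [const_mx _ _ _]mxE ler_norml; lra.
Qed.

Lemma integral_on_ref_le f m : 0 <= m ->
  (forall x, intK x -> (0 <= f x <= m%:E)%E) ->
  (integral_on intK f <= m%:E)%E.
Proof.
move=> m0 Hf.
apply: (@le_trans _ _ (integral_on intK (fun=> m%:E))).
  by apply: ge0_le_integral_on => // x /Hf/andP[].
rewrite integral_on_cst; last exact: measurable_ref_interior.
rewrite -[X in (_ <= X)%E]mule1; apply: lee_wpmul2l; rewrite ?lee_fin//.
exact: lebn_ref_interior.
Qed.

Lemma integral_on_ref_ge f y r m : 0 <= r -> 0 <= m ->
  (forall x, intK x -> (0 <= f x)%E) ->
  (forall z, (forall i, `|z 0 i - y 0 i| <= r) -> intK z /\ (m%:E <= f z)%E) ->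
  ((m * (2 * r) ^+ n)%:E <= integral_on intK f)%E.
Proof.
move=> r0 m0 f0 Hf.
rewrite EFinM -(lebn_tbox y r0) -ref_box -integral_on_cst; last first.
  by rewrite ref_box; exact: measurable_tbox.
by apply: ge0_le_integral_on => // x /Hf[].
Qed.

Lemma ess_sup_on_ref_le f m : (0 <= m)%R ->
  (forall x, intK x -> (f x <= m%:E)%E) ->
  (ess_sup_on intK f <= m%:E)%E.
Proof.
move=> m0 Hf; apply/ess_supP; apply: aeW => t; rewrite patchE.
by case: ifPn => // /[!inE]/Hf.
Qed.

Lemma ess_sup_on_ref_ge f y r m : 0 < r ->
  (forall z, (forall i, `|z 0 i - y 0 i| <= r) -> intK z /\ (m%:E <= f z)%E) ->
  (m%:E <= ess_sup_on intK f)%E.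
Proof.
move=> r0 Hf; rewrite leNgt; apply/negP => H.
have [N [mN N0 HN]] := ess_sup_ge (lebn R n)
  ((f \o @row_of_tuple R n) \_ (@row_of_tuple R n @^-1` intK)).
have : (lebn R n (tbox y r) <= lebn R n N)%E.
  apply: le_measure; rewrite ?inE//; first exact: measurable_tbox.
  rewrite -ref_box => t /Hf[At ft]; apply: HN => /=.
  rewrite patchE mem_set// => /(le_trans ft); rewrite leNgt H//.
rewrite N0 lebn_tbox ?(ltW r0)// lee_fin leNgt exprn_gt0// mulr_gt0//.
Qed.
End reference_integrals.
(** * Tangential gradient and area element of a regular element *)

Section gram_matrix.
Variables (R : realType) (n d : nat).

Lemma enorm_sqr m (v : 'rV[R]_m) : enorm v ^+ 2 = (v *m v^T) 0 0.
Proof.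
rewrite /enorm sqr_sqrtr ?sumr_ge0// => [|i _]; last exact: sqr_ge0.
by rewrite mxE; apply: eq_bigr => i _; rewrite mxE.
Qed.

Lemma normr_det_le (A : 'M[R]_n) (b : R) : (forall i j, `|A i j| <= b) ->
  `|\det A| <= n`!%:R * b ^+ n.
Proof.
move=> Ab; apply: le_trans (ler_norm_sum _ _ _) _.
apply: (@le_trans _ _ (\sum_(s : 'S_n) b ^+ n)).
  apply: ler_sum => s _; rewrite normrM normrX normrN1 expr1n mul1r normr_prod.
  rewrite -[X in _ ^+ X](card_ord n) -prodr_const; apply: ler_prod => i _.
  by rewrite normr_ge0 Ab.
by rewrite sumr_const card_Sn mulr_natl.
Qed.

Variables (J : 'M[R]_(n, d)) (c C : R).
Hypothesis c0 : 0 < c.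
Hypothesis JC : forall i j, `|J i j| <= C.
Hypothesis Jc : forall (w : 'rV[R]_n) l, c * `|w 0 l| <= enorm (w *m J).
Let G := J *m J^T.

Lemma enorm_mulmx_gram (w : 'rV[R]_n) : enorm (w *m J) ^+ 2 = (w *m G *m w^T) 0 0.
Proof. by rewrite enorm_sqr trmx_mul !mulmxA. Qed.

(** The quadratic form [(1 - t) |w|^2 + t |w J|^2] vanishes at 0 only. *)
Lemma gram_segment_unit (t : R) : 0 <= t <= 1 ->
  (1 - t)%:M + t *: G \in unitmx.
Proof.
move=> /andP[t0 t1].
rewrite -row_free_unit -kermx_eq0; apply/rowV0P => w /sub_kermxP.
rewrite mulmxDr => w0.
have : (w *m (1 - t)%:M *m w^T + w *m (t *: G) *m w^T) 0 0 = 0.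
  by rewrite -mulmxDl w0 mul0mx mxE.
rewrite mul_mx_scalar -scalemxAr -!scalemxAl mxE [X in X + _]mxE [X in _ + X]mxE.
rewrite -enorm_sqr -enorm_mulmx_gram => /eqP.
have s1 : 0 <= (1 - t) * enorm w ^+ 2 by rewrite mulr_ge0 ?sqr_ge0// subr_ge0.
have s2 : 0 <= t * enorm (w *m J) ^+ 2 by rewrite mulr_ge0 ?sqr_ge0.
rewrite (paddr_eq0 s1 s2) => /andP[]; rewrite mulf_eq0 => /orP[|]; last first.
  by rewrite sqrf_eq0 => /eqP e0 _; exact: enorm_eq0.
rewrite subr_eq0 => /eqP <-; rewrite mul1r sqrf_eq0 => /eqP e0.
apply/rowP => l; apply/eqP.
rewrite mxE -normr_le0 -(pmulr_rle0 _ c0); have := Jc w l; by rewrite e0.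
Qed.

Lemma gram_unit : G \in unitmx.
Proof.
have := @gram_segment_unit 1; rewrite subrr raddf0 add0r scale1r lexx ler01.
exact.
Qed.

(** The determinant does not vanish on the segment that joins the identity to the Gram
    matrix. *)
Lemma det_gram_gt0 : 0 < \det G.
Proof.
pose M : 'M[{poly R}]_n := (1 - 'X)%:M + 'X *: map_mx polyC G.
pose p := \det M.
have pE t : p.[t] = \det ((1 - t)%:M + t *: G).
  rewrite /p -horner_evalE -det_map_mx; congr (\det _); apply/matrixP => i j.
  by rewrite !mxE/= horner_evalE hornerD hornerMn !hornerE.
rewrite ltNge; apply/negP => G0.
have [|t t01] := @poly_ivt _ (- p) 0 1 ler01.
  rewrite !hornerN !pE subr0 scale0r addr0 det1 subrr raddf0 add0r scale1r.
  by rewrite oppr_le0 ler01 oppr_ge0.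
rewrite /root hornerN oppr_eq0 pE => /eqP e0.
have := gram_segment_unit t01; rewrite unitmxE e0 unitr0//.
Qed.

Lemma gram_invmx_le i j : `|invmx G i j| <= (c ^+ 2)^-1.
Proof.
pose w := row i (invmx G).
have wG : w *m G = delta_mx 0 i by rewrite /w -row_mul mulVmx ?gram_unit// rowE mulmx1.
have e2 : enorm (w *m J) ^+ 2 = w 0 i.
  by rewrite enorm_mulmx_gram wG -rowE !mxE.
have le1 : enorm (w *m J) <= c^-1.
  have h : c * enorm (w *m J) ^+ 2 <= enorm (w *m J).
    apply: le_trans (Jc w i); rewrite -e2 ler_wpM2l ?(ltW c0)//; exact: ler_norm.
  have [->|n0] := eqVneq (enorm (w *m J)) 0; first by rewrite invr_ge0 ltW.
  have p0 : 0 < enorm (w *m J) by rewrite lt_neqAle eq_sym n0 enorm_ge0.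
  by move: h; rewrite expr2 mulrA -ler_pdivlMr// divff// mulrC -ler_pdivlMr// mul1r.
have -> : invmx G i j = w 0 j by rewrite mxE.
rewrite expr2 invfM ler_pdivlMl//.
exact: le_trans (Jc w j) le1.
Qed.

Lemma area_bounds : 0 <= C ->
  c ^+ n / n`!%:R <= Num.sqrt (\det G) <= n`!%:R * d%:R ^+ n * C ^+ n.
Proof.
move=> C0; have f0 : 0 < n`!%:R :> R by rewrite ltr0n fact_gt0.
have f1 : 1 <= n`!%:R :> R by rewrite ler1n fact_gt0.
have GC i j : `|G i j| <= d%:R * C ^+ 2.
  rewrite mxE; apply: le_trans (ler_norm_sum _ _ _) _.
  apply: ler_sum_ord_const => l.
  by rewrite normrM [J^T _ _]mxE expr2 ler_pM.
apply/andP; split.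
  have a0 : 0 <= c ^+ n / n`!%:R by rewrite divr_ge0 ?exprn_ge0 ?ltW.
  rewrite -[leLHS](ger0_norm a0) -sqrtr_sqr; apply: ler_wsqrtr.
  have g0 := det_gram_gt0; have X0 : 0 < (c ^+ 2) ^+ n by rewrite !exprn_gt0.
  have := normr_det_le gram_invmx_le; rewrite det_inv exprVn ler_pdivlMr//.
  rewrite ger0_norm ?invr_ge0 ?(ltW g0)// ler_pdivrMl// => h.
  rewrite exprMn -exprM mulnC exprM exprVn ler_pdivrMr ?exprn_gt0//.
  by apply: (le_trans h); rewrite ler_wpM2l ?(ltW g0)// expr2 ler_peMr// ltW.
have b0 : 0 <= n`!%:R * d%:R ^+ n * C ^+ n by rewrite !mulr_ge0 ?exprn_ge0.
rewrite -[leRHS](ger0_norm b0) -sqrtr_sqr; apply: ler_wsqrtr.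
apply: le_trans (ler_norm _) _; apply: le_trans (normr_det_le GC) _.
have -> : (n`!%:R * d%:R ^+ n * C ^+ n) ^+ 2 =
    n`!%:R * n`!%:R * (d%:R ^+ n * d%:R ^+ n * (C ^+ 2) ^+ n).
  by rewrite exprAC; move: (C ^+ n) (d%:R ^+ n) (n`!%:R : R) => x y z; ring.
rewrite exprMn; apply: ler_pM => //.
- by rewrite mulr_ge0 ?exprn_ge0 ?sqr_ge0.
- by rewrite ler_peMr// ltW.
apply: ler_wpM2r; first by rewrite exprn_ge0// sqr_ge0.
by rewrite -!natrX -natrM ler_nat; case: (d ^ n)%N => // q; rewrite leq_pmulr.
Qed.

Variable D : 'rV[R]_n.
Let t := D *m invmx G *m J.

Lemma tangential_partial_le i : `|D 0 i| <= d%:R * C * enorm t.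
Proof.
have -> : D = t *m J^T by rewrite /t -mulmxA -/G mulmxKV// gram_unit.
rewrite mxE; apply: le_trans (ler_norm_sum _ _ _) _.
rewrite -mulrA; apply: ler_sum_ord_const => l.
rewrite normrM mulrC [J^T _ _]mxE ler_pM//; exact: coord_le_enorm.
Qed.

Lemma enorm_tangential_le (E : R) : (forall i, `|D 0 i| <= E) -> enorm t <= n%:R * E / c.
Proof.
move=> DE; pose v := D *m invmx G.
have e2 : enorm t ^+ 2 = \sum_i D 0 i * v 0 i.
  rewrite /t enorm_mulmx_gram mulmxKV ?gram_unit// mxE.
  by apply: eq_bigr => i _; rewrite mxE.
have h : enorm t ^+ 2 <= n%:R * E / c * enorm t.
  rewrite e2 -!mulrA; apply: ler_sum_ord_const => i.
  apply: le_trans (ler_norm _) _; rewrite normrM ler_pM//.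
  by rewrite ler_pdivlMl// Jc.
have [e0|n0] := eqVneq (enorm t) 0; last first.
  have p0 : 0 < enorm t by rewrite lt_neqAle eq_sym n0 enorm_ge0.
  by move: h; rewrite expr2 ler_pM2r.
rewrite e0 divr_ge0 ?(ltW c0)// mulr_natl -[X in _ *+ X](card_ord n) -sumr_const.
by apply: sumr_ge0 => i _; exact: le_trans (DE i).
Qed.
End gram_matrix.

(** * Comparison of integral norms *)

Lemma powR_superadditive (R : realType) (s t r : R) : 0 <= s -> 0 <= t -> 1 <= r ->
  s `^ r + t `^ r <= (s + t) `^ r.
Proof.
move=> s0 t0 r1; have r0 : 0 < r by apply: lt_le_trans r1.
have st0 : 0 <= s + t by rewrite addr_ge0.
have mono (x : R) : 0 <= x -> x <= s + t -> x `^ r <= x * (s + t) `^ (r - 1).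
  move=> x0 xst; rewrite -(mulr_powRB1 x0 r0) ler_wpM2l//.
  by apply: ge0_ler_powR; rewrite ?nnegrE ?subr_ge0.
rewrite -(mulr_powRB1 st0 r0) mulrDl; apply: lerD; apply: mono => //.
  by rewrite lerDl.
by rewrite lerDr.
Qed.

(** Applied to the sums over the elements, which may be infinite. *)
Lemma poweR_subadditive (R : realType) (x y : \bar R) (r : R) :
  (0 <= x)%E -> (0 <= y)%E -> 1 <= r -> ((x + y) `^ r^-1 <= x `^ r^-1 + y `^ r^-1)%E.
Proof.
move=> x0 y0 r1; have r0 : 0 < r by apply: lt_le_trans r1.
have rV0 : r^-1 != 0 by rewrite gt_eqF ?invr_gt0.
move: x x0 => [x||] x0; last by [].
  move: y y0 => [y||] y0; last by [].
    rewrite !lee_fin in x0 y0; rewrite -EFinD !poweR_EFin -EFinD lee_fin.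
    have K (z : R) : 0 <= z -> (z `^ r^-1) `^ r = z.
      by move=> z0; rewrite -powRrM mulVf ?gt_eqF// powRr1.
    have rn0 : r != 0 by rewrite gt_eqF.
    have s0 : 0 <= x `^ r^-1 + y `^ r^-1 by rewrite addr_ge0 ?powR_ge0.
    rewrite -[leRHS]powRr1// -(mulfV rn0) powRrM.
    apply: ge0_ler_powR; rewrite ?nnegrE ?invr_ge0 ?addr_ge0 ?powR_ge0 ?(ltW r0)//.
    by rewrite -{1}(K x)// -{1}(K y)//; apply: powR_superadditive; rewrite ?powR_ge0.
  by rewrite addey// poweRyr// addey ?leey// -ltNye (lt_le_trans _ (poweR_ge0 _ _)).
have ge0_neqNy (z : \bar R) : (0 <= z)%E -> z != -oo%E.
  by move=> z0; rewrite -ltNye (lt_le_trans _ z0).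
by rewrite addye ?poweRyr ?addye ?leey ?ge0_neqNy ?poweR_ge0.
Qed.

Section norm_comparison.
Variables (R : realType) (n k : nat).
Variables (rho0 C0 : R).
Hypothesis rho00 : 0 < rho0.
Hypothesis C00 : 0 < C0.
Hypothesis box : @large_on_box R n k rho0 C0.
Local Notation intK := (@ref_simplex R n)°.

Lemma ess_sup_ge_nodal_norm (q : 'rV[R]_n -> R) (v : 'rV[R]_n -> R) (A : R) :
  0 < A -> in_Pk k q -> (forall xi, intK xi -> `|q xi| <= A * `|v xi|) ->
  ((nodal_norm k q / (C0 * A))%:E <= ess_sup_on intK (fun xi => `|v xi|%:E))%E.
Proof.
move=> A0 Pq qv; have [y Hy] := box Pq.
apply: (ess_sup_on_ref_ge rho00 (y := y)) => z /Hy[Iz Nz]; split=> //.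
rewrite lee_fin ler_pdivrMr ?mulr_gt0//; apply: (le_trans Nz).
by rewrite [leRHS]mulrC -mulrA ler_wpM2l ?(ltW C00)// qv.
Qed.

Lemma element_ess_sup (q u v : 'rV[R]_n -> R) (B : R) :
  0 <= B -> in_Pk k q ->
  (forall xi, intK xi -> `|u xi| <= B * nodal_norm k q) ->
  (forall xi, intK xi -> `|q xi| <= `|v xi|) ->
  (ess_sup_on intK (fun xi => `|u xi|%:E) <=
   (C0 * B)%:E * ess_sup_on intK (fun xi => `|v xi|%:E))%E.
Proof.
move=> B0 Pq uq qv.
apply: (@le_trans _ _ (B * nodal_norm k q)%:E).
  by apply: ess_sup_on_ref_le => [|xi Ixi]; rewrite ?mulr_ge0 ?nodal_norm_ge0// lee_fin uq.
apply: (@le_trans _ _ ((C0 * B)%:E * (nodal_norm k q / (C0 * 1))%:E)%E).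
  rewrite -EFinM lee_fin mulr1 [C0 * B]mulrC -mulrA ler_wpM2l//.
  by rewrite mulrCA mulfV ?mulr1 ?gt_eqF.
apply: lee_wpmul2l; first by rewrite lee_fin mulr_ge0// ltW.
by apply: ess_sup_ge_nodal_norm => // xi /qv; rewrite mul1r.
Qed.

Variables (c1 C1 : R).
Hypothesis c10 : 0 < c1.
Hypothesis C10 : 0 < C1.

(** The summand 1 makes the first factor at least 1, so that it is below its [r]-th power
    for all [r >= 1]. *)
Definition comparison_constant : R := (1 + C1 / (c1 * (2 * rho0) ^+ n)) * C0.

Lemma comparison_constant_gt0 : 0 < comparison_constant.
Proof. by rewrite mulr_gt0// addr_gt0// divr_gt0// mulr_gt0// exprn_gt0// mulr_gt0. Qed.

(** The integral over the simplex is at most a multiple of the integral over the box where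
    the polynomial is large; as the ratio of the measures enters the norm with the power
    [1/r], the constant can be chosen independently of [r >= 1]. *)
Lemma element_integral (q u v area : 'rV[R]_n -> R) (B r w : R) :
  0 <= B -> 1 <= r -> 0 < w -> in_Pk k q ->
  (forall xi, ref_simplex xi -> c1 * w <= area xi <= C1 * w) ->
  (forall xi, intK xi -> `|u xi| <= B * nodal_norm k q) ->
  (forall xi, intK xi -> `|q xi| <= `|v xi|) ->
  (integral_on intK (fun xi => (`|u xi| `^ r * area xi)%:E) <=
   ((comparison_constant * B) `^ r)%:E *
   integral_on intK (fun xi => (`|v xi| `^ r * area xi)%:E))%E.
Proof.
move=> B0 r1 w0 Pq Ha uq qv; have r0 : 0 < r by apply: lt_le_trans r1.
have N0 : 0 <= nodal_norm k q by exact: nodal_norm_ge0.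
have a0 xi : intK xi -> 0 <= area xi.
  move=> /interior_subset/Ha/andP[+ _]; apply: le_trans; by rewrite mulr_ge0 ?ltW.
have le_powR (x y : R) : 0 <= x -> x <= y -> x `^ r <= y `^ r.
  by move=> x0 xy; rewrite ge0_ler_powR ?nnegrE ?(ltW r0)// (le_trans x0).
have [y Hy] := box Pq.
apply: (@le_trans _ _ ((B * nodal_norm k q) `^ r * (C1 * w))%:E).
  apply: integral_on_ref_le => [|xi Ixi]; first by rewrite mulr_ge0 ?powR_ge0// mulr_ge0 ?ltW.
  rewrite !lee_fin mulr_ge0 ?powR_ge0 ?a0//= ler_pM ?powR_ge0 ?a0//.
    by apply: le_powR => //; exact: uq.
  by have /andP[] := Ha _ (interior_subset Ixi).
apply: (@le_trans _ _ (((comparison_constant * B) `^ r)%:E *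
    ((nodal_norm k q / C0) `^ r * (c1 * w) * (2 * rho0) ^+ n)%:E)%E); last first.
  apply: lee_wpmul2l; first by rewrite lee_fin powR_ge0.
  apply: (integral_on_ref_ge (y := y)) => [||xi Ixi|z /Hy[Iz Nz]].
  - exact: ltW.
  - by rewrite mulr_ge0 ?powR_ge0// mulr_ge0 ?ltW.
  - by rewrite lee_fin mulr_ge0 ?powR_ge0 ?a0.
  - split=> //; rewrite lee_fin ler_pM ?powR_ge0//.
    + by rewrite mulr_ge0 ?ltW.
    + apply: le_powR; first by rewrite divr_ge0 ?(ltW C00).
      by rewrite ler_pdivrMr// mulrC (le_trans Nz)// ler_wpM2l ?(ltW C00)// qv.
    + by have /andP[] := Ha _ (interior_subset Iz).
rewrite -EFinM lee_fin.
set K1 : R := 1 + C1 / (c1 * (2 * rho0) ^+ n).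
have V0 : 0 < c1 * (2 * rho0) ^+ n by rewrite mulr_gt0// exprn_gt0// mulr_gt0.
have K11 : 1 <= K1 by rewrite lerDl divr_ge0 ?ltW.
have K10 : 0 <= K1 by rewrite (le_trans _ K11).
have -> : (comparison_constant * B) `^ r * ((nodal_norm k q / C0) `^ r * (c1 * w) * (2 * rho0) ^+ n) =
    K1 `^ r * ((B * nodal_norm k q) `^ r * (c1 * (2 * rho0) ^+ n * w)).
  have -> : (comparison_constant * B) `^ r * ((nodal_norm k q / C0) `^ r * (c1 * w) * (2 * rho0) ^+ n) =
    ((comparison_constant * B) `^ r * (nodal_norm k q / C0) `^ r) * (c1 * (2 * rho0) ^+ n * w).
    move: (_ `^ r) (_ `^ r) ((2 * rho0) ^+ n) => x1 x2 x3; ring.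
  rewrite -powRM; last 2 first.
  - by rewrite mulr_ge0 ?(ltW comparison_constant_gt0).
  - by rewrite divr_ge0 ?(ltW C00).
  rewrite [RHS]mulrA -powRM ?mulr_ge0//; congr (_ `^ _ * _).
  rewrite /comparison_constant -/K1 -!mulrA; congr (_ * _).
  by rewrite mulrCA; congr (_ * _); rewrite mulrCA mulfV ?mulr1 ?gt_eqF.
rewrite [leRHS]mulrCA ler_wpM2l ?powR_ge0// [leRHS]mulrA ler_wpM2r ?(ltW w0)//.
apply: (@le_trans _ _ (K1 * (c1 * (2 * rho0) ^+ n))).
  by rewrite /K1 mulrDl divfK ?gt_eqF// lerDr mul1r ltW.
rewrite ler_wpM2r ?(ltW V0)// -[leLHS]powRr1//.
by rewrite ler_powR.
Qed.

Section mesh_norms.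
Variables (T : mesh R n.+1) (P : {set 'I_(nvert T)} -> 'rV[R]_n -> 'rV[R]_n.+1) (w : R).
Hypothesis w0 : 0 < w.
Hypothesis areaP : forall S, S \in facets T -> forall xi, ref_simplex xi ->
  c1 * w <= area_element (P S) xi <= C1 * w.
Implicit Types u v : elementwise T R.

Lemma Lp_norm_ge0 p u : (0 <= Lp_norm T P p u)%E.
Proof.
case: p => [r||] //=; first exact: poweR_ge0.
exact: bigmax_ge_id.
Qed.

(** On each element the larger one of the two polynomials dominates [u] up to a factor 2, so
    that one of the integrals of [v] and [v'] suffices there. *)
Lemma Lp_norm_comparison p u v v' (b : R) : (1 <= p)%E -> 0 <= b ->
  (forall S, S \in facets T -> exists q q' : 'rV[R]_n -> R, [/\ in_Pk k q /\ in_Pk k q',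
      forall xi, intK xi -> `|q xi| <= `|v S xi|,
      forall xi, intK xi -> `|q' xi| <= `|v' S xi| &
      forall xi, intK xi -> `|u S xi| <= b * (nodal_norm k q + nodal_norm k q')]) ->
  (Lp_norm T P p u <=
   (comparison_constant * (2 * b))%:E * (Lp_norm T P p v + Lp_norm T P p v'))%E.
Proof.
move=> p1 b0 Hu; pose B := 2 * b; have B0 : 0 <= B by rewrite mulr_ge0.
rewrite -/B; have Huv S : S \in facets T -> exists q : 'rV[R]_n -> R, [/\ in_Pk k q,
    forall xi, intK xi -> `|u S xi| <= B * nodal_norm k q &
    (forall xi, intK xi -> `|q xi| <= `|v S xi|) \/
    (forall xi, intK xi -> `|q xi| <= `|v' S xi|)].
  have le_max (x y z : R) : y <= x -> z <= x -> b * (y + z) <= B * x.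
    by move=> yx zx; rewrite /B [2 * b]mulrC -mulrA ler_wpM2l// mulr_natl mulr2n lerD.
  move=> /Hu[q [q' [[Pq Pq'] qv q'v uqq']]].
  have [le|/ltW le] := leP (nodal_norm k q') (nodal_norm k q).
    by exists q; split=> // [xi /uqq'/le_trans|]; [apply; exact: le_max|left].
  by exists q'; split=> // [xi /uqq'/le_trans|]; [apply; exact: le_max|right].
have KB : 0 <= comparison_constant * B by rewrite mulr_ge0// ltW ?comparison_constant_gt0.
case: p p1 => [r||] //= r1.
  rewrite lee_fin in r1; have r0 : 0 < r by apply: lt_le_trans r1.
  pose I (x : elementwise T R) S := integral_on intK
    (fun xi => (`|x S xi| `^ r * area_element (P S) xi)%:E).
  have I0 x S : S \in facets T -> (0 <= I x S)%E.
    move=> ST; apply: integral_ge0 => t /interior_subset Kt.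
    rewrite lee_fin mulr_ge0 ?powR_ge0// /area_element sqrtr_ge0//.
  have sI0 x : (0 <= \sum_(S in facets T) I x S)%E by apply: sume_ge0 => S ST; exact: I0.
  have main : (\sum_(S in facets T) I u S <= ((comparison_constant * B) `^ r)%:E *
      (\sum_(S in facets T) I v S + \sum_(S in facets T) I v' S))%E.
    rewrite -big_split/= ge0_sume_distrr; last by move=> S ST; rewrite adde_ge0 ?I0.
    apply: lee_sum => S ST; have [q [Pq uq [qv|qv]]] := Huv _ ST.
      apply: (le_trans (element_integral B0 r1 w0 Pq (areaP ST) uq qv)).
      by apply: lee_wpmul2l; rewrite ?lee_fin ?powR_ge0// leeDl ?I0.
    apply: (le_trans (element_integral B0 r1 w0 Pq (areaP ST) uq qv)).
    by apply: lee_wpmul2l; rewrite ?lee_fin ?powR_ge0// leeDr ?I0.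
  have rV0 : 0 <= r^-1 by rewrite invr_ge0 ltW.
  apply: (@le_trans _ _ ((((comparison_constant * B) `^ r)%:E *
      (\sum_(S in facets T) I v S + \sum_(S in facets T) I v' S)) `^ r^-1)%E).
    apply: gt0_ler_poweR => //; rewrite in_itv/= ?leey ?andbT//.
      exact: sI0.
    by rewrite mule_ge0 ?lee_fin ?powR_ge0// adde_ge0.
  rewrite poweRM ?lee_fin ?powR_ge0 ?adde_ge0// poweR_EFin -powRrM mulfV ?gt_eqF// powRr1//.
  apply: lee_wpmul2l; first by rewrite lee_fin.
  exact: poweR_subadditive.
apply: bigmax_le => [|S ST].
  by rewrite mule_ge0 ?lee_fin// adde_ge0//; exact: bigmax_ge_id.
have CK : C0 * B <= comparison_constant * B.
  by rewrite ler_wpM2r// ler_peMl ?(ltW C00)// lerDl divr_ge0 ?ltW// mulr_gt0// exprn_gt0// mulr_gt0.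
have [q [Pq uq qv]] := Huv _ ST.
have main (x : elementwise T R) : (forall xi, intK xi -> `|q xi| <= `|x S xi|) ->
    (ess_sup_on intK (fun xi => `|u S xi|%:E) <= (comparison_constant * B)%:E *
      \big[maxe/0%E]_(S in facets T) ess_sup_on intK (fun xi => `|x S xi|%:E))%E.
  move=> qx; apply: (le_trans (element_ess_sup B0 Pq uq qx)).
  apply: (@le_trans _ _ ((C0 * B)%:E *
    \big[maxe/0%E]_(S in facets T) ess_sup_on intK (fun xi => `|x S xi|%:E))%E).
    apply: lee_wpmul2l; first by rewrite lee_fin mulr_ge0// ltW.
    exact: (le_bigmax_cond _
      (fun S => ess_sup_on intK (fun xi => `|x S xi|%:E)) ST).
  by apply: lee_wpmul2r; rewrite ?lee_fin//; exact: bigmax_ge_id.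
by case: qv => /main H; apply: (le_trans H); apply: lee_wpmul2l;
  rewrite ?lee_fin//; [rewrite leeDl|rewrite leeDr]; rewrite ?bigmax_ge_id.
Qed.

End mesh_norms.
End norm_comparison.
(** * Estimates on one element *)

Section regular_element.
Variables (R : realType) (n k : nat) (T : mesh R n.+1).
Variables (F : {set 'I_(nvert T)} -> 'rV[R]_n -> 'rV[R]_n.+1) (c C : R).
Hypothesis c0 : 0 < c.
Hypothesis C0 : 0 < C.
Hypothesis h0 : 0 < mesh_size T.
Hypothesis regF : regular_elements k F c C.
Variable S : {set 'I_(nvert T)}.
Hypothesis ST : S \in facets T.
Implicit Types (u : 'rV[R]_n -> R) (xi : 'rV[R]_n).
Let h := mesh_size T.

Lemma jac_le xi i j : ref_simplex xi -> `|jac (F S) xi i j| <= C * h.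
Proof. by move=> hxi; rewrite mxE; have [_ /(_ _ hxi)[+ _]] := regF ST; exact. Qed.

Lemma jac_ge xi (w : 'rV[R]_n) l : ref_simplex xi ->
  c * h * `|w 0 l| <= enorm (w *m jac (F S) xi).
Proof. by move=> hxi; have [_ /(_ _ hxi)[_ ]] := regF ST; exact. Qed.

Let ch0 : 0 < c * h. Proof. exact: mulr_gt0. Qed.
Let Ch0 : 0 < C * h. Proof. exact: mulr_gt0. Qed.

Lemma area_element_bounds xi : ref_simplex xi ->
  c ^+ n / n`!%:R * h ^+ n <= area_element (F S) xi <= n`!%:R * n.+1%:R ^+ n * C ^+ n * h ^+ n.
Proof.
move=> hxi.
have := area_bounds ch0 (fun i j => jac_le i j hxi) (fun w l => jac_ge w l hxi) (ltW Ch0).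
by rewrite !exprMn mulrA [c ^+ n * _ / _]mulrAC.
Qed.

Lemma partial_le_tgrad u xi i : ref_simplex xi ->
  `|partial i u xi| <= n.+1%:R * C * h * tgrad_norm (F S) u xi.
Proof.
move=> hxi; have := tangential_partial_le ch0 (fun i j => jac_le i j hxi)
  (fun w l => jac_ge w l hxi) (\row_i 'D_(basis_vec R i) u xi) i.
by rewrite mxE mulrA.
Qed.

Lemma tgrad_norm_le u xi (E : R) : ref_simplex xi -> (forall i, `|partial i u xi| <= E) ->
  tgrad_norm (F S) u xi <= n%:R * E / (c * h).
Proof.
move=> hxi uE; apply: (enorm_tangential_le ch0 (fun w l => jac_ge w l hxi)) => i.
by rewrite mxE; exact: uE.
Qed.

Lemma tgrad_norm_le_vec (v : 'rV[R]_n -> 'rV[R]_n.+1) xi j :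
  tgrad_norm (F S) (fun eta => v eta 0 j) xi <= tgrad_norm_vec (F S) v xi.
Proof.
have t0 u : 0 <= tgrad_norm (F S) u xi by exact: enorm_ge0.
rewrite -[leLHS]ger0_norm// -sqrtr_sqr; apply: ler_wsqrtr.
by rewrite (bigD1 j)//= lerDl sumr_ge0// => i _; rewrite sqr_ge0.
Qed.

Lemma eq_tgrad_norm u u' xi : (@ref_simplex R n)° xi ->
  (forall eta, ref_simplex eta -> u eta = u' eta) ->
  tgrad_norm (F S) u xi = tgrad_norm (F S) u' xi.
Proof.
move=> Ixi uu'; rewrite /tgrad_norm /tgrad.
suff -> : \row_i 'D_(basis_vec R i) u xi = \row_i 'D_(basis_vec R i) u' xi by [].
apply/rowP => i; rewrite !mxE; apply: near_eq_derive.
by move: Ixi; rewrite /interior/=; apply: filterS => eta; exact: uu'.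
Qed.

Lemma eq_tgrad_norm_vec (v v' : 'rV[R]_n -> 'rV[R]_n.+1) xi : (@ref_simplex R n)° xi ->
  (forall eta, ref_simplex eta -> v eta = v' eta) ->
  tgrad_norm_vec (F S) v xi = tgrad_norm_vec (F S) v' xi.
Proof.
move=> Ixi vv'; rewrite /tgrad_norm_vec; apply: (congr1 Num.sqrt); apply: eq_bigr => j _.
apply: (congr1 (fun x => x ^+ 2)).
by apply: eq_tgrad_norm => // eta /vv' ->.
Qed.

(** A polynomial is controlled on the closed simplex by its values on a box, which are
    bounded by the essential supremum: a bound almost everywhere becomes a bound at every
    point. *)
Lemma vpartial_le_W1oo (rho0 D0 Cn M : R) (P : 'rV[R]_n -> 'rV[R]_n.+1)
    (v : elementwise T 'rV[R]_n.+1) : (0 < k)%N -> 0 < rho0 -> 0 < D0 -> 0 < Cn ->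
  @large_on_box R n k rho0 D0 ->
  (forall g xi, ref_simplex xi -> `|interpolant k g xi| <= Cn * nodal_norm k g) ->
  vector_Pk k P -> (forall xi, ref_simplex xi -> v S xi = P xi) ->
  (W1p_norm_vec T F +oo v <= M%:E)%E ->
  forall xi, ref_simplex xi -> forall i j,
    `|vpartial P i j xi| <= Cn * (D0 * (n.+1%:R * C)) * `|M| * h.
Proof.
move=> k0 rho00 D00 Cn0 box HCn PP vP vM xi hxi i j.
have Pq : in_Pk k (vpartial P i j) by exact: in_Pk_partial.
have A0 : 0 < n.+1%:R * C * h by rewrite !mulr_gt0.
have := HCn (vpartial P i j) xi hxi; rewrite (interpolant_Pk k0 Pq) => /le_trans; apply.
rewrite -!mulrA ler_wpM2l ?(ltW Cn0)//.
have main : ((nodal_norm k (vpartial P i j) / (D0 * (n.+1%:R * C * h)))%:E <= M%:E)%E.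
  apply: (@le_trans _ _ (ess_sup_on (@ref_simplex R n)°
      (fun eta => `|tgrad_norm_vec (F S) (v S) eta|%:E))).
    apply: (ess_sup_ge_nodal_norm rho00 D00 box A0 Pq) => eta Ieta.
    apply: (le_trans (partial_le_tgrad _ _ (interior_subset Ieta))).
    rewrite ler_wpM2l ?(ltW A0)// (eq_tgrad_norm_vec Ieta vP).
    exact: le_trans (tgrad_norm_le_vec _ _ _) (ler_norm _).
  apply: le_trans vM; rewrite /W1p_norm_vec.
  apply: (@le_trans _ _ (Lp_norm T F +oo (fun S => tgrad_norm_vec (F S) (v S)))).
    exact: (le_bigmax_cond _ (fun S => ess_sup_on (@ref_simplex R n)°
      (fun eta => `|tgrad_norm_vec (F S) (v S) eta|%:E)) ST).
  by rewrite leeDr// Lp_norm_ge0.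
rewrite lee_fin ler_pdivrMr ?mulr_gt0// in main.
apply: (le_trans main); apply: (@le_trans _ _ (`|M| * (D0 * (n.+1%:R * C * h)))).
  by apply: ler_wpM2r; [rewrite !mulr_ge0// ltW|exact: ler_norm].
by rewrite [leLHS]mulrC -!mulrA [h * _]mulrC.
Qed.

End regular_element.

Section element_estimates.
Variables (R : realType) (n k : nat).
Hypothesis n0 : (0 < n)%N.
Hypothesis k0 : (0 < k)%N.
Variables (c C : R).
Hypothesis c0 : 0 < c.
Hypothesis C0 : 0 < C.

Lemma nodal_normZ (b : R) (q : 'rV[R]_n -> R) :
  nodal_norm k (fun xi => b * q xi) = `|b| * nodal_norm k q.
Proof. by rewrite /nodal_norm mulr_sumr; apply: eq_bigr => a _; rewrite normrM. Qed.

(** Scaled to an element of size [h], the reference estimates are expressed by one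
    polynomial that is dominated by [phi - psi] and another one that is dominated by its
    tangential gradient: the component of [phi - psi], resp. the partial derivative of a
    component, of largest nodal norm. *)
Lemma element_estimates (L KG M h0 : R) : 0 < L -> 0 < KG -> 0 <= M -> 0 <= h0 ->
  exists2 B : R, 0 <= B &
  forall (T : mesh R n.+1) (F : {set 'I_(nvert T)} -> 'rV[R]_n -> 'rV[R]_n.+1)
    (D : set 'rV[R]_n.+1) (G : seq 'I_n.+1 -> 'rV[R]_n.+1 -> R)
    (phi psi : 'rV[R]_n -> 'rV[R]_n.+1) S,
  0 < mesh_size T -> mesh_size T <= h0 -> regular_elements k F c C -> S \in facets T ->
  local_C21 D L G ->
  (forall s, (size s <= 2)%N -> forall x y, D x -> D y ->
    `|G s x - G s y| <= KG * norm1 (x - y)) ->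
  vector_Pk k phi -> vector_Pk k psi ->
  (forall xi, ref_simplex xi -> D (phi xi)) ->
  (forall xi, ref_simplex xi -> D (psi xi)) ->
  (forall xi, ref_simplex xi -> forall i j, `|vpartial phi i j xi| <= M * mesh_size T) ->
  (forall xi, ref_simplex xi -> forall i j, `|vpartial psi i j xi| <= M * mesh_size T) ->
  let e := fun xi => phi xi - psi xi in
  let g := fun xi => G [::] (phi xi) - G [::] (psi xi) in
  let err := fun xi => g xi - interpolant k g xi in
  exists q q' : 'rV[R]_n -> R, [/\ in_Pk k q /\ in_Pk k q',
    forall xi, ref_simplex xi -> `|q xi| <= enorm (e xi),
    forall xi, ref_simplex xi -> `|q' xi| <= tgrad_norm_vec (F S) e xi &
    forall xi, ref_simplex xi ->
    [/\ `|err xi| <= B * mesh_size T * nodal_norm k q,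
        tgrad_norm (F S) err xi <= B * mesh_size T * (nodal_norm k q + nodal_norm k q'),
        `|interpolant k g xi| <= B * nodal_norm k q &
        tgrad_norm (F S) (interpolant k g) xi <= B * (nodal_norm k q + nodal_norm k q')]].
Proof.
move=> L0 KG0 M0 h00.
have [Cr Cr0 HCr] := @reference_estimates R n n.+1 k k0 L KG L0 KG0.
have [Cn Cn0 HCn] := @nodal_norm_bound R n k.
have [C2 C20 HC2] := @nodal_norm_le_sup R n k k0.
have nC0 : 0 <= n.+1%:R * C by rewrite mulr_ge0// ltW.
have [B1 B10 id1] : exists2 B1 : R, 0 <= B1 & forall x y,
    Cr * (M * x * (Cn * (C2 * (Cn * y)) + M * h0 * (Cn * y))) = B1 * x * y.
  exists (Cr * M * (Cn * C2 * Cn + M * h0 * Cn)) => [|x y]; last by ring.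
  by rewrite !(mulr_ge0, addr_ge0)// ltW.
have [B4 B40 le4] : exists2 B4 : R, 0 <= B4 & forall x a b, 0 < x -> 0 <= a -> 0 <= b ->
    n%:R * (Cr * (Cn * (n.+1%:R * C * x * b) + M * x * (Cn * a))) / (c * x) <= B4 * (a + b).
  exists (n%:R * Cr * Cn / c * (n.+1%:R * C + M)) => [|x a b x0 a0 b0].
    apply: mulr_ge0; last by rewrite addr_ge0.
    by rewrite !mulr_ge0 ?invr_ge0// ltW.
  have -> : n%:R * (Cr * (Cn * (n.+1%:R * C * x * b) + M * x * (Cn * a))) / (c * x) =
      n%:R * Cr * Cn / c * (n.+1%:R * C * b + M * a).
    have := lt0r_neq0 x0; have := lt0r_neq0 c0; move: (n.+1%:R : R) (n%:R : R) => m1 m c'0 x'0.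
    by field; rewrite c'0 x'0.
  rewrite -[leRHS]mulrA ler_wpM2l//; first by rewrite !mulr_ge0 ?invr_ge0// ltW.
  by have := mulr_ge0 nC0 a0; have := mulr_ge0 M0 b0; move: (n.+1%:R * C) => m1; lra.
have [B2 B20 id2] : exists2 B2 : R, 0 <= B2 & forall x y, M * x * (B4 * y) = B2 * x * y.
  by exists (M * B4) => [|x y]; [rewrite mulr_ge0|ring].
have [B3 B30 id3] : exists2 B3 : R, 0 <= B3 & forall x, Cr * (Cn * x) = B3 * x.
  by exists (Cr * Cn) => [|x]; [rewrite mulr_ge0 ?ltW|rewrite mulrA].
have scale (m x y z : R) : m * (Cr * (M * x * y)) * z = M * x * (m * (Cr * y) * z) by ring.
have [B [[B0 B1B B2B] [B3B B4B]]] : exists B : R, [/\ 0 <= B, B1 <= B & B2 <= B] /\ [/\ B3 <= B & B4 <= B].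
  by exists (B1 + B2 + B3 + B4); do !split; lra.
exists B => //.
move=> T F D G phi psi S hT hTh0 regF ST HG HL Pphi Ppsi phiD psiD phiH psiH e g err.
set h := mesh_size T in hT hTh0 phiH psiH *.
have Pe j : in_Pk k (fun xi => e xi 0 j).
  rewrite (_ : (fun xi => e xi 0 j) = (fun xi => phi xi 0 j - psi xi 0 j)); last first.
    by apply/funext => xi; rewrite !mxE.
  exact: in_PkB.
have Iq (q : 'rV[R]_n -> R) : in_Pk k q -> interpolant k q = q by exact: interpolant_Pk.
pose N0 j := nodal_norm k (fun xi => e xi 0 j).
pose N1 (p : 'I_n * 'I_n.+1) := nodal_norm k (vpartial e p.1 p.2).
have [j0 Hj0] : exists j0, forall j, N0 j <= N0 j0.
  exists [arg max_(j > ord0) N0 j]%O => j.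
  by case: Order.TotalTheory.arg_maxP => // j' _; exact.
have [p1 Hp1] : exists p1, forall p, N1 p <= N1 p1.
  exists [arg max_(p > (Ordinal n0, ord0)) N1 p]%O => p.
  by case: Order.TotalTheory.arg_maxP => // p' _; exact.
have A0 : 0 < n.+1%:R * C * h by rewrite !mulr_gt0.
pose q xi := e xi 0 j0.
pose q' xi := (n.+1%:R * C * h)^-1 * vpartial e p1.1 p1.2 xi.
have Nq' : N1 p1 = n.+1%:R * C * h * nodal_norm k q'.
  rewrite /q' nodal_normZ gtr0_norm ?invr_gt0// mulrA mulfV ?gt_eqF// mul1r//.
have N00 j : 0 <= N0 j by exact: nodal_norm_ge0.
have N10 p : 0 <= N1 p by exact: nodal_norm_ge0.
have Nq0 : 0 <= nodal_norm k q' by exact: nodal_norm_ge0.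
have hxi0 xi : ref_simplex xi -> forall j, `|e xi 0 j| <= Cn * N0 j0.
  move=> hxi j; have := (HCn (fun xi => e xi 0 j) xi hxi).1.
  rewrite (Iq _ (Pe j)) => /le_trans; apply; rewrite ler_wpM2l ?(ltW Cn0)//; exact: Hj0.
have vpB xi i j : vpartial e i j xi = vpartial phi i j xi - vpartial psi i j xi.
  rewrite /vpartial (_ : (fun xi => e xi 0 j) = (fun xi => phi xi 0 j - psi xi 0 j)); last first.
    by apply/funext => eta; rewrite !mxE.
  have [d1 _] := is_derive_Pk (Pphi j) xi (basis_vec R i).
  have [d2 _] := is_derive_Pk (Ppsi j) xi (basis_vec R i).
  exact: deriveB.
have hxi1 xi : ref_simplex xi -> forall i j,
    `|vpartial phi i j xi - vpartial psi i j xi| <= Cn * N1 p1.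
  move=> hxi i j; rewrite -vpB.
  have := (HCn (vpartial e i j) xi hxi).1.
  rewrite (Iq _ (in_Pk_partial i (Pe j))) => /le_trans; apply.
  by rewrite ler_wpM2l ?(ltW Cn0)//; exact: (Hp1 (i, j)).
have inverse : N1 p1 <= C2 * (Cn * N0 j0).
  apply: HC2 => xi hxi.
  have := (HCn (fun xi => e xi 0 p1.2) xi hxi).2 p1.1; rewrite (Iq _ (Pe _)) => /le_trans; apply.
  by rewrite ler_wpM2l ?(ltW Cn0)//; exact: Hj0.
exists q, q'; split=> [|xi hxi|xi hxi|xi hxi].
- split; first exact: Pe.
  by apply/in_PkZ/in_Pk_partial/Pe.
- exact: coord_le_enorm.
- rewrite /q' normrM gtr0_norm ?invr_gt0// ler_pdivrMl//.
  apply: le_trans (partial_le_tgrad c0 hT regF ST (fun eta => e eta 0 p1.2) p1.1 hxi) _.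
  by rewrite ler_wpM2l ?(ltW A0)//; exact: tgrad_norm_le_vec.
have [e1 e2 e3 e4] := HCr D G phi psi (M * h) (Cn * N0 j0) (Cn * N1 p1) HG HL Pphi Ppsi
  (mulr_ge0 M0 (ltW hT)) (mulr_ge0 (ltW Cn0) (N00 j0)) (mulr_ge0 (ltW Cn0) (N10 p1))
  phiD psiD phiH psiH hxi0 hxi1 xi hxi.
rewrite -/g in e1 e2 e3 e4; rewrite -/err in e2; rewrite -/(err xi) in e1.
have t2 := tgrad_norm_le c0 hT regF ST hxi e2.
have t4 := tgrad_norm_le c0 hT regF ST hxi e4.
rewrite -/h Nq' in t2 t4 e1 e3; rewrite -/h -[nodal_norm k q]/(N0 j0).
rewrite Nq' in inverse.
have a0 := N00 j0; move: t2 t4 e1 e3 inverse Nq0 a0.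
move: (nodal_norm k q') (N0 j0) => b a t2 t4 e1 e3 inverse b0 a0.
have t4' := le4 h a b hT a0 b0.
have ge0 : 0 <= a + b by rewrite addr_ge0.
split.
- apply: (le_trans e1); apply: (@le_trans _ _ (B1 * h * a)); last first.
    rewrite ler_wpM2r// ler_wpM2r ?(ltW hT)//.
  apply: (@le_trans _ _ (Cr * (M * h * (Cn * (C2 * (Cn * a)) + M * h0 * (Cn * a))))).
    rewrite ler_wpM2l ?(ltW Cr0)// ler_wpM2l ?mulr_ge0 ?(ltW hT)//.
    apply: lerD; first by rewrite ler_wpM2l ?(ltW Cn0).
    by rewrite ler_wpM2r ?ler_wpM2l// mulr_ge0 ?(ltW Cn0).
  by rewrite id1.
- apply: (le_trans t2); rewrite scale.
  apply: (le_trans (ler_wpM2l (mulr_ge0 M0 (ltW hT)) t4')).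
  by rewrite id2 ler_wpM2r// ler_wpM2r ?(ltW hT)//; lra.
- by apply: (le_trans e3); rewrite id3 ler_wpM2r//.
- apply: (le_trans t4); apply: (le_trans t4').
  by rewrite ler_wpM2r//.
Qed.

End element_estimates.

(** * The estimates on the discrete interface *)

Lemma eq_interpolant (R : realType) (n k : nat) (u v : 'rV[R]_n -> R) : (0 < k)%N ->
  (forall xi, ref_simplex xi -> u xi = v xi) -> interpolant k u = interpolant k v.
Proof.
move=> k0 uv; apply/funext => xi; apply: eq_bigr => a aok; rewrite uv//.
exact: ref_simplex_node.
Qed.

Lemma finite_element_polynomial (R : realType) (n k : nat) (T : mesh R n.+1) a
    (phi : 'rV[R]_n.+1 -> 'rV[R]_n.+1) S : in_Sh_vec T k a phi -> S \in facets T ->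
  exists2 P : 'rV[R]_n -> 'rV[R]_n.+1, vector_Pk k P &
    forall xi, ref_simplex xi -> pull T k a phi S xi = P xi.
Proof.
move=> Hphi ST.
have /choice[q Hq] : forall j : 'I_n.+1, exists q : 'rV[R]_n -> R, in_Pk k q /\
    forall xi, ref_simplex xi -> pull T k a (fun x => phi x 0 j) S xi = q xi.
  by move=> j; have [_ /(_ S ST)[q Pq Hq]] := Hphi j; exists q.
exists (fun xi => \row_j q j xi) => [j|xi hxi].
  rewrite (_ : (fun xi => _) = q j); first by have [] := Hq j.
  by apply/funext => xi; rewrite mxE.
by apply/rowP => j; rewrite mxE -((Hq j).2 _ hxi).
Qed.

Theorem lemmaC3 (R : realType) (d k : nat) (hd : d = 2%N \/ d = 3%N)
    (hk : (3 <= k)%N) (Gamma0 Omega N : set 'rV[R]_d)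
    (a0 : 'rV[R]_d -> 'rV[R]_d) (sigma tau C0 : R)
    (hOmega : bounded_domain Omega)
    (hGamma0 : closed_hypersurface k.+2 Gamma0)
    (hGammaOmega : Gamma0 `<=` Omega)
    (ha0 : distance_projection k.+1 Gamma0 N a0) :
  exists2 h0 : R, 0 < h0 &
  forall (D : set 'rV[R]_d) (Mf Mphi Mpsi : R),
    open D -> locally_quasiconvex D ->
  exists C : R,
  forall (p : \bar R) (T : mesh R d), (1 <= p)%E ->
    admissible T k a0 Gamma0 Omega N sigma tau C0 -> mesh_size T <= h0 ->
  let F := curved_map T k a0 in
  let h := mesh_size T in
  forall (f : 'rV[R]_d -> R) (phi psi : 'rV[R]_d -> 'rV[R]_d),
    (forall x, D x -> {for x, continuous f}) ->
    (sobolev_infty_norm k.+2 D f <= Mf%:E)%E ->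
    in_Sh_vec T k a0 phi -> in_Sh_vec T k a0 psi ->
    (forall x, curved_interface T k a0 x -> D (phi x) /\ D (psi x)) ->
    (W1p_norm_vec T F +oo (pull T k a0 phi) <= Mphi%:E)%E ->
    (W1p_norm_vec T F +oo (pull T k a0 psi) <= Mpsi%:E)%E ->
  let g := fun x => f (phi x) - f (psi x) in
  let e := pull T k a0 (fun x => phi x - psi x) in
  [/\ (Lp_norm T F p (interp_error T k a0 g)
         <= (C * h)%:E * Lp_norm_vec T F p e)%E,
      (Lp_norm_grad T F p (interp_error T k a0 g)
         <= (C * h)%:E * W1p_norm_vec T F p e)%E,
      (Lp_norm T F p (interp T k a0 g) <= C%:E * Lp_norm_vec T F p e)%E &
      (W1p_norm T F p (interp T k a0 g) <= C%:E * W1p_norm_vec T F p e)%E].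
Proof.
have [n n0 dE] : exists2 n, (0 < n)%N & d = n.+1.
  by case: hd => ->; [exists 1%N|exists 2%N].
subst d; clear hd; pose intK := (@ref_simplex R n)°.
have k0 : (0 < k)%N by exact: leq_trans hk.
have [_ cG _] := hGamma0.
have [h0 [c [Cg [h00 c0 Cg0 Hgeo]]]] :=
  @curved_elements_regular R n k k.+1 n0 k0 Gamma0 Omega N a0 sigma tau C0 cG
    (leq_trans (isT : 2 <= 3)%N (leqW hk)) ha0.
exists h0 => // D Mf Mphi Mpsi oD qD.
have [L L0 HL] := @sobolev_C21 R n.+1 k.+2 Mf (leqW (leqW hk)).
have [KG KG0 HK] := quasiconvex_lipschitz qD L0.
have [rho0 [D0 [rho00 D00 box]]] := @Pk_large_on_box R n k k0.
have [Cn Cn0 HCn] := @nodal_norm_bound R n k.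
have [M [M0 Mphi_le Mpsi_le]] : exists M : R, [/\ 0 <= M,
    Cn * (D0 * (n.+1%:R * Cg)) * `|Mphi| <= M & Cn * (D0 * (n.+1%:R * Cg)) * `|Mpsi| <= M].
  have A0 : 0 <= Cn * (D0 * (n.+1%:R * Cg)) by rewrite !mulr_ge0 ?(ltW Cn0) ?(ltW D00) ?(ltW Cg0).
  exists (Cn * (D0 * (n.+1%:R * Cg)) * (`|Mphi| + `|Mpsi|)).
  split; first by rewrite mulr_ge0// addr_ge0.
    by apply: ler_wpM2l; rewrite // lerDl.
  by apply: ler_wpM2l; rewrite // lerDr.
have [B B0 HB] := @element_estimates R n k n0 k0 c Cg c0 Cg0 L KG M h0 L0 KG0 M0 (ltW h00).
pose c1 := c ^+ n / n`!%:R.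
pose C1 := n`!%:R * n.+1%:R ^+ n * Cg ^+ n.
have c10 : 0 < c1 by rewrite divr_gt0 ?exprn_gt0// ltr0n fact_gt0.
have C10 : 0 < C1 by rewrite !mulr_gt0 ?exprn_gt0// ltr0n fact_gt0.
pose K := comparison_constant n rho0 D0 c1 C1.
have K0 : 0 < K by exact: comparison_constant_gt0.
exists (6 * (K * B)).
move=> p T p1 adm hh0 F h f phi psi cf Mfle Hphi Hpsi HD Wphi Wpsi g e.
have [hT regF] := Hgeo T adm hh0.
have [G HG Gf] := HL D f oD cf Mfle.
have data S : S \in facets T -> exists q q' : 'rV[R]_n -> R, [/\ in_Pk k q /\ in_Pk k q',
    forall xi, intK xi -> `|q xi| <= `|enorm (e S xi)|,
    forall xi, intK xi -> `|q' xi| <= `|tgrad_norm_vec (F S) (e S) xi| &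
    forall xi, intK xi ->
    [/\ `|interp_error T k a0 g S xi| <= B * h * nodal_norm k q,
        `|tgrad_norm (F S) (interp_error T k a0 g S) xi|
          <= B * h * (nodal_norm k q + nodal_norm k q'),
        `|interp T k a0 g S xi| <= B * nodal_norm k q &
        `|tgrad_norm (F S) (interp T k a0 g S) xi|
          <= B * (nodal_norm k q + nodal_norm k q')]].
  move=> ST.
  have [P PP phiP] := finite_element_polynomial Hphi ST.
  have [Q PQ psiQ] := finite_element_polynomial Hpsi ST.
  have onD xi : ref_simplex xi -> D (phi (F S xi)) /\ D (psi (F S xi)).
    by move=> hxi; apply: HD; exists S => //; exists xi.
  have DP xi : ref_simplex xi -> D (P xi) by move=> hxi; rewrite -phiP//; exact: (onD _ hxi).1.
  have DQ xi : ref_simplex xi -> D (Q xi) by move=> hxi; rewrite -psiQ//; exact: (onD _ hxi).2.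
  have dP : forall xi, ref_simplex xi -> forall i j, `|vpartial P i j xi| <= M * h.
    move=> xi hxi i j; apply: le_trans (ler_wpM2r (ltW hT) Mphi_le).
    exact: (vpartial_le_W1oo c0 Cg0 hT regF ST k0 rho00 D00 Cn0 box
      (fun g xi hxi => (HCn g xi hxi).1) PP phiP Wphi hxi).
  have dQ : forall xi, ref_simplex xi -> forall i j, `|vpartial Q i j xi| <= M * h.
    move=> xi hxi i j; apply: le_trans (ler_wpM2r (ltW hT) Mpsi_le).
    exact: (vpartial_le_W1oo c0 Cg0 hT regF ST k0 rho00 D00 Cn0 box
      (fun g xi hxi => (HCn g xi hxi).1) PQ psiQ Wpsi hxi).
  have [q [q' [Pqq' qe q'e est]]] := HB T F D G P Q S hT hh0 regF ST HG (HK _ HG) PP PQ DP DQ dP dQ.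
  have eE xi : ref_simplex xi -> e S xi = P xi - Q xi by move=> hxi; rewrite -phiP// -psiQ.
  have gE xi : ref_simplex xi -> pull T k a0 g S xi = G [::] (P xi) - G [::] (Q xi).
    by move=> hxi; rewrite !Gf; [rewrite -phiP// -psiQ|exact: DQ|exact: DP].
  have IE : interp T k a0 g S = interpolant k (fun xi => G [::] (P xi) - G [::] (Q xi)).
    by rewrite /interp lagrangeE//; exact: eq_interpolant.
  have errE xi : ref_simplex xi -> interp_error T k a0 g S xi =
      (G [::] (P xi) - G [::] (Q xi)) - interpolant k (fun xi => G [::] (P xi) - G [::] (Q xi)) xi.
    by move=> hxi; rewrite /interp_error IE gE.
  exists q, q'; split=> // xi Ixi; have hxi := interior_subset Ixi.
  - by rewrite eE//; apply: le_trans (ler_norm _); exact: qe.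
  - rewrite (eq_tgrad_norm_vec F S Ixi eE); apply: le_trans (ler_norm _); exact: q'e.
  - have [h1 h2 h3 h4] := est xi hxi.
    have t0 u : 0 <= tgrad_norm (F S) u xi by exact: enorm_ge0.
    split.
    + by rewrite errE.
    + rewrite (ger0_norm (t0 (interp_error T k a0 g S))).
      by have -> := eq_tgrad_norm F S Ixi errE; exact: h2.
    + by rewrite IE.
    + by rewrite IE (ger0_norm (t0 (interpolant k (fun xi => G [::] (P xi) - G [::] (Q xi))))).
have h_n : 0 < h ^+ n by rewrite exprn_gt0.
have areaF S : S \in facets T -> forall xi, ref_simplex xi ->
    c1 * h ^+ n <= area_element (F S) xi <= C1 * h ^+ n.
  by move=> ST xi hxi; exact: (area_element_bounds c0 Cg0 hT regF ST hxi).
pose X := Lp_norm_vec T F p e.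
pose Y := Lp_norm T F p (fun S => tgrad_norm_vec (F S) (e S)).
have X0 : (0 <= X)%E by exact: Lp_norm_ge0.
have Y0 : (0 <= Y)%E by exact: Lp_norm_ge0.
have comparison u v' b := @Lp_norm_comparison R n k rho0 D0 rho00 D00 box c1 C1 c10 C10 T F
  (h ^+ n) h_n areaF p u (fun S xi => enorm (e S xi)) v' b p1.
have K2_ge0 b : 0 <= b -> 0 <= K * (2 * b).
  by move=> b0; apply: mulr_ge0; [exact: ltW|exact: mulr_ge0].
have byX u b : 0 <= b -> (forall S, S \in facets T -> exists q : 'rV[R]_n -> R, [/\ in_Pk k q,
      forall xi, intK xi -> `|q xi| <= `|enorm (e S xi)| &
      forall xi, intK xi -> `|u S xi| <= b * nodal_norm k q]) ->
    (Lp_norm T F p u <= (4 * (K * b))%:E * X)%E.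
  move=> b0 Hu.
  have H : (Lp_norm T F p u <= (K * (2 * b))%:E * (X + X))%E.
    apply: comparison => // S /Hu[q [Pq qe uq]]; exists q, q; split=> // xi /uq/le_trans.
    by apply; rewrite ler_wpM2l// lerDl nodal_norm_ge0.
  have -> : 4 * (K * b) = K * (2 * b) + K * (2 * b) by ring.
  have K2b : (0 <= (K * (2 * b))%:E)%E by rewrite lee_fin K2_ge0.
  by rewrite EFinD ge0_muleDl// -ge0_muleDr.
have KB0 : 0 <= K * B by rewrite mulr_ge0// ltW.
have KBh0 : 0 <= K * (B * h) by rewrite mulrA mulr_ge0// ltW.
have c6 : 6 * (K * B) * h = 6 * (K * (B * h)) by rewrite (mulrA K B h) (mulrA 6 (K * B) h).
have Bh0 : 0 <= B * h by rewrite mulr_ge0// ltW.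
have I3 : (Lp_norm T F p (interp T k a0 g) <= (4 * (K * B))%:E * X)%E.
  by apply: byX => // S /data[q [q' [[Pq _] qe _ est]]]; exists q; split=> // xi /est[].
have XY0 : (0 <= X + Y)%E by rewrite adde_ge0.
rewrite -[W1p_norm_vec T F p e]/(X + Y)%E -/X; split.
- apply: (@le_trans _ _ ((4 * (K * (B * h)))%:E * X)%E).
    by apply: byX => // S /data[q [q' [[Pq _] qe _ est]]]; exists q; split=> // xi /est[].
  by apply: lee_wpmul2r; rewrite // lee_fin c6 ler_wpM2r// ler_nat.
- apply: (@le_trans _ _ ((K * (2 * (B * h)))%:E * (X + Y))%E).
    by apply: comparison => // S /data[q [q' [Pqq' qe q'e est]]]; exists q, q'; split=> // xi /est[].
  by apply: lee_wpmul2r; rewrite // lee_fin c6 mulrCA ler_wpM2r// ler_nat.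
- by apply: (le_trans I3); apply: lee_wpmul2r; rewrite // lee_fin ler_wpM2r// ler_nat.
- have I4 : (Lp_norm_grad T F p (interp T k a0 g) <= (K * (2 * B))%:E * (X + Y))%E.
    by apply: comparison => // S /data[q [q' [Pqq' qe q'e est]]]; exists q, q'; split=> // xi /est[].
  have -> : 6 * (K * B) = 4 * (K * B) + K * (2 * B) by ring.
  have KB4 : 0 <= 4 * (K * B) by exact: mulr_ge0.
  rewrite EFinD ge0_muleDl ?lee_fin ?K2_ge0//.
  apply: (leeD _ I4); apply: (le_trans I3); apply: lee_wpmul2l; rewrite ?lee_fin//.
  by rewrite leeDl.
Qed.
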